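(* Assume that $g:\mathbb R^N\to\mathbb R$ is bounded and continuous, that $(\mathbf H_\Omega)$ holds and that the dynamics and costs $b_i,l_i$ satisfy (C1)--(C4) (see context). Then the value functions $\mathbf U^-$ and $\mathbf U^+$ are both viscosity solutions (in the discontinuous sense) of $u_t+H(x,t,Du)=0$ in $\mathbb R^N\times(0,T)$, i.e. $(\mathbf U^\pm)^*$ satisfy the subsolution inequalities (Sub) and $(\mathbf U^\pm)_*$ satisfy the supersolution inequalities (Sup). Moreover, $\mathbf U^-$ is a subsolution of $u_t+\mathbb H^-(x,t,Du)=0$, i.e. $(\mathbf U^-)^*$ also satisfies $w_t+H_T(x,t,D_{\mathcal H}w)\le 0$ on $\mathcal H\times(0,T)$, while $\mathbf U^+$ is a subsolution of $u_t+\mathbb H^+(x,t,Du)=0$, i.e. $(\mathbf U^+)^*$ also satisfies $w_t+H_T^{\rm reg}(x,t,D_{\mathcal H}w)\le 0$ on $\mathcal H\times(0,T)$.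
   Context: Geometry $(\mathbf H_\Omega)$: $\mathbb R^N=\Omega_1\cup\Omega_2\cup\mathcal H$, where $\Omega_1,\Omega_2$ are disjoint open sets and $\mathcal H=\partial\Omega_1=\partial\Omega_2$ is a $W^{2,\infty}$-hypersurface (the signed distance to $\mathcal H$ is $W^{2,\infty}$ in a neighbourhood of $\mathcal H$). For $z\in\mathcal H$, $\mathbf n_i(z)$ is the unit normal to $\partial\Omega_i$ at $z$ pointing outwards $\Omega_i$ (so $\mathbf n_2=-\mathbf n_1$). $T_z\mathcal H$ is the tangent space, $D_{\mathcal H}$ the tangential gradient on $\mathcal H$. Control data: $T>0$; for $i=1,2$, $b_i:\overline{\Omega_i}\times[0,T]\times A_i\to\mathbb R^N$, $l_i:\overline{\Omega_i}\times[0,T]\times A_i\to\mathbb R$. (C1) $A_i$ is a compact metric space, $b_i$ is continuous, $|b_i|\le M_b$ and $|b_i(z,s,\alpha_i)-b_i(z',s',\alpha_i)|\le L_b(|z-z'|+|s-s'|)$. (C2) $l_i$ is uniformly continuous, $|l_i|\le M_l$, and $|l_i(z,s,\alpha_i)-l_i(z',s',\alpha_i)|\le m_l(|z-z'|+|s-s'|)$ for a modulus of continuity $m_l$. (C3) For all $z\in\overline{\Omega_i}$, $s\in[0,T]$, the set $\{(b_i(z,s,\alpha_i),l_i(z,s,\alpha_i)):\alpha_i\in A_i\}$ is closed and convex. (C4) There is $\delta>0$ such that for $i=1,2$, $z\in\mathcal H$, $s\in[0,T]$: $\{b_i(z,s,\alpha_i)\cdot\mathbf n_i(z):\alpha_i\in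 A_i\}\supset[-\delta,\delta]$. Interface dynamics: $A:=A_1\times A_2\times[0,1]$; for $z\in\mathcal H$, $a=(\alpha_1,\alpha_2,\mu)\in A$, $b_{\mathcal H}(z,s,a)=\mu b_1(z,s,\alpha_1)+(1-\mu)b_2(z,s,\alpha_2)$, $l_{\mathcal H}(z,s,a)=\mu l_1(z,s,\alpha_1)+(1-\mu)l_2(z,s,\alpha_2)$; $A_0(z,s)=\{a\in A: b_{\mathcal H}(z,s,a)\cdot\mathbf n_1(z)=0\}$; $A_0^{\rm reg}(z,s)=\{a\in A_0(z,s): b_i(z,s,\alpha_i)\cdot\mathbf n_i(z)\ge0,\ i=1,2\}$. Trajectories: for $(x,t)\in\mathbb R^N\times[0,T)$, $\mathcal T_{x,t}$ is the set of pairs $(X,a)$ with $X:[0,t]\to\mathbb R^N$ Lipschitz, $X(0)=x$, $a=(\alpha_1,\alpha_2,\mu)\in L^\infty(0,t;A)$ and, for a.e. $s\in(0,t)$, $\dot X(s)=\sum_{i=1,2}b_i(X(s),t-s,\alpha_i(s))\mathbf 1_{\{X(s)\in\Omega_i\}}+b_{\mathcal H}(X(s),t-s,a(s))\mathbf 1_{\{X(s)\in\mathcal H\}}$. $\mathcal T^{\rm reg}_{x,t}$ is the subset of those with $a(s)\in A_0^{\rm reg}(X(s),t-s)$ for a.e. $s$ with $X(s)\in\mathcal H$. The cost is $J(x,t;(X,a))=\int_0^t\ell(X(s),t-s,a(s))\,ds+g(X(t))$, with $\ell(X(s),t-s,a(s))=\sum_i l_i(X(s),t-s,\alpha_i(s))\mathbf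 1_{\{X(s)\in\Omega_i\}}+l_{\mathcal H}(X(s),t-s,a(s))\mathbf 1_{\{X(s)\in\mathcal H\}}$. Value functions: $\mathbf U^-(x,t)=\inf_{\mathcal T_{x,t}}J$, $\mathbf U^+(x,t)=\inf_{\mathcal T^{\rm reg}_{x,t}}J$. Hamiltonians: $H_i(x,t,p)=\sup_{\alpha_i\in A_i}\{-b_i(x,t,\alpha_i)\cdot p-l_i(x,t,\alpha_i)\}$ for $x\in\overline{\Omega_i}$; for $x\in\mathcal H$, $p\in T_x\mathcal H$: $H_T(x,t,p)=\sup_{a\in A_0(x,t)}\{-b_{\mathcal H}(x,t,a)\cdot p-l_{\mathcal H}(x,t,a)\}$ and $H_T^{\rm reg}$ is the same with $A_0^{\rm reg}(x,t)$. Viscosity notions. $w^*$, $w_*$ denote upper/lower semicontinuous envelopes. (Sub): a bounded usc $w$ satisfies, in the viscosity sense, $w_t+H_i(x,t,Dw)\le0$ in $\Omega_i\times(0,T)$, $i=1,2$, and $w_t+\min\{H_1(x,t,Dw),H_2(x,t,Dw)\}\le0$ on $\mathcal H\times(0,T)$ (tests: local maxima of $w-\phi$ in $\mathbb R^N\times(0,T)$, $\phi\in C^1$). (Sup): a bounded lsc $w$ satisfies $w_t+H_i(x,t,Dw)\ge0$ in $\Omega_i\times(0,T)$ and $w_t+\max\{H_1,H_2\}(x,t,Dw)\ge0$ on $\mathcal H\times(0,T)$ (tests: local minima in $\mathbb R^N\times(0,T)$). The inequality $w_t+H_T(x,t,D_{\mathcal H}w)\le0$ on $\mathcal H\times(0,T)$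 means: for every $\phi\in C^1(\mathcal H\times[0,T])$ and every maximum point $(x,t)\in\mathcal H\times(0,T)$ of $w|_{\mathcal H\times(0,T)}-\phi$, $\phi_t(x,t)+H_T(x,t,D_{\mathcal H}\phi(x,t))\le0$; similarly for $H_T^{\rm reg}$. *)

(* Defs.v *)
From HB Require Import structures.
From mathcomp Require Import all_boot all_order all_algebra.
From mathcomp Require Import all_classical all_reals all_analysis.
Import Order.TTheory GRing.Theory Num.Theory.
Import numFieldNormedType.Exports.

Set Implicit Arguments.
Unset Strict Implicit.
Unset Printing Implicit Defensive.

Local Open Scope classical_set_scope.
Local Open Scope ring_scope.

(* The library norm on 'rV[R]_N is the sup norm; lengths, distances and unit
   normals below are Euclidean. *)
Section Euclidean.
Context {R : realType} {N : nat}.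
Local Notation V := 'rV[R]_N.

Definition edot (u v : V) : R := \sum_(i < N) u 0 i * v 0 i.

Definition enorm (u : V) : R := Num.sqrt (edot u u).

Definition dist_to (S : set V) (x : V) : R := inf [set enorm (x - z) | z in S].

Definition grad (f : V -> R) (x : V) : V :=
  \row_(i < N) 'D_(delta_mx 0 i : V) f x.

Definition boundary (S : set V) : set V := closure S `\` interior S.

(* W^{2,oo}(D), D open, for the continuous representative: bounded, C^1 with
   bounded gradient, and gradient Lipschitz with a constant uniform over all
   segments (equivalently, balls) contained in D. *)
Definition W2infty_on (D : set V) (f : V -> R) : Prop :=
  (forall x, D x -> differentiable f x) /\
  exists K : R,
    (forall x, D x -> `|f x| <= K /\ enorm (grad f x) <= K) /\
    (forall x y, (forall r, 0 <= r <= 1 -> D (x + r *: (y - x))) ->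
       enorm (grad f y - grad f x) <= K * enorm (y - x)).

(* v belongs to T_z S *)
Definition tangent (S : set V) (z v : V) : Prop :=
  exists c : R -> V,
    [/\ c 0 = z, (\forall r \near 0, S (c r)) & is_derive (0 : R) 1 c v].

Definition outward_unit_normal (Om : set V) (z n : V) : Prop :=
  [/\ enorm n = 1,
      (forall v, tangent (boundary Om) z v -> edot n v = 0) &
      \forall r \near 0^'+, ~ closure Om (z + r *: n)].

End Euclidean.

Section Data.
Context (R : realType) (N : nat).
Local Notation V := 'rV[R]_N.

(* The data attached to one of the two open sets. The functions dyn and cost
   are only meaningful on closure dom x [0,T] x ctrl, and normal on the
   interface. *)
Record region := Region {
  dom : set V ;
  normal : V -> V ;
  ctrl : metricType R ;
  dyn : V -> R -> ctrl -> V ;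
  cost : V -> R -> ctrl -> R }.

Record control_problem := ControlProblem {
  horizon : R ;
  iface : set V ;
  reg1 : region ;
  reg2 : region ;
  terminal : V -> R }.

End Data.

Section Assumptions.
Context {R : realType} {N : nat}.
Local Notation V := 'rV[R]_N.
Implicit Types (P : control_problem R N) (G : region R N).

Definition signed_dist P (x : V) : R :=
  if x \in dom (reg1 P) then - dist_to (iface P) x else dist_to (iface P) x.

Definition W2infty_hypersurface P : Prop :=
  exists D : set V,
    [/\ open D, iface P `<=` D & W2infty_on D (signed_dist P)].

Definition H_Omega P : Prop :=
  [/\ [/\ open (dom (reg1 P)), open (dom (reg2 P)),
          dom (reg1 P) `&` dom (reg2 P) = set0 &
          dom (reg1 P) `|` dom (reg2 P) `|` iface P = [set: V]],
      iface P = boundary (dom (reg1 P)),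
      iface P = boundary (dom (reg2 P)),
      W2infty_hypersurface P &
      (forall z, iface P z ->
         outward_unit_normal (dom (reg1 P)) z (normal (reg1 P) z) /\
         outward_unit_normal (dom (reg2 P)) z (normal (reg2 P) z))].

Definition spacetime G (T : R) (z : V) (s : R) : Prop :=
  closure (dom G) z /\ 0 <= s <= T.

(* Control sets are nonempty; (C4) only gives this when the interface is
   nonempty. *)
Definition C1 (T : R) G : Prop :=
  [/\ [set: ctrl G] !=set0,
      compact [set: ctrl G],
      {within [set p : V * R * ctrl G | spacetime G T p.1.1 p.1.2],
        continuous (fun p => dyn p.1.1 p.1.2 p.2)},
      (exists Mb : R, forall z s a, spacetime G T z s ->
         enorm (@dyn _ _ G z s a) <= Mb) &
      (exists Lb : R, forall z s z' s' a,
         spacetime G T z s -> spacetime G T z' s' ->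
         enorm (@dyn _ _ G z s a - dyn z' s' a)
           <= Lb * (enorm (z - z') + `|s - s'|))].

Definition modulus (m : R -> R) : Prop :=
  [/\ m 0 = 0, (forall r r', 0 <= r -> r <= r' -> m r <= m r') &
      m r @[r --> 0^'+] --> 0].

Definition C2 (T : R) G : Prop :=
  [/\ (forall e, 0 < e -> exists2 d, 0 < d &
         forall z s z' s' (a a' : ctrl G),
           spacetime G T z s -> spacetime G T z' s' ->
           enorm (z - z') < d -> `|s - s'| < d -> mdist a a' < d ->
           `|cost z s a - cost z' s' a'| < e),
      (exists Ml : R, forall z s a, spacetime G T z s ->
         `|@cost _ _ G z s a| <= Ml) &
      (exists2 ml, modulus ml & forall z s z' s' a,
         spacetime G T z s -> spacetime G T z' s' ->
         `|@cost _ _ G z s a - cost z' s' a|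
           <= ml (enorm (z - z') + `|s - s'|))].

Definition C3 (T : R) G : Prop :=
  forall z s, spacetime G T z s ->
    let E : set (V * R^o) :=
      [set (dyn z s a, cost z s a : R^o) | a in [set: ctrl G]] in
    closed E /\ convex_set E.

Definition C4 P : Prop :=
  exists2 d : R, 0 < d & forall z s r,
    iface P z -> 0 <= s <= horizon P -> - d <= r <= d ->
    (exists a, edot (@dyn _ _ (reg1 P) z s a) (normal (reg1 P) z) = r) /\
    (exists a, edot (@dyn _ _ (reg2 P) z s a) (normal (reg2 P) z) = r).

Definition control_assumptions P : Prop :=
  [/\ C1 (horizon P) (reg1 P) /\ C1 (horizon P) (reg2 P),
      C2 (horizon P) (reg1 P) /\ C2 (horizon P) (reg2 P),
      C3 (horizon P) (reg1 P) /\ C3 (horizon P) (reg2 P) &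
      C4 P].

End Assumptions.

Section Control.
Context {R : realType} {N : nat} (P : control_problem R N).
Local Notation V := 'rV[R]_N.
Local Notation mu := (@lebesgue_measure R).
Local Notation T := (horizon P).
Local Notation Om1 := (dom (reg1 P)).
Local Notation Om2 := (dom (reg2 P)).
Local Notation Ga := (iface P).
Local Notation n1 := (normal (reg1 P)).
Local Notation n2 := (normal (reg2 P)).
Local Notation b1 := (@dyn _ _ (reg1 P)).
Local Notation b2 := (@dyn _ _ (reg2 P)).
Local Notation l1 := (@cost _ _ (reg1 P)).
Local Notation l2 := (@cost _ _ (reg2 P)).

(* Triples (alpha_1, alpha_2, mu); the set A is cut out by 0 <= mu <= 1. *)
Definition control : Type := (ctrl (reg1 P) * ctrl (reg2 P) * R)%type.

Definition ctrl_set : set control := [set a | 0 <= a.2 <= 1].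

Definition dyn_iface (z : V) (s : R) (a : control) : V :=
  a.2 *: b1 z s a.1.1 + (1 - a.2) *: b2 z s a.1.2.

Definition cost_iface (z : V) (s : R) (a : control) : R :=
  a.2 * l1 z s a.1.1 + (1 - a.2) * l2 z s a.1.2.

Definition A0 (z : V) (s : R) : set control :=
  [set a | ctrl_set a /\ edot (dyn_iface z s a) (n1 z) = 0].

Definition A0reg (z : V) (s : R) : set control :=
  [set a | [/\ A0 z s a, 0 <= edot (b1 z s a.1.1) (n1 z) &
                         0 <= edot (b2 z s a.1.2) (n2 z)]].

Definition drift (x : V) (s : R) (a : control) : V :=
  (\1_Om1 x : R) *: b1 x s a.1.1 + (\1_Om2 x : R) *: b2 x s a.1.2
  + (\1_Ga x : R) *: dyn_iface x s a.

Definition running_cost (x : V) (s : R) (a : control) : R :=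
  \1_Om1 x * l1 x s a.1.1 + \1_Om2 x * l2 x s a.1.2
  + \1_Ga x * cost_iface x s a.

(* L^oo(0,t;A) through Borel representatives: every class has one since A is
   compact metric, and nothing below depends on the representative. *)
Definition Linfty_control (t : R) (a : R -> control) : Prop :=
  (forall s, s \in `[0, t] -> ctrl_set (a s)) /\
  (forall U : set (ctrl (reg1 P) * ctrl (reg2 P) * R), open U ->
     measurable (`[0, t]%classic `&` a @^-1` U)).

Definition trajectories (x : V) (t : R) : set ((R -> V) * (R -> control)) :=
  [set Xa | [/\ [lipschitz Xa.1 s | s in `[0, t]%classic],
                Xa.1 0 = x,
                Linfty_control t Xa.2 &
                {ae mu, forall s, s \in `]0, t[ ->
                   is_derive s 1 Xa.1 (drift (Xa.1 s) (t - s) (Xa.2 s))}]].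

Definition reg_trajectories (x : V) (t : R) : set ((R -> V) * (R -> control)) :=
  [set Xa | trajectories x t Xa /\
            {ae mu, forall s, s \in `]0, t[ -> Ga (Xa.1 s) ->
               A0reg (Xa.1 s) (t - s) (Xa.2 s)}].

Definition payoff (t : R) (Xa : (R -> V) * (R -> control)) : R :=
  \int[mu]_(s in `[0, t]) running_cost (Xa.1 s) (t - s) (Xa.2 s)
  + terminal P (Xa.1 t).

Definition Uminus (p : V * R) : R :=
  inf [set payoff p.2 Xa | Xa in trajectories p.1 p.2].

Definition Uplus (p : V * R) : R :=
  inf [set payoff p.2 Xa | Xa in reg_trajectories p.1 p.2].

Definition Ham (G : region R N) (x : V) (t : R) (p : V) : R :=
  sup [set - edot (dyn x t a) p - cost x t a | a in [set: ctrl G]].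

Definition Ham_on (C : V -> R -> set control) (x : V) (t : R) (p : V) : R :=
  sup [set - edot (dyn_iface x t a) p - cost_iface x t a | a in C x t].

Definition HT := Ham_on A0.

Definition HTreg := Ham_on A0reg.

(* The value functions are defined on R^N x [0,T). *)
Definition value_domain : set (V * R) := [set p | 0 <= p.2 < T].

Definition usc_env (w : V * R -> R) (p : V * R) : R :=
  fine (limf_esup (fun q => (w q)%:E) (within value_domain (nbhs p))).

Definition lsc_env (w : V * R -> R) (p : V * R) : R :=
  fine (limf_einf (fun q => (w q)%:E) (within value_domain (nbhs p))).

Definition cylinder : set (V * R) := [set p | 0 < p.2 < T].

Definition usc_on_cylinder (w : V * R -> R) : Prop :=
  forall p, cylinder p -> forall c, w p < c -> \forall q \near p, w q < c.

Definition lsc_on_cylinder (w : V * R -> R) : Prop :=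
  forall p, cylinder p -> forall c, c < w p -> \forall q \near p, c < w q.

Definition grad_x (phi : V * R -> R) (p : V * R) : V :=
  \row_(i < N) 'D_((delta_mx 0 i, 0) : V * R) phi p.

Definition d_t (phi : V * R -> R) (p : V * R) : R :=
  'D_((0, 1) : V * R) phi p.

Definition C1_cylinder (phi : V * R -> R) : Prop :=
  forall p, cylinder p ->
    differentiable phi p /\ forall v : V * R, {for p, continuous ('D_v phi)}.

Definition subsolution (w : V * R -> R) : Prop :=
  [/\ [bounded w p | p in cylinder], usc_on_cylinder w &
  forall phi p, C1_cylinder phi -> cylinder p ->
    (\forall q \near p, w q - phi q <= w p - phi p) ->
    let h1 := Ham (reg1 P) p.1 p.2 (grad_x phi p) in
    let h2 := Ham (reg2 P) p.1 p.2 (grad_x phi p) in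
    [/\ (Om1 p.1 -> d_t phi p + h1 <= 0),
        (Om2 p.1 -> d_t phi p + h2 <= 0) &
        (Ga p.1 -> d_t phi p + Num.min h1 h2 <= 0)]].

Definition supersolution (w : V * R -> R) : Prop :=
  [/\ [bounded w p | p in cylinder], lsc_on_cylinder w &
  forall phi p, C1_cylinder phi -> cylinder p ->
    (\forall q \near p, w p - phi p <= w q - phi q) ->
    let h1 := Ham (reg1 P) p.1 p.2 (grad_x phi p) in
    let h2 := Ham (reg2 P) p.1 p.2 (grad_x phi p) in
    [/\ (Om1 p.1 -> 0 <= d_t phi p + h1),
        (Om2 p.1 -> 0 <= d_t phi p + h2) &
        (Ga p.1 -> 0 <= d_t phi p + Num.max h1 h2)]].

Definition viscosity_solution (u : V * R -> R) : Prop :=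
  subsolution (usc_env u) /\ supersolution (lsc_env u).

Definition iface_cylinder : set (V * R) := [set p | Ga p.1 /\ 0 <= p.2 <= T].

(* phi is C^1 on the manifold Ga x [0,T], with tangential gradient Dphi and
   time derivative phit; only values on Ga x [0,T] matter. *)
Definition C1_iface (phi : V * R -> R) (Dphi : V * R -> V) (phit : V * R -> R) :
    Prop :=
  [/\ (forall p, iface_cylinder p -> tangent Ga p.1 (Dphi p)),
      (forall p, iface_cylinder p -> forall e, 0 < e ->
         \forall q \near within iface_cylinder (nbhs p),
           `|phi q - phi p - edot (Dphi p) (q.1 - p.1) - phit p * (q.2 - p.2)|
             <= e * (enorm (q.1 - p.1) + `|q.2 - p.2|)),
      {within iface_cylinder, continuous Dphi} &
      {within iface_cylinder, continuous phit}].

Definition iface_subsolution (ham : V -> R -> V -> R) (w : V * R -> R) : Prop :=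
  forall phi Dphi phit, C1_iface phi Dphi phit ->
  forall p, Ga p.1 -> cylinder p ->
    (forall q, Ga q.1 -> cylinder q -> w q - phi q <= w p - phi p) ->
    phit p + ham p.1 p.2 (Dphi p) <= 0.

End Control.

(* Main.v *)
(** Along a trajectory [X] issued from [x] with [t] to go, a test function
    [phi] satisfies
    [phi(X(tau), t - tau) - phi(x, t) + int_0^tau l <= c tau] as soon as
    [b . Dphi - phi_t + l <= c] almost everywhere. If a subsolution inequality
    failed at [p], some control would make this rate negative at [p]; dynamic
    programming is then contradicted once a trajectory keeping the rate
    negative starts from every point near [p]. Away from the interface a
    constant control will do. On the interface, let [B_i = b_i . n_i]. By (C3)
    and (C4) the controls can be perturbed so that [B_1] and [B_2] are nonzero.
    If [B_i < 0], the constant control [alpha_i] leads into [Omega_i]. If [B_1]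
    and [B_2] have the same sign, the feedback [mu = B_2 / (B_1 + B_2)] makes
    [mu b_1 + (1 - mu) b_2] a Lipschitz field whose flow preserves the
    interface. The tangential inequalities reduce to the latter case, since
    every element of [A_0] has [B_1] and [B_2] of the same (weak) sign, and
    since a starting point off the interface can be brought to it in a time
    proportional to its distance. For the supersolution inequalities the rate
    is positive for all controls near [p], so the integrated inequality holds
    along every trajectory. *)
From HB Require Import structures.
From mathcomp Require Import all_boot all_order all_algebra.
From mathcomp Require Import all_classical all_reals all_analysis.
From mathcomp Require Import measurable_realfun ring lra.
Require Import Defs.
Import Order.TTheory GRing.Theory Num.Theory.
Import numFieldNormedType.Exports.
Set Implicit Arguments.
Unset Strict Implicit.
Unset Printing Implicit Defensive.
Local Open Scope classical_set_scope.
Local Open Scope ring_scope.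

(** * Euclidean geometry and derivatives along curves *)

(** A trajectory is differentiable only almost everywhere and its control is merely measurable, so
    the integrated inequality rests on a covering argument for Lipschitz functions whose derivative
    is bounded off a null set. For [Uplus] the strategies must moreover be regular: a curve that
    leaves the interface at once is so vacuously, and sliding with both dynamics pointing outwards
    is so by construction. Hence one boolean carries both value functions through the proof. An
    infimum over an empty set is 0 here, so regular trajectories must be built from every point;
    compactness gives a step length valid on the whole region that can be reached. The normals come
    without any regularity. Estimates use the gradient of the signed distance instead, which is
    Lipschitz near the interface, does not vanish on it, and is a positive multiple of each outward
    normal up to a sign. The envelope at a point is only approached at nearby points, so the time
    step must be fixed before the starting point: every strategy comes with a radius and a duration
    depending on the contact point alone. *)

Section Norms.
Context {R : realType} {N : nat}.
Local Notation V := 'rV[R]_N.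
Implicit Types (u v w : V) (c : R).

Lemma coord_le_norm u i : `|u 0 i| <= `|u|.
Proof.
by rewrite [leRHS]/Num.Def.normr/= mx_normrE; exact: (le_bigmax _ _ (0, i)).
Qed.

Lemma norm_le_coord u c : 0 <= c -> (forall i, `|u 0 i| <= c) -> `|u| <= c.
Proof.
move=> c0 uc; rewrite [leLHS]/Num.Def.normr/= mx_normrE (bigmax_le _ c0)//=.
by move=> [i j] _ /=; rewrite ord1.
Qed.

Lemma edotC u v : edot u v = edot v u.
Proof. by rewrite /edot; apply: eq_bigr => i _; rewrite mulrC. Qed.

Lemma edotDl u v w : edot (u + v) w = edot u w + edot v w.
Proof.
by rewrite /edot -big_split; apply: eq_bigr => i _; rewrite mxE mulrDl.
Qed.

Lemma edotZl c u v : edot (c *: u) v = c * edot u v.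
Proof.
by rewrite /edot mulr_sumr; apply: eq_bigr => i _; rewrite mxE mulrA.
Qed.

Lemma edotNl u v : edot (- u) v = - edot u v.
Proof. by rewrite -scaleN1r edotZl mulN1r. Qed.

Lemma edotBl u v w : edot (u - v) w = edot u w - edot v w.
Proof. by rewrite edotDl edotNl. Qed.

Lemma edotDr u v w : edot u (v + w) = edot u v + edot u w.
Proof. by rewrite edotC edotDl !(edotC u). Qed.

Lemma edotZr c u v : edot u (c *: v) = c * edot u v.
Proof. by rewrite edotC edotZl edotC. Qed.

Lemma edotNr u v : edot u (- v) = - edot u v.
Proof. by rewrite edotC edotNl edotC. Qed.

Lemma edotBr u v w : edot u (v - w) = edot u v - edot u w.
Proof. by rewrite edotDr edotNr. Qed.

Lemma edot0l u : edot 0 u = 0.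
Proof. by rewrite -[0 in LHS](scale0r u) edotZl mul0r. Qed.

Lemma edotvv_ge0 u : 0 <= edot u u.
Proof. by apply: sumr_ge0 => i _; rewrite -expr2 sqr_ge0. Qed.

Lemma edotvv_eq0 u : edot u u = 0 -> u = 0.
Proof.
move/eqP; rewrite psumr_eq0 => [|i _]; last by rewrite -expr2 sqr_ge0.
move/allP => h; apply/rowP => i; rewrite mxE.
by have /(_ (mem_index_enum i)) := h i; rewrite mulf_eq0 orbb => /eqP.
Qed.

Lemma edotvv_gt0 u : u != 0 -> 0 < edot u u.
Proof.
move=> u0; rewrite lt_neqAle edotvv_ge0 andbT eq_sym.
by apply: contra u0 => /eqP /edotvv_eq0 ->.
Qed.

(** Cauchy-Schwarz with sup norms costs a factor [N]; the factors [N%:R] in later constants come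
    from here and from [enorm_le_norm]. *)
Lemma edot_le u v : `|edot u v| <= N%:R * `|u| * `|v|.
Proof.
rewrite (le_trans (ler_norm_sum _ _ _))//.
apply: (@le_trans _ _ (\sum_(i < N) `|u| * `|v|)).
  by apply: ler_sum => i _; rewrite normrM ler_pM// coord_le_norm.
by rewrite sumr_const card_ord -[leLHS]mulr_natl mulrA.
Qed.

Lemma norm_le_enorm u : `|u| <= enorm u.
Proof.
apply: norm_le_coord => [|i]; first exact: sqrtr_ge0.
rewrite -sqrtr_sqr /enorm ler_sqrt ?edotvv_ge0// /edot (bigD1 i)//= -expr2 lerDl.
by apply: sumr_ge0 => j _; rewrite -expr2 sqr_ge0.
Qed.

Lemma enorm_le_norm u : enorm u <= N%:R * `|u|.
Proof.
have [u0|u0] := eqVneq u 0.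
  by rewrite u0 /enorm edot0l sqrtr0 normr0 mulr0.
have N1 : (1 : R) <= N%:R.
  rewrite ler1n; case: (posnP N) => // n0; exfalso.
  by move/eqP: u0; apply; apply/rowP => i; have := ltn_ord i; rewrite [X in (_ < X)%N]n0.
rewrite -[leRHS]ger0_norm ?mulr_ge0// -sqrtr_sqr /enorm ler_sqrt ?sqr_ge0//.
rewrite (le_trans (ler_norm _))// (le_trans (edot_le _ _))//.
have -> : (N%:R * `|u|) ^+ 2 = N%:R * (N%:R * `|u| * `|u|) by ring.
by rewrite ler_peMl// !mulr_ge0.
Qed.

Lemma enorm0 : enorm (0 : V) = 0.
Proof. by rewrite /enorm edot0l sqrtr0. Qed.

End Norms.

Section Calculus.
Context {R : realType}.

(** A form without quotients: error estimates on increments can simply be added, and [h = 0] need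
    not be excluded. *)
Lemma is_deriveP (W : normedModType R) (f : R -> W) (s : R) (v : W) :
  is_derive s 1 f v <->
  forall e, 0 < e -> \forall h \near (0 : R),
    `|f (s + h) - f s - h *: v| <= e * `|h|.
Proof.
have E (h : R) : f (h *: 1 + s) = f (s + h) by rewrite [h *: 1]mulr1 addrC.
split=> [[df dv] e e0|H].
  move: df => /cvg_ex[l fl].
  have lv : l = v by rewrite -dv; apply/esym/cvg_lim.
  rewrite {l}lv in fl; move/cvgrPdist_le : fl => /(_ _ e0).
  rewrite /= near_withinE /=; apply: filterS => h he.
  have [->|h0] := eqVneq h 0.
    by rewrite scale0r subr0 addr0 subrr !normr0 mulr0.
  have := he h0; rewrite E distrC => {}he.
  have -> : f (s + h) - f s - h *: v = h *: (h^-1 *: (f (s + h) - f s) - v).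
    by rewrite [RHS]scalerBr scalerA divff// scale1r.
  by rewrite normrZ mulrC ler_wpM2r.
have fl : (fun h => h^-1 *: ((f \o shift s) (h *: 1) - f s)) @ 0^' --> v.
  apply/cvgrPdist_le => e e0; have := H _ e0.
  rewrite /= near_withinE /=; apply: filterS => h he h0.
  rewrite E distrC.
  have -> : h^-1 *: (f (s + h) - f s) - v = h^-1 *: (f (s + h) - f s - h *: v).
    by rewrite [RHS]scalerBr scalerA mulVf// scale1r.
  by rewrite normrZ normfV ler_pdivrMl ?normr_gt0// mulrC.
split; first by apply/cvg_ex; exists v.
by apply/cvg_lim.
Qed.

Lemma is_derive_continuous (W : normedModType R) (f : R -> W) (s : R) v :
  is_derive s 1 f v -> {for s, continuous f}.
Proof.
by move=> [df _]; apply: differentiable_continuous; apply/derivable1_diffP.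
Qed.

Lemma is_derive_lip (W : normedModType R) (f : R -> W) (s : R) v : is_derive s 1 f v ->
  exists2 K, 0 < K & \forall h \near (0 : R), `|f (s + h) - f s| <= K * `|h|.
Proof.
move=> /is_deriveP/(_ 1 ltr01) H; exists (1 + `|v|).
  by rewrite ltr_pwDl.
apply: filterS H => h H; rewrite -[X in `|X|](subrK (h *: v)).
rewrite (le_trans (ler_normD _ _))// mulrDl lerD// normrZ mulrC//.
Qed.

Lemma increment_le (f df : R -> R) (a b c : R) : a <= b ->
  {within `[a, b], continuous f} ->
  (forall s : R, s \in `]a, b[ -> is_derive s 1 f (df s) /\ df s <= c) ->
  f b - f a <= c * (b - a).
Proof.
rewrite le_eqVlt => /predU1P[-> _ _|ab cf H]; first by rewrite !subrr mulr0.
have [|x xab ->] := @MVT _ f df _ _ ab _ cf; first by move=> x /H[].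
by rewrite ler_wpM2r ?subr_ge0 ?(ltW ab)//; apply: (H _ xab).2.
Qed.

Lemma increment_norm_le (f df : R -> R) (a b c : R) : a <= b ->
  {within `[a, b], continuous f} ->
  (forall s : R, s \in `]a, b[ -> is_derive s 1 f (df s) /\ `|df s| <= c) ->
  `|f b - f a| <= c * (b - a).
Proof.
move=> ab cf H; rewrite ler_norml; apply/andP; split.
  rewrite lerNl.
  have -> : - (f b - f a) = - f b - - f a by rewrite opprB opprK addrC.
  apply: (@increment_le (fun x => - f x) (fun x => - df x)) => //.
    by move=> x; apply: continuousN; exact: cf.
  move=> s /H[d1 d2]; split; first exact: is_deriveN.
  by rewrite (le_trans (ler_norm _))// normrN.
apply: (@increment_le f df) => // s /H[d1 d2]; split=> //.
by rewrite (le_trans (ler_norm _)).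
Qed.

End Calculus.

Section Chain.
Context {R : realType} {N : nat}.
Local Notation V := 'rV[R]_N.

Lemma is_derive_coord (X : R -> V) (s : R) (v : V) i :
  is_derive s 1 X v -> is_derive s 1 (fun r => X r 0 i) (v 0 i).
Proof.
move=> /is_deriveP H; apply/is_deriveP => e e0.
apply: filterS (H _ e0) => h; apply: le_trans.
have -> : X (s + h) 0 i - X s 0 i - h *: v 0 i = (X (s + h) - X s - h *: v) 0 i.
  by rewrite !mxE.
exact: coord_le_norm.
Qed.

Lemma is_derive_row (X : R -> V) (s : R) (v : V) :
  (forall i, is_derive s 1 (fun r => X r 0 i) (v 0 i)) -> is_derive s 1 X v.
Proof.
move=> H; apply/is_deriveP => e e0.
have : \forall h \near (0 : R), forall i,
    `|X (s + h) 0 i - X s 0 i - h *: v 0 i| <= e * `|h|.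
  apply: (@filter_forall _ _ (fun i h => `|X (s + h) 0 i - X s 0 i - h *: v 0 i| <=
    e * `|h|) (nbhs (0 : R))) => i.
  by have /is_deriveP := H i; apply.
apply: filterS => h Hh; apply: norm_le_coord => [|i]; first by rewrite mulr_ge0// ltW.
by apply: le_trans (Hh i); rewrite !mxE.
Qed.

(** First-order expansion of [phi] at [p] relative to [S]. With [S] the interface cylinder it gives
    a derivative to a function known only there, so one chain rule serves both kinds of test
    function. *)
Definition expansion (S : set (V * R)) (phi : V * R -> R) (p : V * R)
    (D : V) (d : R) := forall e, 0 < e -> \forall q \near p, S q ->
  `|phi q - phi p - edot D (q.1 - p.1) - d * (q.2 - p.2)|
    <= e * (`|q.1 - p.1| + `|q.2 - p.2|).

Lemma is_derive_chain (S : set (V * R)) phi D d (X : R -> V) (th : R -> R) (s : R) (v : V) (w : R) :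
  expansion S phi (X s, th s) D d ->
  is_derive s 1 X v -> is_derive s 1 th w ->
  (\forall h \near (0 : R), S (X (s + h), th (s + h))) ->
  is_derive s 1 (fun r => phi (X r, th r)) (edot D v + d * w).
Proof.
move=> H dX dth nS; apply/is_deriveP => e e0.
have [K K0 XK] := is_derive_lip dX.
have [K' K'0 thK] := is_derive_lip dth.
(* The error has three sources, each allowed [e / 3]: the expansion of [phi], scaled by the growth
   [K + K'] of the curve, and the linearizations of [X] and of [th], scaled by [D] and [d]. *)
pose e1 := e / 3 / (K + K').
have e1_gt0 : 0 < e1 by rewrite !divr_gt0 ?addr_gt0.
pose e2 := e / 3 / (N%:R * `|D| + 1).
have e2_gt0 : 0 < e2 by rewrite !divr_gt0.
pose e3 := e / 3 / (`|d| + 1).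
have e3_gt0 : 0 < e3 by rewrite !divr_gt0.
have cs : (s + h) @[h --> (0 : R)] --> s.
  by rewrite -[X in _ --> X]addr0; apply: cvgD; [exact: cvg_cst|exact: cvg_id].
have cX : X (s + h) @[h --> 0] --> X s.
  exact: (cvg_comp _ _ cs (is_derive_continuous dX)).
have cth : th (s + h) @[h --> 0] --> th s.
  exact: (cvg_comp _ _ cs (is_derive_continuous dth)).
have cc : (X (s + h), th (s + h)) @[h --> 0] --> (X s, th s) by exact: (cvg_pair cX cth).
have {}H := cc _ (H _ e1_gt0).
move/is_deriveP: dX => /(_ _ e2_gt0) dX.
move/is_deriveP: dth => /(_ _ e3_gt0) dth.
near=> h.
have h1 : `|phi (X (s + h), th (s + h)) - phi (X s, th s) -
     edot D (X (s + h) - X s) - d * (th (s + h) - th s)| <=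
     e1 * (`|X (s + h) - X s| + `|th (s + h) - th s|).
  have : S (X (s + h), th (s + h)) by near: h.
  by near: h.
have h2 : `|X (s + h) - X s - h *: v| <= e2 * `|h| by near: h.
have h3 : `|th (s + h) - th s - h *: w| <= e3 * `|h| by near: h.
have h4 : `|X (s + h) - X s| <= K * `|h| by near: h.
have h5 : `|th (s + h) - th s| <= K' * `|h| by near: h.
set a := phi _ in h1 *; set b := phi _ in h1 *.
set dX' := X (s + h) - X s in h1 h2 h4 *.
set dt' := th (s + h) - th s in h1 h3 h5 *.
have -> : a - b - h *: (edot D v + d * w) =
   (a - b - edot D dX' - d * dt') + edot D (dX' - h *: v) + d * (dt' - h *: w).
  rewrite (edotBr D dX') edotZr -[h *: w]/(h * w) -[h *: (_ + _)]/(h * (_ + _)).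
  ring.
rewrite (le_trans (ler_normD _ _))//.
have -> : e * `|h| = e / 3 * `|h| + e / 3 * `|h| + e / 3 * `|h| by field.
rewrite lerD//.
  rewrite (le_trans (ler_normD _ _))// lerD//.
    rewrite (le_trans h1)//.
    rewrite (@le_trans _ _ (e1 * ((K + K') * `|h|)))//.
      by rewrite ler_pM2l// mulrDl lerD.
    by rewrite mulrA /e1 divfK// gt_eqF// addr_gt0.
  rewrite (le_trans (edot_le _ _))//.
  rewrite (@le_trans _ _ ((N%:R * `|D| + 1) * (e2 * `|h|)))//.
    by rewrite ler_pM// ?mulr_ge0// lerDl.
  by rewrite mulrA /e2 [X in X * _]mulrC divfK ?gt_eqF.
rewrite normrM (@le_trans _ _ ((`|d| + 1) * (e3 * `|h|)))//.
  by rewrite ler_pM// lerDl.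
by rewrite mulrA /e3 [X in X * _]mulrC divfK ?gt_eqF.
Unshelve. all: by end_near. Qed.

Lemma expansion_diff phi (p : V * R) : differentiable phi p ->
  expansion setT phi p (grad_x phi p) (d_t phi p).
Proof.
move=> dphi e e0.
have L q : 'd phi p q = edot (grad_x phi p) q.1 + d_t phi p * q.2.
  have {1}-> : q = \sum_(i < N) q.1 0 i *: ((delta_mx 0 i, 0) : V * R) +
     q.2 *: ((0, 1) : V * R).
    have E : \sum_(i < N) q.1 0 i *: ((delta_mx 0 i, 0) : V * R) = (q.1, 0).
      rewrite [in RHS](row_sum_delta q.1).
      elim/big_ind2 : _ => // [x u y v -> ->|i _]; first by congr pair; rewrite addr0.
      by congr pair; rewrite /= scaler0.
    rewrite E; case: q {E} => x t /=; congr pair => /=.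
      by rewrite scaler0 addr0.
    by rewrite [t *: _]mulr1 add0r.
  rewrite linearD linear_sum linearZ /= /d_t deriveE// [RHS]addrC addrC mulrC.
  congr (_ + _); rewrite /edot; apply: eq_bigr => i _.
  by rewrite linearZ /= mxE deriveE// mulrC.
have /eqaddoP /(_ _ e0) H := diff_locally dphi.
have cp : (q - p : (V * R)%type) @[q --> p] --> (0 : (V * R)%type).
  by rewrite -[X in _ --> X](subrr p); apply: cvgB; [exact: cvg_id|exact: cvg_cst].
have {}H : \forall q \near p, `|(phi \o shift p - (cst (phi p) + 'd phi p)) (q - p)|
    <= e * `|q - p| by exact: cp H.
apply: filterS H => q /= Hq _.
have -> : phi q - phi p - edot (grad_x phi p) (q.1 - p.1) - d_t phi p * (q.2 - p.2) =
    (phi \o shift p - (cst (phi p) + 'd phi p)) (q - p).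
  by rewrite !fctE /= subrK L /= opprD opprD !addrA.
rewrite (le_trans Hq)//.
rewrite ler_pM2l// prod_normE ge_max; apply/andP; split; first by rewrite lerDl.
by rewrite lerDr.
Qed.

Lemma diff_grad (f : V -> R) x v : differentiable f x ->
  'd f x v = edot (grad f x) v.
Proof.
move=> df; rewrite {1}(row_sum_delta v) linear_sum /edot; apply: eq_bigr => i _.
by rewrite linearZ /= mxE deriveE// mulrC.
Qed.

Lemma expansion_grad (f : V -> R) (p : V * R) : differentiable f p.1 ->
  expansion setT (fun q => f q.1) p (grad f p.1) 0.
Proof.
move=> df e e0; have /eqaddoP /(_ _ e0) H := diff_locally df.
have cp : (q.1 - p.1) @[q --> p] --> (0 : V).
  by rewrite -[X in _ --> X](subrr p.1); apply: cvgB; [exact: cvg_fst|exact: cvg_cst].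
have {}H : \forall q \near p,
    `|(f \o shift p.1 - (cst (f p.1) + 'd f (p.1))) (q.1 - p.1)|
    <= e * `|q.1 - p.1| by exact: cp H.
apply: filterS H => q /= Hq _.
have -> : f q.1 - f p.1 - edot (grad f p.1) (q.1 - p.1) - 0 * (q.2 - p.2) =
    (f \o shift p.1 - (cst (f p.1) + 'd f (p.1))) (q.1 - p.1).
  by rewrite !fctE /= subrK diff_grad// mul0r subr0 opprD !addrA.
rewrite (le_trans Hq)//.
by rewrite ler_pM2l// lerDl.
Qed.

End Chain.

(** * Differential inequalities in integrated form *)

Section Rate.
Context {R : realType}.
Local Notation mu := (@lebesgue_measure R).

(** Cover the exceptional times by an open [U] of measure below [e], let [h s] be the measure of [U]
    in [[0, s]], and propagate [F s - F 0 <= (c + e) * s + K'' * h s] by continuous induction. At an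
    ordinary time the derivative lets the bound advance; at an exceptional one [h] grows at unit
    rate and pays for the Lipschitz increment. *)
Lemma lip_ae_increment_le (F : R -> R) (tau c K : R) : 0 <= tau -> 0 <= K ->
  (forall s r, 0 <= s <= tau -> 0 <= r <= tau -> `|F s - F r| <= K * `|s - r|) ->
  {ae mu, forall s : R, s \in `]0, tau[ ->
    exists2 v, is_derive s 1 F v & v <= c} ->
  F tau - F 0 <= c * tau.
Proof.
move=> tau0 K0 FK [A0 [mA0 muA0 sA0]].
(* The hypothesis says nothing at the endpoint 0, which therefore joins the exceptional times. *)
pose A := A0 `|` [set 0].
have mA : measurable A by apply: measurableU => //; exact: measurable_set1.
have muA : mu A = 0%E.
  by apply/eqP; rewrite measureU0//; [exact/eqP|exact: lebesgue_measure_set1].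
have HA s : 0 <= s < tau -> ~ A s -> exists2 v, is_derive s 1 F v & v <= c.
  move=> /andP[s0 st] As.
  have s_gt0 : 0 < s.
    by rewrite lt_neqAle s0 andbT; apply/eqP => s0'; apply: As; right; rewrite -s0'.
  apply: contrapT => h; apply: As; left; apply: sA0 => /= hh; apply: h.
  by apply: hh; rewrite in_itv/= s_gt0.
(* Chosen so that [K - c <= K'']: the growth of [h] then covers the excess of [K * (r - m)] over
   [c * (r - m)]. *)
pose K'' := K + `|c|.
have K''0 : 0 <= K'' by rewrite addr_ge0.
suff key e : 0 < e -> F tau - F 0 <= c * tau + e * (tau + K'').
  apply/ler_addgt0Pr => e e0.
  have tK : 0 < tau + K'' + 1 by rewrite ltr_wpDl// addr_ge0.
  have := key (e / (tau + K'' + 1)) (divr_gt0 e0 tK) => /le_trans; apply.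
  by rewrite lerD2l mulrAC ler_pdivrMr// ler_pM2l// lerDl.
move=> e0; have [|U [oU AU muU]] := lebesgue_regularity_outer mA _ e0.
  by change (mu A < +oo)%E; rewrite muA.
have mU : measurable U by exact: open_measurable.
have {}muU : (mu U < e%:E)%E.
  have -> : U = (U `\` A) `|` A by rewrite setUC setDUK.
  by rewrite measureU0 ?muA//; exact: measurableD.
have le_mu (X Y : set R) : measurable X -> measurable Y -> X `<=` Y ->
    (mu X <= mu Y)%E.
  by move=> mX mY XY; apply: le_measure => //; rewrite inE.
have mUI (s : R) : measurable (U `&` `[0, s]) by exact: measurableI.
have UIfin (s : R) : mu (U `&` `[0, s]) \is a fin_num.
  rewrite ge0_fin_numE//; apply: le_lt_trans (lt_trans muU (ltry e)).
  by apply: le_mu => // x [].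
pose h s := fine (mu (U `&` `[0, s])).
have h_ge0 s : 0 <= h s by rewrite fine_ge0.
have h_homo s r : s <= r -> h s <= h r.
  move=> sr; rewrite /h fine_le//; apply: le_mu => //.
  by apply: setIS => x /=; rewrite !in_itv/= => /andP[-> xs]; exact: le_trans sr.
have h_le s : h s <= e.
  rewrite /h -lee_fin fineK//; apply: le_trans (ltW muU).
  by apply: le_mu => // x [].
have h_incr s r : 0 <= s -> s <= r -> `[s, r] `<=` U -> r - s <= h r - h s.
  move=> s0 sr srU; rewrite lerBrDr -lee_fin EFinD /h !fineK//.
  have -> : (r - s)%:E = mu `]s, r].
    rewrite lebesgue_measure_itv/= lte_fin.
    by case: ltgtP sr => // -> _; rewrite subrr.
  pose I1 := `]s, r]%classic; pose I2 := U `&` `[0, s].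
  have E : mu (I1 `|` I2) = (mu I1 + mu I2)%E.
    apply: measureU; [exact: measurable_itv|exact: mUI|].
    apply/seteqP; split=> // x [].
    by rewrite /I1 /I2/= !in_itv/= => /andP[sx _] [_ /andP[_]]; rewrite leNgt sx.
  rewrite -/I1 -/I2 -E {E}/I1 /I2.
  apply: le_mu => //; first exact: measurableU.
  move=> x [/=|[Ux /=]].
    rewrite in_itv/= => /andP[sx xr]; split.
      by apply: srU; rewrite /= in_itv/= (ltW sx).
    by rewrite /= in_itv/= xr (le_trans s0 (ltW sx)).
  by rewrite !in_itv/= => /andP[x0 xs]; split=> //; rewrite x0 (le_trans xs).
pose S := [set s | 0 <= s <= tau /\ F s - F 0 <= (c + e) * s + K'' * h s].
have S0 : S 0.
  by split; [rewrite lexx|rewrite subrr mulr0 add0r mulr_ge0].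
have hsS : has_sup S by split; [exists 0|exists tau => s [/andP[]]].
pose m := sup S.
have m0 : 0 <= m by exact: ub_le_sup hsS.2 _ S0.
have mt : m <= tau by apply: ge_sup; [exists 0|move=> s [/andP[]]].
(* The bound passes to the limit from the left because [F] and the linear term are Lipschitz and [h]
   is monotone. *)
have Sm : S m.
  split; first by rewrite m0.
  apply/ler_addgt0Pr => d d0.
  pose B := K + `|c + e| + 1.
  have B0 : 0 < B by rewrite ltr_wpDl// addr_ge0.
  have [s [/andP[s0 st] Ss] sm] := sup_adherent (divr_gt0 d0 B0) hsS.
  have {}sm : m - s < d / B by rewrite ltrBlDl -ltrBlDr.
  have s_le_m : s <= m by apply: ub_le_sup hsS.2 _ _; split => //; rewrite s0.
  have h1 : F m - F s <= K * (m - s).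
    rewrite -[X in _ <= _ * X]ger0_norm ?subr_ge0//.
    by rewrite (le_trans (ler_norm _))// FK ?m0 ?s0.
  have h2 : (c + e) * s <= (c + e) * m + `|c + e| * (m - s).
    rewrite -lerBlDl -mulrBr -opprB mulrN -mulNr ler_wpM2r ?subr_ge0//.
    by rewrite -normrN ler_norm.
  have h3 : K'' * h s <= K'' * h m by rewrite ler_wpM2l// h_homo.
  have h4 : (K + `|c + e|) * (m - s) <= d.
    rewrite (@le_trans _ _ (B * (m - s)))//.
      by rewrite ler_wpM2r ?subr_ge0// lerDl.
    by rewrite mulrC -ler_pdivlMr// ltW.
  rewrite mulrDl in h4; lra.
have [tm|tm] := leP tau m.
  have -> : tau = m by apply/eqP; rewrite eq_le tm mt.
  case: Sm => _ Sm; rewrite (le_trans Sm)//.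
  have : K'' * h m <= K'' * e by rewrite ler_wpM2l.
  lra.
suff [r mr Sr] : exists2 r, m < r & S r.
  by have := ub_le_sup hsS.2 Sr; rewrite leNgt mr.
have [Am|Am] := pselect (A m).
  have /nbhs_ballP[d /= d0 dU] : nbhs m U.
    by apply: open_nbhs_nbhs; split=> //; exact: AU.
  pose r := Num.min (m + d / 2) tau.
  have mr : m < r by rewrite /r lt_min tm andbT ltrDl divr_gt0.
  have rt : r <= tau by rewrite /r ge_min lexx orbT.
  have rd : r <= m + d / 2 by rewrite /r ge_min lexx.
  exists r => //; split; first by rewrite (le_trans m0 (ltW mr)).
  have hi : r - m <= h r - h m.
    apply: h_incr => //; first exact: ltW.
    move=> x /=; rewrite in_itv/= => /andP[mx xr]; apply: dU.
    rewrite /ball/= distrC ger0_norm ?subr_ge0//.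
    by rewrite ltrBlDl (le_lt_trans xr)// (le_lt_trans rd)// ltrD2l ltr_pdivrMr//
      ltr_pMr// ltr1n.
  have h1 : F r - F m <= K * (r - m).
    rewrite -[X in _ <= _ * X]ger0_norm ?subr_ge0 ?(ltW mr)//.
    by rewrite (le_trans (ler_norm _))// FK ?m0 ?(le_trans m0 (ltW mr)).
  have h2 : K'' * (r - m) <= K'' * (h r - h m) by rewrite ler_wpM2l.
  have h3 : (K - c) * (r - m) <= K'' * (r - m).
    by rewrite ler_wpM2r ?subr_ge0 ?(ltW mr)// lerD2l -normrN ler_norm.
  have h4 : 0 <= e * (r - m) by rewrite mulr_ge0 ?subr_ge0 ?(ltW mr) ?(ltW e0).
  case: Sm => _ Sm; rewrite mulrBl in h3; rewrite !mulrBr in h1 h2 h3 h4.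
  lra.
have [|v /is_deriveP/(_ _ e0) dF vc] := HA m _ Am; first by rewrite m0.
move: dF => /nbhs_ballP[d /= d0 dF].
pose k := Num.min (d / 2) (tau - m).
have k0 : 0 < k by rewrite /k lt_min divr_gt0//= subr_gt0.
have kt : k <= tau - m by rewrite /k ge_min lexx orbT.
have kd : k < d.
  by rewrite (@le_lt_trans _ _ (d / 2)) ?/k ?ge_min ?lexx// ltr_pdivrMr// ltr_pMr// ltr1n.
exists (m + k); first by rewrite ltrDl.
split; first by rewrite addr_ge0//= ?(ltW k0)// -lerBrDl.
have /dF /= : ball 0 d k by rewrite /ball/= sub0r normrN gtr0_norm.
rewrite (gtr0_norm k0) => /(le_trans (ler_norm _)).
rewrite -[k *: v]/(k * v) => h1.
have h2 : k * v <= k * c by rewrite ler_pM2l.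
have h3 : K'' * h m <= K'' * h (m + k) by rewrite ler_wpM2l// h_homo// lerDl ltW.
case: Sm => _ Sm; lra.
Qed.

(** The primitive [G] of [l] is Lipschitz because [l] is bounded, and by Lebesgue differentiation
    its derivative is [l] almost everywhere; the previous lemma applies to [f + G]. *)
Lemma rate_le (f l : R -> R) (tau c K B : R) : 0 <= tau -> 0 <= K -> 0 <= B ->
  (forall s r, 0 <= s <= tau -> 0 <= r <= tau -> `|f s - f r| <= K * `|s - r|) ->
  measurable_fun `[0, tau] l ->
  (forall s, s \in `[0, tau] -> `|l s| <= B) ->
  {ae mu, forall s : R, s \in `]0, tau[ ->
    exists2 v, is_derive s 1 f v & v + l s <= c} ->
  f tau - f 0 + \int[mu]_(s in `[0, tau]) l s <= c * tau.
Proof.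
move=> tau0 K0 B0 fK ml lB H.
(* Extended by zero, [l] is locally integrable on the whole line, as the differentiation theorem
   requires. *)
pose l' := l \_ `[0, tau].
have ml' : measurable_fun setT l' by apply/(measurable_restrictT _ _).1.
have l'B s : `|l' s| <= B.
  by rewrite /l' patchE; case: ifPn => [/set_mem/lB//|_]; rewrite normr0.
have intl' (D : set R) : measurable D -> (mu D < +oo)%E ->
    mu.-integrable D (EFin \o l').
  move=> mD muD; apply: measurable_bounded_integrable => //.
    exact: measurable_funS ml'.
  exists B; split=> [|M BM x _]; first exact: num_real.
  by rewrite /= (le_trans _ (ltW BM)).
have int0 (y : R) : mu.-integrable `[0, y] (EFin \o l').
  by apply: intl' => //; rewrite lebesgue_measure_itv/=; case: ifP; rewrite ?ltry.
pose G s := \int[mu]_(t in `[0, s]) l' t.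
have GB s r : 0 <= r -> r <= s -> `|G s - G r| <= B * `|s - r|.
  move=> r0 rs.
  have -> : G s - G r = \int[mu]_(t in `]r, s]) l' t.
    by rewrite /G Rintegral_itvB//= bnd_simp.
  have muI : mu `]r, s]%classic = (s - r)%:E.
    rewrite lebesgue_measure_itv/= lte_fin.
    by case: ltgtP rs => // -> _; rewrite subrr.
  have I1 : mu.-integrable `]r, s] (EFin \o l').
    by apply: intl' => //; rewrite [X in (X < _)%E]muI ltry.
  rewrite (le_trans (le_normr_Rintegral _ _))// [`|s - r|]ger0_norm ?subr_ge0//.
  have -> : B * (s - r) = \int[mu]_(t in `]r, s]) B.
    by rewrite Rintegral_cst//= [mu _]muI.
  apply: le_Rintegral => //.
  - exact: integrable_norm.
  - apply: measurable_bounded_integrable => //; first by rewrite [X in (X < _)%E]muI ltry.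
    exists B; split=> [|M BM x _]; first exact: num_real.
    by rewrite /= ger0_norm// ltW.
have GB' s r : 0 <= s -> 0 <= r -> `|G s - G r| <= B * `|s - r|.
  by move=> s0 r0; case: (leP r s) => [|/ltW] ?; [|rewrite distrC (distrC s)]; apply: GB.
have dG : {ae mu, forall s : R, 0 < s -> is_derive s 1 G (l' s)}.
  have /(@FTC1 _ _ (BLeft 0)) : locally_integrable [set: R] l'.
    apply: integrable_locally => //.
    apply: eq_integrable (int0 tau) => // x xI /=.
    by rewrite /l' patchE xI.
  move=> /(_ int0); apply: filterS; first exact: (ae_filter_ringOfSetsType mu).
  move=> s Hs s0; have [|d1 d2] := Hs.
    by rewrite /= lte_fin.
  by split; [exact: d1|rewrite -derive1E].
have G0 : G 0 = 0 by rewrite /G set_itv1 Rintegral_set1.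
have -> : \int[mu]_(s in `[0, tau]) l s = G tau - G 0.
  by rewrite G0 subr0; apply: eq_Rintegral => x xI; rewrite /l' patchE xI.
have -> : f tau - f 0 + (G tau - G 0) = (f \+ G) tau - (f \+ G) 0 by rewrite /=; ring.
apply: (@lip_ae_increment_le _ _ _ (K + B)) => //; first exact: addr_ge0.
  move=> s r sI rI /=; rewrite opprD addrACA (le_trans (ler_normD _ _))// mulrDl.
  by rewrite lerD// ?fK// GB'//; [case/andP: sI|case/andP: rI].
move: dG H; apply: filterS2; first exact: (ae_filter_ringOfSetsType mu).
move=> s ds H sI.
have s0 : 0 < s by move: sI; rewrite in_itv/= => /andP[].
have [v dv vc] := H sI; exists (v + l' s); first exact: (is_deriveD dv (ds s0)).
have -> // : l' s = l s.
by rewrite /l' patchE mem_set//= in_itv/=; move: sI; rewrite in_itv/= => /andP[/ltW-> /ltW->].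
Qed.

End Rate.

(** * Lipschitz extension and flows *)

Section Clip.
Context {R : realType}.
Implicit Types a b x y : R.

Definition clip a b x : R := Num.max a (Num.min b x).

Lemma clip_itv a b x : a <= b -> a <= clip a b x <= b.
Proof. by move=> ab; rewrite /clip le_max lexx /= ge_max ge_min lexx ab. Qed.

Lemma clipE a b x : a <= x <= b -> clip a b x = x.
Proof. by move=> /andP[h1 h2]; rewrite /clip min_r// max_r. Qed.

Lemma clip_lip a b x y : `|clip a b x - clip a b y| <= `|x - y|.
Proof.
wlog xy : x y / x <= y.
  by move=> H; case: (leP x y) => [/H//|/ltW/H]; rewrite distrC (distrC x).
have mono : Num.min b x <= Num.min b y by rewrite le_min !ge_min lexx xy orbT.
have incr : Num.min b y <= Num.min b x + (y - x).
  have yx : 0 <= y - x by rewrite subr_ge0.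
  rewrite addrC -lerBlDl le_min lerBlDr ge_min lerDl yx /=.
  by rewrite lerBlDr ge_min addrC subrK lexx orbT.
rewrite distrC ger0_norm; last first.
  by rewrite subr_ge0 /clip ge_max !le_max lexx mono orbT.
rewrite distrC ger0_norm ?subr_ge0// lerBlDl /clip ge_max.
rewrite -{1}[a]addr0 lerD ?le_max ?lexx ?subr_ge0//=.
by rewrite (le_trans incr)// lerD2r le_max lexx orbT.
Qed.

End Clip.

Section LipschitzExtension.
Context {R : realType} {E : normedModType R}.
Implicit Types (D : set E) (f g : E -> R).

(* McShane's formula [inf_q (f q + L |p - q|)], truncated to keep the bound. *)
Lemma mcshane D f (L M : R) : 0 <= L -> 0 <= M ->
  (forall p, D p -> `|f p| <= M) ->
  (forall p q, D p -> D q -> `|f p - f q| <= L * `|p - q|) ->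
  exists g, [/\ forall p, D p -> g p = f p, forall p, `|g p| <= M &
    forall p q, `|g p - g q| <= L * `|p - q|].
Proof.
move=> L0 M0 fM fL; have [[q0 Dq0]|D0] := pselect (D !=set0); last first.
  exists (cst 0); split=> [p Dp|p|p q] /=.
  - by exfalso; apply: D0; exists p.
  - by rewrite normr0.
  - by rewrite subrr normr0 mulr_ge0.
pose S p := [set f q + L * `|p - q| | q in D].
have Slb p : has_lbound (S p).
  exists (- M) => _ [q Dq <-]; rewrite ler_wpDr ?mulr_ge0//.
  by have := fM _ Dq; rewrite ler_norml => /andP[].
have S0 p : S p !=set0 by exists (f q0 + L * `|p - q0|); exists q0.
pose g0 p := inf (S p).
have g0E p : D p -> g0 p = f p.
  move=> Dp; apply/eqP; rewrite eq_le; apply/andP; split.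
    by apply: ge_inf => //; exists p => //; rewrite subrr normr0 mulr0 addr0.
  apply: lb_le_inf => // _ [q Dq <-]; rewrite -lerBlDl.
  by rewrite (le_trans (ler_norm _))// fL.
have g0L p q : g0 p - g0 q <= L * `|p - q|.
  rewrite lerBlDr -lerBlDl; apply: lb_le_inf => // _ [r Dr <-].
  rewrite lerBlDl; apply: (@le_trans _ _ (f r + L * `|p - r|)).
    by apply: ge_inf => //; exists r.
  rewrite addrCA lerD2l -mulrDr ler_wpM2l//.
  by rewrite -[p - r](subrKA q) ler_normD.
exists (clip (- M) M \o g0); split=> [p Dp|p|p q] /=.
- by rewrite g0E// clipE// -ler_norml fM.
- by rewrite ler_norml clip_itv// (le_trans _ M0)// oppr_le0.
- rewrite (le_trans (clip_lip _ _ _ _))// ler_norml g0L andbT lerNl opprB.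
  by rewrite (le_trans (g0L _ _))// distrC.
Qed.

(** Boundedness is built in because a product of Lipschitz functions need not be Lipschitz without
    it. The class is stable under the operations that form feedback fields, including inverses of
    functions bounded away from 0. *)
Definition bdd_lip D f := exists2 K, 0 <= K &
  (forall p, D p -> `|f p| <= K) /\
  (forall p q, D p -> D q -> `|f p - f q| <= K * `|p - q|).

Lemma bdd_lip_cst D c : bdd_lip D (cst c).
Proof.
by exists `|c| => //; split=> // p q _ _; rewrite subrr normr0 mulr_ge0.
Qed.

Lemma bdd_lip_eq D f g : (forall p, D p -> f p = g p) -> bdd_lip D f -> bdd_lip D g.
Proof.
move=> fg [K K0 [h1 h2]]; exists K => //; split=> [p Dp|p q Dp Dq].
  by rewrite -fg// h1.
by rewrite -!fg// h2.
Qed.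

Lemma bdd_lipS D D' f : D' `<=` D -> bdd_lip D f -> bdd_lip D' f.
Proof.
move=> DD [K K0 [h1 h2]]; exists K => //.
by split=> [p /DD/h1//|p q /DD Dp /DD Dq]; exact: h2.
Qed.

Lemma bdd_lipD D f g : bdd_lip D f -> bdd_lip D g -> bdd_lip D (fun p => f p + g p).
Proof.
move=> [K K0 [f1 f2]] [L L0 [g1 g2]]; exists (K + L); first exact: addr_ge0.
split=> [p Dp|p q Dp Dq].
  by rewrite (le_trans (ler_normD _ _))// lerD ?f1 ?g1.
rewrite opprD addrACA (le_trans (ler_normD _ _))// mulrDl.
by rewrite lerD ?f2 ?g2.
Qed.

Lemma bdd_lipM D f g : bdd_lip D f -> bdd_lip D g -> bdd_lip D (fun p => f p * g p).
Proof.
move=> [K K0 [f1 f2]] [L L0 [g1 g2]].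
exists (K * L + K * L); first by rewrite addr_ge0 ?mulr_ge0.
split=> [p Dp|p q Dp Dq].
  by rewrite normrM ler_wpDr ?mulr_ge0// ler_pM ?f1 ?g1.
have -> : f p * g p - f q * g q = (f p - f q) * g p + f q * (g p - g q) by ring.
rewrite (le_trans (ler_normD _ _))// !normrM mulrDl lerD//.
  by rewrite (le_trans (ler_pM _ _ (f2 _ _ Dp Dq) (g1 _ Dp)))// mulrAC.
by rewrite (le_trans (ler_pM _ _ (f1 _ Dq) (g2 _ _ Dp Dq)))// mulrA.
Qed.

Lemma bdd_lipN D f : bdd_lip D f -> bdd_lip D (fun p => - f p).
Proof.
move=> H; apply: bdd_lip_eq (bdd_lipM (bdd_lip_cst D (-1)) H) => p _ /=.
by rewrite mulN1r.
Qed.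

Lemma bdd_lipV D f c : 0 < c -> (forall p, D p -> c <= `|f p|) ->
  bdd_lip D f -> bdd_lip D (fun p => (f p)^-1).
Proof.
move=> c0 fc [K K0 [f1 f2]].
have fV p : D p -> `|(f p)^-1| <= c^-1.
  by move=> Dp; rewrite normfV lef_pV2 ?posrE ?fc// (lt_le_trans c0 (fc _ Dp)).
have fn p : D p -> f p != 0.
  by move=> Dp; rewrite -normr_gt0 (lt_le_trans c0 (fc _ Dp)).
exists (c^-1 + c^-1 * c^-1 * K).
  by rewrite addr_ge0 ?mulr_ge0 ?invr_ge0 ?(ltW c0).
split=> [p Dp|p q Dp Dq].
  by rewrite (le_trans (fV _ Dp))// lerDl !mulr_ge0 ?invr_ge0 ?(ltW c0).
have -> : (f p)^-1 - (f q)^-1 = (f p)^-1 * (f q)^-1 * (f q - f p).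
  by field; rewrite fn// fn.
rewrite mulrDl ler_wpDl ?mulr_ge0 ?invr_ge0 ?(ltW c0)// !normrM.
rewrite -[leRHS]mulrA; apply: ler_pM; rewrite ?mulr_ge0//.
  by apply: ler_pM; rewrite ?fV.
by rewrite distrC f2.
Qed.

Lemma bdd_lip_sum D n (f : 'I_n -> E -> R) : (forall i, bdd_lip D (f i)) ->
  bdd_lip D (fun p => \sum_i f i p).
Proof.
elim: n f => [|n IH] f H.
  apply: bdd_lip_eq (bdd_lip_cst D 0) => p _ /=; by rewrite big_ord0.
have h := bdd_lipD (IH (fun i => f (widen_ord (leqnSn n) i)) (fun i => H _)) (H ord_max).
by apply: bdd_lip_eq h => p _; rewrite big_ord_recr.
Qed.

End LipschitzExtension.

Section VectorFields.
Context {R : realType} {N : nat} {E : normedModType R}.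
Local Notation V := 'rV[R]_N.

Definition vbdd_lip (D : set E) (F : E -> V) := forall i, bdd_lip D (fun p => F p 0 i).

Lemma vbdd_lipD D F G : vbdd_lip D F -> vbdd_lip D G ->
  vbdd_lip D (fun p => F p + G p).
Proof.
move=> hF hG i; apply: bdd_lip_eq (bdd_lipD (hF i) (hG i)) => p _.
by rewrite mxE.
Qed.

Lemma vbdd_lipZ D f F : bdd_lip D f -> vbdd_lip D F ->
  vbdd_lip D (fun p => f p *: F p).
Proof.
move=> hf hF i; apply: bdd_lip_eq (bdd_lipM hf (hF i)) => p _.
by rewrite mxE.
Qed.

Lemma bdd_lip_edot D F G : vbdd_lip D F -> vbdd_lip D G ->
  bdd_lip D (fun p => edot (F p) (G p)).
Proof. by move=> hF hG; apply: bdd_lip_sum => i; exact: bdd_lipM. Qed.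

Lemma vbdd_lip_norm (D : set E) (F : E -> V) (K : R) : 0 <= K ->
  (forall p, D p -> `|F p| <= K) ->
  (forall p q, D p -> D q -> `|F p - F q| <= K * `|p - q|) -> vbdd_lip D F.
Proof.
move=> K0 h1 h2 i; exists K => //; split=> [p Dp|p q Dp Dq].
  by rewrite (le_trans (coord_le_norm _ _))// h1.
by rewrite (le_trans _ (h2 _ _ Dp Dq))// (le_trans _ (coord_le_norm _ i))// !mxE.
Qed.

(** A field known only on [D] becomes a global one, so its flow can be built before it is known
    whether the curve stays in [D]. *)
Lemma vector_extension (D : set E) (F : E -> V) : vbdd_lip D F ->
  exists G : E -> V, exists2 K, 0 < K &
    [/\ forall p, D p -> G p = F p, forall p, `|G p| <= K &
        forall p q, `|G p - G q| <= K * `|p - q|].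
Proof.
move=> hF.
have H i : exists gK : (E -> R) * R, 0 <= gK.2 /\
    [/\ forall p, D p -> gK.1 p = F p 0 i, forall p, `|gK.1 p| <= gK.2 &
        forall p q, `|gK.1 p - gK.1 q| <= gK.2 * `|p - q|].
  have [K K0 [h1 h2]] := hF i; have [g [g1 g2 g3]] := mcshane K0 K0 h1 h2.
  by exists (g, K).
pose gK i := sval (cid (H i)).
have gKP i := svalP (cid (H i)).
pose K := \sum_i (gK i).2 + 1.
have Ki i : (gK i).2 <= K.
  rewrite /K (bigD1 i)//= -addrA lerDl addr_ge0// sumr_ge0// => j _.
  exact: (gKP j).1.
have K0 : 0 < K by rewrite ltr_wpDl// sumr_ge0// => j _; exact: (gKP j).1.
exists (fun p => \row_i (gK i).1 p), K => //; split=> [p Dp|p|p q].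
- by apply/rowP => i; rewrite mxE; case: (gKP i) => _ [h _ _]; exact: h.
- apply: norm_le_coord => [|i]; first exact: ltW.
  by rewrite mxE (le_trans _ (Ki i))//; case: (gKP i) => _ [].
- apply: norm_le_coord => [|i]; first by rewrite mulr_ge0// ltW.
  rewrite !mxE (@le_trans _ _ ((gK i).2 * `|p - q|))//.
    by case: (gKP i) => _ [].
  by rewrite ler_wpM2r.
Qed.

End VectorFields.

(** * Local existence for Lipschitz fields by Picard iteration *)

Section Picard.
Context {R : realType} {N : nat}.
Local Notation V := 'rV[R]_N.
Local Notation mu := (@lebesgue_measure R).

(** Integrating from [a < 0] makes the derivative two-sided at 0. *)
Lemma antiderivative (g : R -> R) (a : R) : continuous g -> a < 0 ->
  exists2 G : R -> R, G 0 = 0 & forall s : R, a < s -> is_derive s 1 G (g s).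
Proof.
move=> cg a0.
pose G s := \int[mu]_(t in `[a, s]) g t - \int[mu]_(t in `[a, 0]) g t.
exists G => [|s as_]; first by rewrite /G subrr.
have H : derivable (fun s => \int[mu]_(t in `[a, s]) g t) s 1 /\
    derive1 (fun s => \int[mu]_(t in `[a, s]) g t) s = g s.
  apply: (@continuous_FTC1_closed _ g a s (s + 1)); rewrite ?ltrDl//; last exact: cg.
  apply: continuous_compact_integrable; first exact: segment_compact.
  exact: continuous_subspaceT.
have dH : is_derive s 1 (fun s => \int[mu]_(t in `[a, s]) g t) (g s).
  by case: H => h1 h2; split; [exact: h1|rewrite -derive1E].
rewrite -[g s]subr0.
exact: (is_deriveB dH (is_derive_cst (\int[mu]_(t in `[a, 0]) g t) s 1)).
Qed.

Lemma lipschitz_continuous (U W : normedModType R) (f : U -> W) K :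
  (forall x y, `|f x - f y| <= K * `|x - y|) -> continuous f.
Proof.
move=> fK x; apply/cvgrPdist_le => e e0.
have K1 : 0 < `|K| + 1 by rewrite ltr_wpDl.
have : \forall y \near x, `|x - y| <= e / (`|K| + 1).
  have /cvgrPdist_le/(_ _ (divr_gt0 e0 K1)) : y @[y --> x] --> x by exact: cvg_id.
  by [].
apply: filterS => y xy; rewrite (le_trans (fK _ _))//.
rewrite (@le_trans _ _ ((`|K| + 1) * `|x - y|))//.
  by rewrite ler_wpM2r// (le_trans (ler_norm _))// lerDl.
by rewrite mulrC -ler_pdivlMr.
Qed.

Variables (G : (V * R)%type -> V) (K : R) (x0 : V).
Hypotheses (K0 : 0 < K) (GK : forall p, `|G p| <= K)
  (GL : forall p q, `|G p - G q| <= K * `|p - q|).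

(** With this life time [K * tau = 1 / 2], so the Picard map contracts by one half. *)
Let tau := (2 * K)^-1.
Let tau0 : 0 < tau. Proof. by rewrite invr_gt0 mulr_gt0. Qed.
Let clamp_itv s : - tau <= clip (- tau) tau s <= tau.
Proof. by apply: clip_itv; rewrite ltW// gtrN. Qed.

Let lip (Y : R -> V) := forall s r, `|Y s - Y r| <= K * `|s - r|.

(** [Z] is the Picard image of [Y], frozen outside [[- tau, tau]]; iterates are thus curves on the
    whole line, compared uniformly in time. *)
Let picard_spec (Y Z : R -> V) := [/\ Z 0 = x0, lip Z,
  (forall s, Z s = Z (clip (- tau) tau s)) &
  forall s : R, `|s| < tau -> is_derive s 1 Z (G (Y s, s))].

Let prod_norm_le (p : (V * R)%type) : `|p| <= `|p.1| + `|p.2|.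
Proof. by rewrite prod_normE ge_max lerDl lerDr !normr_ge0. Qed.

Let picard_ex (Y : R -> V) : lip Y -> exists Z, picard_spec Y Z.
Proof.
move=> lY.
have cg i : continuous (fun s => G (Y s, s) 0 i).
  apply: (@lipschitz_continuous _ _ _ (K * (K + 1))) => s r.
  have -> : G (Y s, s) 0 i - G (Y r, r) 0 i = (G (Y s, s) - G (Y r, r)) 0 i.
    by rewrite !mxE.
  rewrite (le_trans (coord_le_norm _ _))// (le_trans (GL _ _))// -mulrA.
  rewrite ler_wpM2l ?(ltW K0)// (le_trans (prod_norm_le _))//= mulrDl mul1r.
  by rewrite lerD2r lY.
(* The margin 1 makes the primitives differentiable at [- tau] as well. *)
have a0 : - tau - 1 < 0 by have := tau0; lra.
have H i := antiderivative (cg i) a0.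
pose A i := s2val (cid2 (H i)).
have A0 i : A i 0 = 0 := s2valP (cid2 (H i)).
have AD i (s : R) : - tau - 1 < s -> is_derive s 1 (A i) (G (Y s, s) 0 i) :=
  s2valP' (cid2 (H i)) s.
pose B s : V := x0 + \row_i A i s.
have BD (s : R) : - tau - 1 < s -> is_derive s 1 B (G (Y s, s)).
  move=> hs; apply: is_derive_row => i.
  have -> : (fun r => B r 0 i) = (fun r => cst (x0 0 i) r + A i r).
    by apply/funext => r; rewrite !mxE.
  rewrite -[G _ 0 i]add0r.
  exact: (is_deriveD (is_derive_cst (x0 0 i) s 1) (AD i s hs)).
have BL s r : - tau <= s -> s <= r -> `|B r - B s| <= K * (r - s).
  move=> hs sr; apply: norm_le_coord => [|i].
    by rewrite mulr_ge0 ?subr_ge0 ?(ltW K0).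
  rewrite !mxE opprD addrACA subrr add0r.
  have dA (t : R) : t \in `[s, r] -> is_derive t 1 (A i) (G (Y t, t) 0 i).
    by rewrite in_itv/= => /andP[st _]; apply: AD; have := tau0; lra.
  apply: (@increment_norm_le _ _ (fun t => G (Y t, t) 0 i)) => //.
    apply: derivable_within_continuous => t /dA ht; exact: ex_derive.
  move=> t tI; split; first by apply: dA; exact: subset_itv_oo_cc tI.
  by rewrite (le_trans (coord_le_norm _ _)).
have BL' s r : `|B (clip (- tau) tau s) - B (clip (- tau) tau r)| <= K * `|s - r|.
  apply: (@le_trans _ _ (K * `|clip (- tau) tau s - clip (- tau) tau r|)); last first.
    by rewrite ler_wpM2l ?(ltW K0)// clip_lip.
  case: (leP (clip (- tau) tau s) (clip (- tau) tau r)) => [sr|/ltW sr].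
    rewrite distrC (distrC (clip (- tau) tau s)) [X in _ <= _ * X]ger0_norm ?subr_ge0// BL//.
    by have /andP[] := clamp_itv s.
  rewrite [X in _ <= _ * X]ger0_norm ?subr_ge0// BL//.
  by have /andP[] := clamp_itv r.
exists (B \o clip (- tau) tau); split=> /=.
- rewrite clipE; last by have := tau0; move=> ?; apply/andP; split; lra.
  by apply/rowP => i; rewrite !mxE A0 addr0.
- exact: BL'.
- by move=> s; rewrite (clipE (clamp_itv s)).
- move=> s; rewrite ltr_norml => /andP[s1 s2].
  have hs : - tau - 1 < s by lra.
  apply/is_deriveP => e e0; have /is_deriveP/(_ _ e0) := BD s hs.
  have : \forall h \near (0 : R), `|h| < Num.min (s + tau) (tau - s).
    have h0 : 0 < Num.min (s + tau) (tau - s).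
      by rewrite lt_min; apply/andP; split; lra.
    by have := nbhs0_lt h0.
  apply: filterS2 => h; rewrite lt_min => /andP[]; rewrite !ltr_norml.
  move=> /andP[h1 h2] /andP[h3 h4]; rewrite /= !clipE//; apply/andP; split; lra.
Qed.

Let picard_contract Y Y' Z Z' c : picard_spec Y Z -> picard_spec Y' Z' ->
  (forall s, `|Y s - Y' s| <= c) -> forall s, `|Z s - Z' s| <= c / 2.
Proof.
move=> [Z0 lZ cZ dZ] [Z'0 lZ' cZ' dZ'] Yc s.
have c0 : 0 <= c by rewrite (le_trans _ (Yc 0)).
rewrite cZ cZ'; move: (clip (- tau) tau s) (clamp_itv s) => {}s /andP[s1 s2].
apply: norm_le_coord => [|i]; first by rewrite divr_ge0.
pose f t := Z t 0 i - Z' t 0 i.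
have cf : continuous f.
  apply: (@lipschitz_continuous _ _ _ (K + K)) => a b.
  have -> : f a - f b = (Z a - Z b) 0 i - (Z' a - Z' b) 0 i by rewrite /f !mxE; ring.
  rewrite (le_trans (ler_normB _ _))// mulrDl lerD//.
    by rewrite (le_trans (coord_le_norm _ _)).
  by rewrite (le_trans (coord_le_norm _ _)).
have df (t : R) : `|t| < tau -> is_derive t 1 f (G (Y t, t) 0 i - G (Y' t, t) 0 i).
  move=> ht; exact: (is_deriveB (is_derive_coord i (dZ t ht)) (is_derive_coord i (dZ' t ht))).
have dfc t : `|G (Y t, t) 0 i - G (Y' t, t) 0 i| <= K * c.
  have -> : G (Y t, t) 0 i - G (Y' t, t) 0 i = (G (Y t, t) - G (Y' t, t)) 0 i.
    by rewrite !mxE.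
  rewrite (le_trans (coord_le_norm _ _))// (le_trans (GL _ _))// ler_wpM2l ?(ltW K0)//.
  by rewrite prod_normE /= subrr normr0 max_l.
have key a b : a <= b -> - tau <= a -> b <= tau -> b - a <= tau -> `|f b - f a| <= c / 2.
  move=> ab ta bt bat.
  apply: (@le_trans _ _ (K * c * (b - a))).
    apply: (@increment_norm_le _ _ (fun t => G (Y t, t) 0 i - G (Y' t, t) 0 i)) => //.
      exact: continuous_subspaceT.
    move=> t; rewrite in_itv/= => /andP[h1 h2]; split; last exact: dfc.
    by apply: df; rewrite ltr_norml; apply/andP; split; lra.
  have -> : c / 2 = K * c * tau by rewrite /tau; field; rewrite gt_eqF.
  by rewrite ler_wpM2l// mulr_ge0 ?(ltW K0).
have f0 : f 0 = 0 by rewrite /f Z0 Z'0 subrr.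
have -> : (Z s - Z' s) 0 i = f s - f 0 by rewrite f0 subr0 /f !mxE.
have t0 := tau0.
case: (leP 0 s) => [s0|/ltW s0]; first by apply: key => //; lra.
by rewrite distrC; apply: key => //; lra.
Qed.

Lemma picard : exists X : R -> V, [/\ X 0 = x0,
  forall s r, `|X s - X r| <= K * `|s - r| &
  forall s : R, `|s| < (2 * K)^-1 -> is_derive s 1 X (G (X s, s))].
Proof.
have lip0 : lip (cst x0) by move=> s r; rewrite subrr normr0 mulr_ge0 ?(ltW K0).
pose Phi Y := if pselect (lip Y) is left h then sval (cid (picard_ex h)) else Y.
have PhiP Y : lip Y -> picard_spec Y (Phi Y).
  by rewrite /Phi; case: pselect => // h _; exact: svalP.
pose X n := iter n Phi (cst x0).
have lX n : lip (X n).
  by elim: n => [//|n IH]; rewrite /X iterS -/(X n); case: (PhiP _ IH).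
have step n s : `|X n.+1 s - X n s| <= (K * tau) / 2 ^+ n.
  elim: n s => [|n IH] s.
    rewrite expr0 divr1; case: (PhiP _ lip0) => z0 lz cz _.
    rewrite /X /= (cz s) -[X in `|_ - X|]z0 (le_trans (lz _ _))// ler_wpM2l ?(ltW K0)//.
    by rewrite subr0 ler_norml clamp_itv.
  rewrite exprSr invfM mulrA.
  exact: (picard_contract (PhiP _ (lX n.+1)) (PhiP _ (lX n)) IH).
pose C := K * tau; have C0 : 0 <= C by rewrite mulr_ge0 ?(ltW K0) ?(ltW tau0).
have far n m s : `|X n s - X (n + m)%N s| <= C / 2 ^+ n * (2 - 2 / 2 ^+ m).
  elim: m => [|m IH]; first by rewrite addn0 subrr normr0 expr0 divr1 subrr mulr0.
  rewrite -(subrKA (X (n + m)%N s)) (le_trans (ler_normD _ _))//.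
  apply: (@le_trans _ _ (C / 2 ^+ n * (2 - 2 / 2 ^+ m) + C / 2 ^+ (n + m))).
    by rewrite lerD// addnS distrC step.
  rewrite le_eqVlt; apply/orP; left; apply/eqP.
  rewrite exprD exprS; field.
  by rewrite !expf_neq0.
have far2 n m s : (n <= m)%N -> `|X n s - X m s| <= 2 * C / 2 ^+ n.
  move=> nm; rewrite -(subnKC nm) (le_trans (far _ _ _))//.
  rewrite [leRHS](_ : _ = C / 2 ^+ n * 2); last by ring.
  apply: ler_wpM2l; first by rewrite divr_ge0 ?exprn_ge0.
  by rewrite gerBl divr_ge0 ?exprn_ge0.
have small e : 0 < e -> exists n, 2 * C / 2 ^+ n < e.
  move=> e0; have [n hn] : exists n, 2 * C / e < n%:R.
    by exists (Num.truncn (2 * C / e)).+1; rewrite truncnS_gt.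
  exists n; rewrite ltr_pdivrMr ?exprn_gt0// [ltRHS]mulrC -ltr_pdivrMr//.
  by rewrite (lt_le_trans hn)// -natrX ler_nat ltnW// ltn_expl.
have cvX s : cvgn (fun n => X n s).
  apply: cauchy_cvg; apply/cauchy_exP => e e0.
  have [n hn] := small _ e0; exists (X n s).
  exists n => // m /= nm; rewrite -ball_normE /=.
  by apply: le_lt_trans (far2 n m s _) hn.
pose Xl s := limn (fun n => X n s).
have Xlim n s : `|X n s - Xl s| <= 2 * C / 2 ^+ n.
  have h : `|X n s - X m s| @[m --> \oo] --> `|X n s - Xl s|.
    by apply: cvg_norm; apply: cvgB; [exact: cvg_cst|exact: cvX].
  rewrite -(cvg_lim _ h)//; apply: limr_le; first by apply/cvg_ex; eexists; exact: h.
  by near=> m; apply: far2; near: m; exact: nbhs_infty_ge.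
have lXl : lip Xl.
  move=> s r; have h : `|X m s - X m r| @[m --> \oo] --> `|Xl s - Xl r|.
    by apply: cvg_norm; apply: cvgB; exact: cvX.
  rewrite -(cvg_lim _ h)//; apply: limr_le; first by apply/cvg_ex; eexists; exact: h.
  by near=> m; exact: lX.
(* Both sides are compared with [X n.+1]: the contraction halves the distance from [X n] to [Xl]. *)
have E : Phi Xl = Xl.
  apply/funext => s; apply/eqP; rewrite -subr_eq0 -normr_le0.
  apply/ler_addgt0Pr => e e0; rewrite add0r.
  have [n hn] := small _ e0.
  rewrite -(subrKA (X n.+1 s)) (le_trans (ler_normD _ _))//.
  have h1 := Xlim n.+1 s.
  have h2 := picard_contract (PhiP _ lXl) (PhiP _ (lX n))
    (fun s => le_trans (eq_ind_r (fun x => x <= _) (Xlim n s) (distrC _ _)) (lexx _)) s.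
  rewrite -/(X n) in h2.
  have h3 : 2 * C / 2 ^+ n.+1 = 2 * C / 2 ^+ n / 2 by rewrite exprSr invfM mulrA.
  rewrite h3 in h1; rewrite [X n.+1]/X iterS -/(X n) in h1 *; lra.
have [h1 h2 _ h4] := PhiP _ lXl; rewrite E in h1 h2 h4.
by exists Xl.
Unshelve. all: by end_near. Qed.

End Picard.

(** * Translation invariance of Lebesgue measure and integral *)

Section LebesgueShift.
Context {R : realType}.
Local Notation mu := (@lebesgue_measure R).

Lemma measurable_shift (c : R) :
  measurable_fun [set: R] (fun s : R => s + c : measurableTypeR R).
Proof. by apply: measurable_funD => //; exact: measurable_cst. Qed.

Lemma lebesgue_measure_shift (c : R) (A : set R) : measurable A ->
  pushforward mu (fun s : R => s + c : measurableTypeR R) A = mu A.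
Proof.
have mc := measurable_shift c.
move=> mA; apply/esym/lebesgue_measure_unique => //= _ [[a b]] _ <-.
rewrite /pushforward.
have -> : (fun s : R => s + c) @^-1` `]a, b] = `]a - c, b - c]%classic.
  by apply/seteqP; split=> s /=; rewrite !in_itv/= ltrBlDr lerBrDr.
by rewrite !lebesgue_measure_itv/= !lte_fin ltrD2r -!EFinB opprB addrA subrK.
Qed.

Lemma ae_shift (c : R) (Q : R -> Prop) : {ae mu, forall s, Q s} ->
  {ae mu, forall s, Q (s + c)}.
Proof.
move=> [A [mA muA QA]]; exists ((fun s => s + c) @^-1` A); split.
- rewrite -[X in measurable X]setTI; exact: (measurable_shift c).
- rewrite -muA; exact: lebesgue_measure_shift.
- by move=> s Qs; apply: QA.
Qed.

Lemma Rintegral_shift (c r B : R) (f : R -> R) :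
  measurable_fun `[c, c + r] f -> (forall s, s \in `[c, c + r] -> `|f s| <= B) ->
  \int[mu]_(s in `[c, c + r]) f s = \int[mu]_(s in `[0, r]) f (s + c).
Proof.
move=> mf fB; pose f' := f \_ `[c, c + r].
have mf' : measurable_fun setT f' by apply/(measurable_restrictT _ _).1.
have f'B s : `|f' s| <= `|B|.
  rewrite /f' patchE; case: ifPn => [/set_mem/fB/le_trans->//|_]; last by rewrite normr0.
  exact: ler_norm.
have E : (fun s : R => s + c) @^-1` `[c, c + r] = `[0, r]%classic.
  apply/seteqP; split=> s /=; rewrite !in_itv/= => /andP[h1 h2]; apply/andP; split; lra.
transitivity (\int[mu]_(s in `[c, c + r]) f' s).
  by apply: eq_Rintegral => s sI; rewrite /f' patchE sI.
transitivity (\int[mu]_(s in `[0, r]) f' (s + c)); last first.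
  apply: eq_Rintegral => s /set_mem/= sI; rewrite /f' patchE mem_set//=.
  move: sI; rewrite !in_itv/= => /andP[h1 h2]; apply/andP; split; lra.
rewrite /Rintegral; congr fine.
pose sh (s : R) : measurableTypeR R := s + c; pose I := `[c, c + r]%classic.
have mc : measurable_fun [set: measurableTypeR R] sh := measurable_shift c.
transitivity (\int[pushforward mu sh]_(x in I) (EFin \o f') x)%E.
  apply: eq_measure_integral => //= A mA _.
  exact: (esym (lebesgue_measure_shift c mA)).
have mEf : measurable_fun [set: measurableTypeR R] (EFin \o f') by exact/measurable_EFinP.
have intf : mu.-integrable (sh @^-1` I) ((EFin \o f') \o sh).
  rewrite E; apply: measurable_bounded_integrable => //=.
  + by rewrite lebesgue_measure_itv/=; case: ifP; rewrite ?ltry.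
  + apply: measurable_funTS; apply: (measurableT_comp mf'); exact: measurable_shift.
  + exists `|B|; split=> [|M BM x _]; first exact: num_real.
    by rewrite /= (le_trans _ (ltW BM)).
rewrite (integral_pushforward mc mEf intf); last exact: measurable_itv.
by have -> : sh @^-1` I = `[0, r]%classic by exact: E.
Qed.

End LebesgueShift.

(** * Measurability of a cost along a measurable control *)

Section Selection.
Context {R : realType} {A : metricType R}.

Lemma mball_open (c : A) (e : R) : open [set x | mdist c x < e].
Proof.
rewrite openE => x /= cx; apply/nbhs_ballP; exists (e - mdist c x) => /=.
  by rewrite subr_gt0.
move=> y; rewrite ballEmdist/= ltrBrDl; apply: le_lt_trans.
exact: metric_triangle.
Qed.

(** Compactness in filter form, for finite sequences filtered by inclusion: near a given point every
    sequence containing that point is fine enough, so some sequence is fine enough everywhere. *)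
Lemma compact_net (e : R) : compact [set: A] -> 0 < e ->
  exists cs : seq A, forall x, exists2 c, c \in cs & mdist c x < e.
Proof.
move=> /compact_near_coveringP cA e0.
pose F : set_system (seq A) :=
  filter_from [set: seq A] (fun s0 => [set s : seq A | {subset s0 <= s}]).
have FF : Filter F.
  apply: filter_from_filter; first by exists [::].
  move=> s1 s2 _ _; exists (s1 ++ s2) => // s /= h; split=> x xs; apply: h.
    by rewrite mem_cat xs.
  by rewrite mem_cat xs orbT.
have [x _|cs _ H] := cA _ F (fun s x => exists2 c, c \in s & mdist c x < e) FF.
  exists ([set y | mdist x y < e], [set s : seq A | x \in s]) => /=.
    split; first by rewrite -ballEmdist; exact: nbhsx_ballx.
    by exists [:: x] => // s /= h; apply: h; rewrite inE.
  by move=> [y s] /= [xy xs]; exists x.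
by exists cs => x; exact: (H cs).
Qed.

(* The level sets are countable unions over nets of [A]. *)
Lemma measurable_selection (D : set R) (a : R -> A) (f : R -> A -> R) :
  measurable D -> compact [set: A] ->
  (forall U : set A, open U -> measurable (D `&` a @^-1` U)) ->
  (forall c, measurable_fun D (f^~ c)) ->
  (forall e, 0 < e -> exists2 d, 0 < d & forall s x y, D s -> mdist x y < d ->
     `|f s x - f s y| < e) ->
  measurable_fun D (fun s => f s (a s)).
Proof.
move=> mD cA ma mf uf.
apply: (measurability _ (RGenInftyO.measurableE R)) => _ [_ [y ->] <-].
pose en n : R := n.+1%:R^-1.
have en0 n : 0 < en n by rewrite invr_gt0.
pose d n := sval (cid2 (uf _ (en0 n))).
have [d0 dP] : (forall n, 0 < d n) /\ (forall n s x z, D s -> mdist x z < d n ->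
    `|f s x - f s z| < en n).
  split=> n; first by rewrite /d; case: cid2.
  by rewrite /d; case: cid2.
pose cs n := sval (cid (compact_net cA (d0 n))).
have csP n x : exists2 c, c \in cs n & mdist c x < d n := svalP (cid (compact_net cA (d0 n))) x.
have [[s0 Ds0]|D0] := pselect (D !=set0); last first.
  rewrite (_ : _ `&` _ = set0)//; apply/seteqP; split=> // s [Ds _].
  by apply: D0; exists s.
pose c0 := a s0.
(* At level [n], replacing [a s] by a net point changes [f s] by less than [en n]. The margin [en n]
   below [y] makes every piece sound; once [2 * en n] is below the gap to [y], some piece contains
   [s]. *)
have -> : D `&` (fun s => f s (a s)) @^-1` `]-oo, y[ = \bigcup_n \bigcup_j
    (if (j < size (cs n))%N then
      (D `&` a @^-1` (ball (nth c0 (cs n) j) (d n))) `&`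
      (D `&` (f^~ (nth c0 (cs n) j)) @^-1` `]-oo, y - en n[) else set0).
  apply/seteqP; split=> s /=.
    rewrite in_itv/= => -[Ds fy].
    have [n hn] : exists n, 2 * en n < y - f s (a s).
      have h0 : 0 < (y - f s (a s)) / 2 by rewrite divr_gt0// subr_gt0.
      have [n _ hn] := near_infty_natSinv_lt (PosNum h0).
      exists n; have := hn n (leqnn n); rewrite /= -/(en n) => h; lra.
    have [c ccs cd] := csP n (a s).
    exists n => //; exists (index c (cs n)) => //.
    rewrite index_mem ccs nth_index//; split; split=> //=.
      by rewrite ballEmdist.
    rewrite in_itv/=; have := dP n s c (a s) Ds cd; rewrite ltr_distl => /andP[h1 h2].
    lra.
  move=> [n _ [j _]]; case: ifPn => // jn [[Ds /=]].
  rewrite ballEmdist/= => cd [_ /=]; rewrite !in_itv/= => fy; split=> //.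
  have := dP n s _ _ Ds cd; rewrite ltr_distl => /andP[h1 h2]; lra.
apply: bigcupT_measurable => n; apply: bigcupT_measurable => j.
case: ifPn => // jn; apply: measurableI.
  by apply: ma; rewrite ballEmdist; exact: mball_open.
apply: mf => //.
Qed.

End Selection.

(** * Trajectories and dynamic programming *)

Section Standing.
Context {R : realType} {N : nat} (P : control_problem R N).
Local Notation V := 'rV[R]_N.
Local Notation T := (horizon P).
Local Notation Om1 := (dom (reg1 P)).
Local Notation Om2 := (dom (reg2 P)).
Local Notation Ga := (iface P).

(** With boolean indices [~~ i] is the opposite side, and arguments symmetric in the two regions are
    given once. *)
Definition reg (i : bool) : region R N := if i then reg1 P else reg2 P.

(** The constants of the assumptions, converted once from Euclidean to sup norms and merged into one
    bound [M] and one Lipschitz constant [L] of the dynamics. *)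
Record standing (M L : R) : Prop := Standing {
  st_T : 0 < T;
  st_geo : H_Omega P;
  st_ctl : control_assumptions P;
  st_M0 : 0 < M;
  st_L0 : 0 < L;
  st_dyn : forall i z s (a : ctrl (reg i)), spacetime (reg i) T z s ->
    `|dyn z s a| <= M;
  st_cost : forall i z s (a : ctrl (reg i)), spacetime (reg i) T z s ->
    `|cost z s a| <= M;
  st_lip : forall i z s z' s' (a : ctrl (reg i)), spacetime (reg i) T z s ->
    spacetime (reg i) T z' s' ->
    `|dyn z s a - dyn z' s' a| <= L * (`|z - z'| + `|s - s'|);
  st_term : forall z, `|terminal P z| <= M }.

Lemma standing_ex : 0 < T -> [bounded terminal P x | x in [set: V]] ->
  H_Omega P -> control_assumptions P -> exists M L, standing M L.
Proof.
move=> T0 [Mg [_ Mgb]] geo ctl.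
have [[C11 C12] [C21 C22] _ _] := ctl.
have dynM i : exists2 M, 0 <= M & forall z s (a : ctrl (reg i)),
    spacetime (reg i) T z s -> `|dyn z s a| <= M.
  have [M H] : exists M : R, forall z s (a : ctrl (reg i)),
      spacetime (reg i) T z s -> enorm (dyn z s a) <= M.
    by case: i; [case: C11|case: C12].
  exists `|M| => // z s a /H h; rewrite (le_trans (norm_le_enorm _))//.
  by rewrite (le_trans (h _))// ler_norm.
have costM i : exists2 M, 0 <= M & forall z s (a : ctrl (reg i)),
    spacetime (reg i) T z s -> `|cost z s a| <= M.
  have [M H] : exists M : R, forall z s (a : ctrl (reg i)),
      spacetime (reg i) T z s -> `|cost z s a| <= M.
    by case: i; [case: C21|case: C22].
  exists `|M| => // z s a /H h; by rewrite (le_trans (h _))// ler_norm.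
have dynL i : exists2 L, 0 <= L & forall z s z' s' (a : ctrl (reg i)),
    spacetime (reg i) T z s -> spacetime (reg i) T z' s' ->
    `|dyn z s a - dyn z' s' a| <= L * (`|z - z'| + `|s - s'|).
  have [L H] : exists L : R, forall z s z' s' (a : ctrl (reg i)),
      spacetime (reg i) T z s -> spacetime (reg i) T z' s' ->
      enorm (dyn z s a - dyn z' s' a) <= L * (enorm (z - z') + `|s - s'|).
    by case: i; [case: C11|case: C12].
  exists (`|L| * (N%:R + 1)); first by rewrite mulr_ge0 ?addr_ge0.
  move=> z s z' s' a h1 h2; rewrite (le_trans (norm_le_enorm _))//.
  rewrite (le_trans (H _ _ _ _ _ h1 h2))//.
  rewrite (@le_trans _ _ (`|L| * (enorm (z - z') + `|s - s'|)))//.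
    by rewrite ler_wpM2r ?addr_ge0 ?sqrtr_ge0// ler_norm.
  rewrite -mulrA ler_wpM2l// mulrDr lerD//.
    by rewrite (le_trans (enorm_le_norm _))// ler_wpM2r// lerDl.
  by rewrite ler_peMl// lerDr.
have [M1 M10 HM1] := dynM true; have [M2 M20 HM2] := dynM false.
have [M3 M30 HM3] := costM true; have [M4 M40 HM4] := costM false.
have [L1 L10 HL1] := dynL true; have [L2 L20 HL2] := dynL false.
have g0 : 0 <= `|Mg| + 1 by rewrite addr_ge0.
pose M := M1 + M2 + M3 + M4 + (`|Mg| + 1) + 1; exists M, (L1 + L2 + 1).
split=> //; rewrite ?/M; try lra.
- case=> z s a /[dup] h; [move=> /HM1 h1|move=> /HM2 h1]; have := h1 a; lra.
- case=> z s a /[dup] h; [move=> /HM3 h1|move=> /HM4 h1]; have := h1 a; lra.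
- case=> z s z' s' a h1 h2.
    rewrite (le_trans (HL1 _ _ _ _ _ h1 h2))// ler_wpM2r// -addrA lerDl; lra.
  rewrite (le_trans (HL2 _ _ _ _ _ h1 h2))// ler_wpM2r//; lra.
- move=> z; have := Mgb (`|Mg| + 1).
  have h : Mg < `|Mg| + 1 by rewrite (le_lt_trans (ler_norm _))// ltrDl.
  move=> /(_ h z I) /= h2; lra.
Qed.

Variables (M L : R).
Hypothesis S : standing M L.

Lemma iface_notin1 z : Ga z -> ~ Om1 z.
Proof.
have [[op1 _ _ _] e1 _ _ _] := st_geo S.
by rewrite e1 => -[_ h] /= O1; apply: h; rewrite /interior/=; exact: open_nbhs_nbhs.
Qed.

Lemma iface_notin2 z : Ga z -> ~ Om2 z.
Proof.
have [[_ op2 _ _] _ e1 _ _] := st_geo S.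
by rewrite e1 => -[_ h] /= O1; apply: h; rewrite /interior/=; exact: open_nbhs_nbhs.
Qed.

Lemma iface_closure i z : Ga z -> closure (dom (reg i)) z.
Proof.
have [_ e1 e2 _ _] := st_geo S.
by case: i; [rewrite e1|rewrite e2] => -[].
Qed.

Lemma dom_disj z : Om1 z -> Om2 z -> False.
Proof.
have [[_ _ dj _] _ _ _ _] := st_geo S.
by move=> h1 h2; have : (Om1 `&` Om2) z by []; rewrite dj.
Qed.

Lemma tricho z : [\/ Om1 z, Om2 z | Ga z].
Proof.
have [[_ _ _ U] _ _ _ _] := st_geo S.
have : [set: V] z by []; rewrite -U => -[[h|h]|h].
- by apply: Or31.
- by apply: Or32.
- by apply: Or33.
Qed.

Lemma dom_open i : open (dom (reg i)).
Proof. by have [[op1 op2 _ _] _ _ _ _] := st_geo S; case: i. Qed.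

Lemma iface_closed : closed Ga.
Proof.
have [_ e1 _ _ _] := st_geo S.
rewrite e1 /boundary setDE; apply: closedI; first exact: closed_closure.
by apply: open_closedC; exact: open_interior.
Qed.

Lemma closure_dom i z : closure (dom (reg i)) z -> dom (reg i) z \/ Ga z.
Proof.
have [_ e1 e2 _ _] := st_geo S.
move=> cz; have [h|h] := pselect (dom (reg i) z); [by left|right].
have hi : ~ interior (dom (reg i)) z by move=> /interior_subset.
by case: i cz h hi => cz h hi; [rewrite e1|rewrite e2]; split.
Qed.

Lemma notin_closure i z : ~ closure (dom (reg i)) z -> dom (reg (~~ i)) z.
Proof.
move=> h; have [h1|h2|/(iface_closure i)//] := tricho z; case: i h => h //=.
  by exfalso; apply: h; exact: subset_closure.
by exfalso; apply: h; exact: subset_closure.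
Qed.

Lemma drift_dom (i : bool) z s (a : control P) : dom (reg i) z ->
  drift z s a = if i then dyn z s a.1.1 else dyn z s a.1.2.
Proof.
case: i => /= h; rewrite /drift !indicE.
  rewrite mem_set// memNset; last by move=> /(dom_disj h).
  rewrite memNset; last by move=> /iface_notin1.
  by rewrite scale1r !scale0r !addr0.
rewrite memNset; last by move=> /dom_disj /(_ h).
rewrite mem_set// memNset; last by move=> /iface_notin2.
by rewrite scale1r !scale0r addr0 add0r.
Qed.

Lemma drift_iface z s (a : control P) : Ga z -> drift z s a = dyn_iface z s a.
Proof.
move=> h; rewrite /drift !indicE memNset; last exact: iface_notin1.
rewrite memNset; last exact: iface_notin2.
by rewrite mem_set// scale1r !scale0r !add0r.
Qed.

Lemma running_cost_dom (i : bool) z s (a : control P) : dom (reg i) z ->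
  running_cost z s a = if i then cost z s a.1.1 else cost z s a.1.2.
Proof.
case: i => /= h; rewrite /running_cost !indicE.
  rewrite mem_set// memNset; last by move=> /(dom_disj h).
  rewrite memNset; last by move=> /iface_notin1.
  by rewrite mul1r !mul0r !addr0.
rewrite memNset; last by move=> /dom_disj /(_ h).
rewrite mem_set// memNset; last by move=> /iface_notin2.
by rewrite mul1r !mul0r addr0 add0r.
Qed.

Lemma running_cost_iface z s (a : control P) : Ga z ->
  running_cost z s a = cost_iface z s a.
Proof.
move=> h; rewrite /running_cost !indicE memNset; last exact: iface_notin1.
rewrite memNset; last exact: iface_notin2.
by rewrite mem_set// mul1r !mul0r !add0r.
Qed.

Lemma time_left (t s tau T' : R) : 0 <= s <= tau -> tau <= t -> t <= T' -> 0 <= t - s <= T'.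
Proof. by move=> /andP[? ?] ? ?; apply/andP; split; lra. Qed.

Lemma drift_le z s a : 0 <= s <= T -> ctrl_set a -> `|drift (P:=P) z s a| <= M.
Proof.
move=> sT /andP[m0 m1].
have [h|h|h] := tricho z.
- rewrite (@drift_dom true)//; apply: (st_dyn S (i:=true)); split=> //.
  exact: subset_closure.
- rewrite (@drift_dom false)//; apply: (st_dyn S (i:=false)); split=> //.
  exact: subset_closure.
- rewrite drift_iface// /dyn_iface (le_trans (ler_normD _ _))// !normrZ.
  rewrite (ger0_norm m0) (ger0_norm (_ : 0 <= 1 - a.2)) ?subr_ge0//.
  have h1 : `|dyn z s a.1.1| <= M.
    by apply: (st_dyn S (i:=true)); split=> //; exact: (iface_closure true).
  have h2 : `|dyn z s a.1.2| <= M.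
    by apply: (st_dyn S (i:=false)); split=> //; exact: (iface_closure false).
  have -> : M = a.2 * M + (1 - a.2) * M by ring.
  by rewrite lerD// ler_wpM2l// subr_ge0.
Qed.

Lemma running_cost_le z s a : 0 <= s <= T -> ctrl_set a ->
  `|running_cost (P:=P) z s a| <= M.
Proof.
move=> sT /andP[m0 m1].
have [h|h|h] := tricho z.
- rewrite (@running_cost_dom true)//; apply: (st_cost S (i:=true)); split=> //.
  exact: subset_closure.
- rewrite (@running_cost_dom false)//; apply: (st_cost S (i:=false)); split=> //.
  exact: subset_closure.
- rewrite running_cost_iface// /cost_iface (le_trans (ler_normD _ _))// !normrM.
  rewrite (ger0_norm m0) (ger0_norm (_ : 0 <= 1 - a.2)) ?subr_ge0//.
  have h1 : `|cost z s a.1.1| <= M.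
    by apply: (st_cost S (i:=true)); split=> //; exact: (iface_closure true).
  have h2 : `|cost z s a.1.2| <= M.
    by apply: (st_cost S (i:=false)); split=> //; exact: (iface_closure false).
  have -> : M = a.2 * M + (1 - a.2) * M by ring.
  by rewrite lerD// ler_wpM2l// subr_ge0.
Qed.

Lemma cost_uniform i e : 0 < e -> exists2 d, 0 < d &
  forall z s z' s' (a a' : ctrl (reg i)), spacetime (reg i) T z s ->
    spacetime (reg i) T z' s' -> `|z - z'| < d -> `|s - s'| < d ->
    mdist a a' < d -> `|cost z s a - cost z' s' a'| < e.
Proof.
move=> e0; have [_ [C21 C22] _ _] := st_ctl S.
have [d d0 H] : exists2 d, 0 < d &
  forall z s z' s' (a a' : ctrl (reg i)), spacetime (reg i) T z s ->
    spacetime (reg i) T z' s' -> enorm (z - z') < d -> `|s - s'| < d ->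
    mdist a a' < d -> `|cost z s a - cost z' s' a'| < e.
  by case: i; [case: C21 => /(_ _ e0)|case: C22 => /(_ _ e0)].
exists (d / (N%:R + 1)); first by rewrite divr_gt0// ltr_wpDl.
have N1 : 1 <= N%:R + 1 :> R by rewrite lerDr.
have dd : d / (N%:R + 1) <= d by rewrite ler_pdivrMr// ler_peMr// ltW.
move=> z s z' s' a a' h1 h2 h3 h4 h5; apply: H => //.
- rewrite (le_lt_trans (enorm_le_norm _))//.
  rewrite (@le_lt_trans _ _ ((N%:R + 1) * `|z - z'|))//.
    by rewrite ler_wpM2r// lerDl.
  by rewrite mulrC -ltr_pdivlMr.
- exact: lt_le_trans dd.
- exact: lt_le_trans dd.
Qed.

Lemma ctrl_ne i : exists a : ctrl (reg i), True.
Proof.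
have [[C11 C12] _ _ _] := st_ctl S.
by case: i; [case: C11 => [[a _] _ _ _ _]|case: C12 => [[a _] _ _ _ _]]; exists a.
Qed.

Lemma ctrl_compact i : compact [set: ctrl (reg i)].
Proof. by have [[C11 C12] _ _ _] := st_ctl S; case: i; [case: C11|case: C12]. Qed.

End Standing.

(** * Partial trajectories: restriction, shift and concatenation *)

Section PartialTrajectories.
Context {R : realType} {N : nat} (P : control_problem R N) (M L : R).
Local Notation V := 'rV[R]_N.
Local Notation mu := (@lebesgue_measure R).
Local Notation T := (horizon P).
Local Notation Ga := (iface P).
Local Notation ctl := (control P).
Hypothesis S : standing P M L.
Implicit Types (r : bool) (x y : V) (t tau sg : R) (X Y : R -> V) (a c : R -> ctl).

(* Trajectories from [x], with [t] to go, followed only for a duration [tau];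
   the boolean [r] selects the regular ones. *)
Definition ptraj r x t tau X a : Prop :=
  [/\ X 0 = x,
      (forall s s', 0 <= s <= tau -> 0 <= s' <= tau -> `|X s - X s'| <= M * `|s - s'|),
      Linfty_control tau a,
      {ae mu, forall s : R, s \in `]0, tau[ ->
         is_derive s 1 X (drift (X s) (t - s) (a s))} &
      (r -> {ae mu, forall s : R, s \in `]0, tau[ -> Ga (X s) ->
         A0reg (X s) (t - s) (a s)})].

(** Improves an arbitrary Lipschitz constant to the almost everywhere bound on the derivative.
    Trajectories are assumed Lipschitz with some constant; in this way they all get the constant
    [M]. *)
Lemma lip_ae_norm_le (f : R -> R) (tau K C : R) : 0 <= tau -> 0 <= K ->
  (forall s s', 0 <= s <= tau -> 0 <= s' <= tau -> `|f s - f s'| <= K * `|s - s'|) ->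
  {ae mu, forall s : R, s \in `]0, tau[ -> exists2 v, is_derive s 1 f v & `|v| <= C} ->
  forall s s', 0 <= s <= tau -> 0 <= s' <= tau -> `|f s - f s'| <= C * `|s - s'|.
Proof.
move=> tau0 K0 fK H.
have key (g : R -> R) : (forall s s', 0 <= s <= tau -> 0 <= s' <= tau ->
      `|g s - g s'| <= K * `|s - s'|) ->
    {ae mu, forall s : R, s \in `]0, tau[ -> exists2 v, is_derive s 1 g v & `|v| <= C} ->
    forall s s', 0 <= s -> s <= s' -> s' <= tau -> g s' - g s <= C * (s' - s).
  move=> gK Hg s s' s0 ss' s't.
  have := @lip_ae_increment_le _ (fun u => g (s + u)) (s' - s) C K.
  rewrite /= addr0 (_ : s + (s' - s) = s'); last by ring.
  apply=> //; first by rewrite subr_ge0.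
    move=> u v /andP[u0 u1] /andP[v0 v1].
    have -> : u - v = s + u - (s + v) by ring.
    apply: gK; apply/andP; split; lra.
  have := ae_shift s Hg; apply: filterS; first exact: (ae_filter_ringOfSetsType mu).
  move=> u Hu; rewrite in_itv/= => /andP[u0 u1].
  have [|v dv vC] := Hu; first by rewrite in_itv/=; apply/andP; split; lra.
  exists v; last by rewrite (le_trans (ler_norm _)).
  apply/is_deriveP => e e0; have /is_deriveP/(_ _ e0) := dv; apply: filterS => h.
  by rewrite (addrC u s) addrA.
have keyN s s' : 0 <= s -> s <= s' -> s' <= tau -> `|f s' - f s| <= C * `|s' - s|.
  move=> s0 ss' s't; rewrite [X in C * X]ger0_norm ?subr_ge0// ler_norml.
  rewrite (key f fK H)// andbT lerNl.
  have := key (fun u => - f u); rewrite opprB => /(_ _ _ s s'); rewrite opprK addrC.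
  apply=> //.
    by move=> u v uI vI; rewrite -opprD normrN fK.
  move: H; apply: filterS; first exact: (ae_filter_ringOfSetsType mu).
  move=> u Hu uI; have [v dv vC] := Hu uI; exists (- v); first exact: is_deriveN.
  by rewrite normrN.
move=> s s' /andP[s0 st] /andP[s'0 s't].
case: (leP s s') => [ss'|/ltW ss']; last exact: keyN.
by rewrite distrC (distrC s); exact: keyN.
Qed.

Lemma traj_ptraj x t X a : 0 <= t <= T -> trajectories x t (X, a) ->
  ptraj false x t t X a.
Proof.
move=> /andP[t0 tT] [/= lX X0 la dX]; split=> //.
have [K K0 KX] : exists2 K, 0 <= K & forall s s', 0 <= s <= t -> 0 <= s' <= t ->
    `|X s - X s'| <= K * `|s - s'|.
  have [B [_ HB]] := lX; exists (`|B| + 1); first by rewrite addr_ge0.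
  have hB : B < `|B| + 1 by rewrite (le_lt_trans (ler_norm _))// ltrDl.
  move=> s s' sI s'I; have := HB _ hB (s, s'); rewrite /= /self_sub/=.
  by apply; split; rewrite /= in_itv.
move=> s s' sI s'I; apply: norm_le_coord => [|i].
  by rewrite mulr_ge0// ltW// (st_M0 S).
rewrite !mxE; apply: (@lip_ae_norm_le (fun u => X u 0 i) t K) => //.
  move=> u v uI vI; rewrite (le_trans _ (KX _ _ uI vI))//.
  by rewrite (le_trans _ (coord_le_norm _ i))// !mxE.
move: dX; apply: filterS; first exact: (ae_filter_ringOfSetsType mu).
move=> u du uI; have := du uI; move: uI; rewrite in_itv/= => /andP[u0 ut] {}du.
exists (drift (X u) (t - u) (a u) 0 i); first exact: is_derive_coord du.
rewrite (le_trans (coord_le_norm _ _))// (drift_le S)//.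
  by apply/andP; split; lra.
by apply: la.1; rewrite in_itv/= !ltW.
Qed.

Lemma ptraj_traj x t X a : 0 <= t -> ptraj false x t t X a -> trajectories x t (X, a).
Proof.
move=> t0 [X0 lX la dX _]; split=> //=; exists M; split; first exact: num_real.
move=> B MB [s s'] /=; rewrite !in_itv/= => -[sI s'I].
by rewrite /self_sub/= (le_trans (lX _ _ sI s'I))// ler_wpM2r// ltW.
Qed.

Definition trajs r := if r then @reg_trajectories R N P else @trajectories R N P.

Lemma trajs_ptraj r x t X a : 0 <= t <= T -> trajs r x t (X, a) <-> ptraj r x t t X a.
Proof.
move=> tI; have t0 : 0 <= t by case/andP: tI.
split; case: r => /=.
- by move=> [/= /(traj_ptraj tI)[h1 h2 h3 h4 _] h5]; split.
- exact: traj_ptraj.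
- by move=> [h1 h2 h3 h4 h5]; split; [exact: ptraj_traj|exact: h5].
- exact: ptraj_traj.
Qed.

Lemma ptrajW r x t tau X a : ptraj r x t tau X a -> ptraj false x t tau X a.
Proof. by case. Qed.

Lemma ptraj_disp r x t tau X a s : ptraj r x t tau X a -> 0 <= s <= tau ->
  `|X s - x| <= M * s.
Proof.
move=> [<- lX _ _ _] /andP[s0 st].
have -> : M * s = M * `|s - 0| by rewrite subr0 ger0_norm.
by apply: lX; rewrite ?s0 ?lexx//= (le_trans s0).
Qed.

Lemma ptraj_restrict r x t tau sg X a : sg <= tau ->
  ptraj r x t tau X a -> ptraj r x t sg X a.
Proof.
move=> st [X0 lX [la1 la2] dX rX].
have sub s : 0 <= s <= sg -> 0 <= s <= tau.
  by move=> /andP[-> h]/=; exact: le_trans st.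
have sub' s : s \in `]0, sg[ -> s \in `]0, tau[.
  by rewrite !in_itv/= => /andP[-> h]/=; exact: lt_le_trans st.
split=> //.
- by move=> s s' /sub sI /sub s'I; exact: lX.
- split=> [s|U oU].
    by rewrite in_itv/= => /sub sI; apply: la1; rewrite in_itv.
  have -> : `[0, sg] `&` a @^-1` U = `[0, sg] `&` (`[0, tau] `&` a @^-1` U).
    apply/seteqP; split=> s [/=]; first by rewrite in_itv/= => sI Us;
      rewrite !in_itv/=; split=> //; split=> //; exact: sub.
    by move=> ? [].
  by apply: measurableI => //; exact: la2.
- move: dX; apply: filterS; first exact: (ae_filter_ringOfSetsType mu).
  by move=> s ds /sub' sI; exact: ds.
- move=> /rX; apply: filterS; first exact: (ae_filter_ringOfSetsType mu).
  by move=> s ds /sub' sI; exact: ds.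
Qed.

Lemma measurable_preimage_shift sg (A : set R) : measurable A ->
  measurable ((fun s => s + sg) @^-1` A).
Proof.
by move=> mA; rewrite -[X in measurable X]setTI; exact: (measurable_shift sg).
Qed.

Lemma ptraj_shift r x t tau sg X a : 0 <= sg <= tau ->
  ptraj r x t tau X a ->
  ptraj r (X sg) (t - sg) (tau - sg) (fun s => X (s + sg)) (fun s => a (s + sg)).
Proof.
move=> /andP[s0 st] [X0 lX [la1 la2] dX rX].
have sub s : 0 <= s <= tau - sg -> 0 <= s + sg <= tau.
  by move=> /andP[h1 h2]; apply/andP; split; lra.
have sub' s : s \in `]0, tau - sg[ -> s + sg \in `]0, tau[.
  by rewrite !in_itv/= => /andP[h1 h2]; apply/andP; split; lra.
have tE s : t - sg - s = t - (s + sg) by ring.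
split.
- by rewrite add0r.
- move=> s s' /sub sI /sub s'I; rewrite (le_trans (lX _ _ sI s'I))//.
  by rewrite (_ : s + sg - (s' + sg) = s - s')//; ring.
- split=> [s|U oU].
    by rewrite in_itv/= => /sub sI; apply: la1; rewrite in_itv.
  have -> : `[0, tau - sg] `&` (fun s => a (s + sg)) @^-1` U =
     `[0, tau - sg] `&` (fun s => s + sg) @^-1` (`[0, tau] `&` a @^-1` U).
    apply/seteqP; split=> s [/=]; first by rewrite in_itv/= => sI Us;
      rewrite !in_itv/=; split=> //; split=> //; exact: sub.
    by move=> ? [].
  by apply: measurableI => //; apply: measurable_preimage_shift; exact: la2.
- have := ae_shift sg dX; apply: filterS; first exact: (ae_filter_ringOfSetsType mu).
  move=> s ds /sub' sI; rewrite tE; have /is_deriveP H := ds sI.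
  apply/is_deriveP => e e0; apply: filterS (H _ e0) => h.
  by rewrite (addrAC s h).
- move=> /rX rX'; have := ae_shift sg rX'.
  apply: filterS; first exact: (ae_filter_ringOfSetsType mu).
  by move=> s ds /sub' sI Gs; rewrite tE; exact: ds.
Qed.

Definition glue {W : Type} sg (X Y : R -> W) s := if s <= sg then X s else Y (s - sg).

(** A concatenation may have a corner at the junction [sg]; this single time is discarded. *)
Lemma ae_neq (sg : R) : {ae mu, forall s : R, s != sg}.
Proof.
exists [set sg]; split; [exact: measurable_set1|exact: lebesgue_measure_set1|].
by move=> s /= /negP; rewrite negbK => /eqP.
Qed.

Lemma ptraj_glue r x t tau sg X a Y c : 0 <= sg <= tau ->
  ptraj r x t sg X a -> ptraj r (X sg) (t - sg) (tau - sg) Y c ->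
  ptraj r x t tau (glue sg X Y) (glue sg a c).
Proof.
move=> /andP[s0 st] [X0 lX [la1 la2] dX rX] [Y0 lY [lc1 lc2] dY rY].
have tE s : t - sg - (s - sg) = t - s by ring.
have gr s : sg < s -> (s <= sg) = false by move=> h; apply/negbTE; rewrite -ltNge.
have lZ' s s' : 0 <= s -> s <= s' -> s' <= tau ->
    `|glue sg X Y s' - glue sg X Y s| <= M * `|s' - s|.
  move=> h0 h1 h2; rewrite /glue; case: (leP s sg) => h3; case: (leP s' sg) => h4.
  - apply: lX; apply/andP; split; lra.
  - rewrite -(subrKA (Y 0)) {2}Y0 (le_trans (ler_normD _ _))//.
    have e1 : `|Y (s' - sg) - Y 0| <= M * `|s' - sg - 0|.
      by apply: lY; apply/andP; split; lra.
    have e2 : `|X sg - X s| <= M * `|sg - s|.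
      by apply: lX; apply/andP; split; lra.
    rewrite subr0 ger0_norm in e1; last by lra.
    rewrite [`|sg - s|]ger0_norm in e2; last by lra.
    rewrite [`|s' - s|]ger0_norm; last by lra.
    have -> : M * (s' - s) = M * (s' - sg) + M * (sg - s) by ring.
    exact: lerD.
  - lra.
  - have -> : s' - s = s' - sg - (s - sg) by ring.
    apply: lY; apply/andP; split; lra.
split.
- by rewrite /glue s0.
- move=> s s' /andP[h0 h1] /andP[h2 h3].
  case: (leP s s') => [h|/ltW h]; last exact: lZ'.
  by rewrite distrC (distrC s); exact: lZ'.
- split=> [s|U oU].
    rewrite in_itv/= /glue => /andP[h0 h1]; case: (leP s sg) => h.
      by apply: la1; rewrite in_itv/= h0.
    by apply: lc1; rewrite in_itv/=; apply/andP; split; lra.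
  have -> : `[0, tau] `&` glue sg a c @^-1` U = (`[0, sg] `&` a @^-1` U) `|`
     (`]sg, tau] `&` (fun s => s - sg) @^-1` (`[0, tau - sg] `&` c @^-1` U)).
    apply/seteqP; split=> s /=.
      rewrite !in_itv/= /glue => -[/andP[h0 h1]]; case: (leP s sg) => h Us.
        by left; rewrite h0.
      by right; rewrite h1; split=> //; split=> //; apply/andP; split; lra.
    rewrite !in_itv/= /glue => -[[/andP[h0 h1] Us]|[/andP[h0 h1] [h2 Us]]].
      by rewrite h1 h0 (le_trans h1).
    by rewrite gr// h1 (le_trans s0 (ltW h0)).
  apply: measurableU; first exact: la2.
  by apply: measurableI => //; apply: measurable_preimage_shift; exact: lc2.
- have := ae_shift (- sg) dY; move: dX (ae_neq sg).
  apply: filterS3; first exact: (ae_filter_ringOfSetsType mu).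
  move=> s dX' nsg dY'; rewrite in_itv/= => /andP[h0 h1].
  case: (ltP s sg) => h.
    have /is_deriveP H : is_derive s 1 X (drift (X s) (t - s) (a s)).
      by apply: dX'; rewrite in_itv/= h0.
    rewrite /glue (ltW h) -/(glue sg X Y); apply/is_deriveP => e e0.
    have hh : 0 < sg - s by rewrite subr_gt0.
    have hn : \forall k \near (0 : R), `|k| < sg - s by have := nbhs0_lt hh.
    move: (H _ e0) hn; apply: filterS2 => k; rewrite ltr_norml => Hk /andP[_ k1].
    rewrite /glue (ltW h); have -> : s + k <= sg by lra.
    exact: Hk.
  have {}h : sg < s by rewrite lt_neqAle eq_sym nsg.
  have /is_deriveP H : is_derive (s - sg) 1 Y
      (drift (Y (s - sg)) (t - s) (c (s - sg))).
    by rewrite -(tE s); apply: dY'; rewrite in_itv/=; apply/andP; split; lra.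
  rewrite /glue gr// -/(glue sg X Y); apply/is_deriveP => e e0.
  have hh : 0 < s - sg by rewrite subr_gt0.
  have hn : \forall k \near (0 : R), `|k| < s - sg by have := nbhs0_lt hh.
  move: (H _ e0) hn; apply: filterS2 => k; rewrite ltr_norml => Hk /andP[k1 _].
  rewrite /glue !gr//; last by lra.
  by rewrite (addrAC s k).
- move=> rr; have := ae_shift (- sg) (rY rr); move: (rX rr) (ae_neq sg).
  apply: filterS3; first exact: (ae_filter_ringOfSetsType mu).
  move=> s dX' nsg dY'; rewrite in_itv/= => /andP[h0 h1].
  case: (ltP s sg) => h.
    by rewrite /glue (ltW h); apply: dX'; rewrite in_itv/= h0.
  have {}h : sg < s by rewrite lt_neqAle eq_sym nsg.
  rewrite /glue gr// -(tE s); apply: dY'.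
  by rewrite in_itv/=; apply/andP; split; lra.
Qed.

End PartialTrajectories.

(** * Costs along trajectories and the dynamic programming principle *)

Section Values.
Context {R : realType} {N : nat} (P : control_problem R N) (M L : R).
Local Notation V := 'rV[R]_N.
Local Notation mu := (@lebesgue_measure R).
Local Notation T := (horizon P).
Local Notation Ga := (iface P).
Local Notation ctl := (control P).
Hypothesis S : standing P M L.
Implicit Types (r : bool) (x y : V) (t tau sg : R) (X Y : R -> V) (a c : R -> ctl).

Lemma unif_measurable (D : set R) (f : R -> R) : measurable D ->
  (forall e, 0 < e -> exists2 d, 0 < d & forall s s', D s -> D s' ->
     `|s - s'| < d -> `|f s - f s'| < e) -> measurable_fun D f.
Proof.
move=> mD H; apply: subspace_continuous_measurable_fun => //.
apply/subspace_continuousP => s Ds; apply/cvgrPdist_lt => e e0.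
have [d d0 Hd] := H _ e0.
rewrite /prop_near1 /within /=; apply/nbhs_ballP; exists d => //= s' ss' Ds'.
exact: Hd.
Qed.

(** Freezing time outside [[0, tau]] makes the curve continuous on the whole line, where preimages
    of open sets are open. *)
Lemma measurable_traj r x t tau X a (B : set V) : 0 <= tau -> ptraj M r x t tau X a ->
  open B -> measurable (`[0, tau] `&` X @^-1` B).
Proof.
move=> tau0 [_ lX _ _ _] oB.
have cX : continuous (X \o clip 0 tau).
  apply: (@lipschitz_continuous _ _ _ _ M) => s s' /=.
  rewrite (le_trans (lX _ _ (clip_itv _ tau0) (clip_itv _ tau0)))//.
  by rewrite ler_wpM2l ?clip_lip// ltW// (st_M0 S).
have -> : `[0, tau] `&` X @^-1` B = `[0, tau] `&` (X \o clip 0 tau) @^-1` B.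
  by apply/seteqP; split=> s /=; rewrite in_itv/= => -[sI]; rewrite clipE.
apply: measurableI => //; apply: open_measurable.
by apply: open_comp => // s _; exact: cX.
Qed.

Lemma measurable_cost r x t tau X a i (D : set R) (al : R -> ctrl (reg P i)) :
  0 <= tau <= t -> t <= T -> ptraj M r x t tau X a ->
  measurable D -> D `<=` `[0, tau] ->
  (forall s, D s -> closure (dom (reg P i)) (X s)) ->
  (forall U, open U -> measurable (D `&` al @^-1` U)) ->
  measurable_fun D (fun s => cost (X s) (t - s) (al s)).
Proof.
move=> /andP[tau0 taut] tT [_ lX _ _ _] mD Dt DX mal.
have M0 := st_M0 S.
have DI s : D s -> 0 <= s <= tau by move=> /Dt; rewrite /= in_itv.
have stD s : D s -> spacetime (reg P i) T (X s) (t - s).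
  by move=> Ds; split; [exact: DX|have /andP[h1 h2] := DI _ Ds; apply/andP; split; lra].
apply: (@measurable_selection _ _ D al (fun s u => cost (X s) (t - s) u)) => //.
- exact: ctrl_compact S i.
- move=> u; apply: unif_measurable => // e e0.
  have [d d0 Hd] := cost_uniform S i e0.
  exists (Num.min d (d / M)); first by rewrite lt_min d0 divr_gt0.
  move=> s s' Ds Ds'; rewrite lt_min => /andP[h1 h2]; apply: Hd; rewrite ?mdistxx//.
  + exact: stD.
  + exact: stD.
  + rewrite (le_lt_trans (lX _ _ (DI _ Ds) (DI _ Ds')))//.
    by rewrite mulrC -ltr_pdivlMr.
  + by rewrite (_ : t - s - (t - s') = s' - s) 1?distrC//; ring.
- move=> e e0; have [d d0 Hd] := cost_uniform S i e0; exists d => //.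
  move=> s u v Ds uv; apply: Hd; rewrite ?subrr ?normr0//; exact: stD.
Qed.

(** The time interval is cut according to the position of [X s]. On each piece the running cost is
    one fixed expression in costs evaluated inside [spacetime], where alone they are controlled. *)
Lemma measurable_running_cost r x t tau X a : 0 <= tau <= t -> t <= T ->
  ptraj M r x t tau X a ->
  measurable_fun `[0, tau] (fun s => running_cost (X s) (t - s) (a s)).
Proof.
move=> tI tT pX; have tau0 : 0 <= tau by case/andP: tI.
pose D1 := `[0, tau] `&` X @^-1` dom (reg P true).
pose D2 := `[0, tau] `&` X @^-1` dom (reg P false).
pose D3 := `[0, tau] `&` X @^-1` Ga.
have mD1 : measurable D1 by exact: (measurable_traj tau0 pX (@dom_open _ _ _ _ _ S true)).
have mD2 : measurable D2 by exact: (measurable_traj tau0 pX (@dom_open _ _ _ _ _ S false)).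
have mD3 : measurable D3.
  have -> : D3 = `[0, tau] `\` (`[0, tau] `&` X @^-1` ~` Ga).
    apply/seteqP; split=> s [/= sI]; first by move=> h; split=> // -[].
    by move=> h; split=> //=; apply: contrapT => h2; apply: h.
  apply: measurableD => //; apply: (measurable_traj tau0 pX).
  by apply: closed_openC; exact: (iface_closed S).
have -> : `[0, tau]%classic = (D1 `|` D2) `|` D3.
  apply/seteqP; split=> s; last by move=> [[[]|[]]|[]].
  move=> sI; have [h|h|h] := tricho S (X s); [by do 2 left|by left; right|by right].
have [_ _ [_ la] _ _] := pX.
have mi (D : set R) (U : set (ctrl (reg1 P) * ctrl (reg2 P) * R)) :
    measurable D -> D `<=` `[0, tau] -> open U -> measurable (D `&` a @^-1` U).
  move=> mD DI oU.
  have -> : D `&` a @^-1` U = D `&` (`[0, tau] `&` a @^-1` U).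
    by apply/seteqP; split=> s [Ds]; [move=> h; split=> //; split=> //; exact: DI|case].
  by apply: measurableI => //; exact: la.
have m1 (D : set R) : measurable D -> D `<=` `[0, tau] ->
    (forall s, D s -> closure (dom (reg P true)) (X s)) ->
    measurable_fun D (fun s => cost (X s) (t - s) (a s).1.1).
  move=> mD DI DX; apply: (@measurable_cost r x t tau X a true) => // U oU.
  apply: (mi D (fun p => U p.1.1)) => //.
  by apply: (@open_comp _ _ (fun p : ctrl (reg1 P) * ctrl (reg2 P) * R => p.1.1)) => // p _;
    apply: (@continuous_comp _ _ _ fst fst); exact: cvg_fst.
have m2 (D : set R) : measurable D -> D `<=` `[0, tau] ->
    (forall s, D s -> closure (dom (reg P false)) (X s)) ->
    measurable_fun D (fun s => cost (X s) (t - s) (a s).1.2).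
  move=> mD DI DX; apply: (@measurable_cost r x t tau X a false) => // U oU.
  apply: (mi D (fun p => U p.1.2)) => //.
  by apply: (@open_comp _ _ (fun p : ctrl (reg1 P) * ctrl (reg2 P) * R => p.1.2)) => // p _;
    apply: (@continuous_comp _ _ _ fst snd); [exact: cvg_fst|exact: cvg_snd].
have m3 (D : set R) : measurable D -> D `<=` `[0, tau] ->
    measurable_fun D (fun s => (a s).2).
  move=> mD DI; apply: (measurability _ (RGenInftyO.measurableE R)) => _ [_ [y ->] <-].
  apply: (mi D (fun p => `]-oo, y[%classic p.2)) => //.
  by apply: (@open_comp _ _ (fun p : ctrl (reg1 P) * ctrl (reg2 P) * R => p.2)) => // p _;
    exact: cvg_snd.
have sub1 : D1 `<=` `[0, tau] by move=> s [].
have sub2 : D2 `<=` `[0, tau] by move=> s [].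
have sub3 : D3 `<=` `[0, tau] by move=> s [].
apply/measurable_funU => //; first exact: measurableU.
split; first (apply/measurable_funU => //; split).
- apply: (eq_measurable_fun (fun s => cost (X s) (t - s) (a s).1.1)).
    by move=> s /set_mem[_ h]; rewrite (running_cost_dom S (i:=true)).
  by apply: m1 => // s [_ h]; exact: subset_closure.
- apply: (eq_measurable_fun (fun s => cost (X s) (t - s) (a s).1.2)).
    by move=> s /set_mem[_ h]; rewrite (running_cost_dom S (i:=false)).
  by apply: m2 => // s [_ h]; exact: subset_closure.
- apply: (eq_measurable_fun (fun s => (a s).2 * cost (X s) (t - s) (a s).1.1 +
     (1 - (a s).2) * cost (X s) (t - s) (a s).1.2)).
    by move=> s /set_mem[_ h]; rewrite (running_cost_iface S).
  apply: measurable_funD; apply: measurable_funM.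
  + exact: m3.
  + by apply: m1 => // s [_ h]; exact: (iface_closure S true).
  + by apply: measurable_funB; [exact: measurable_cst|exact: m3].
  + by apply: m2 => // s [_ h]; exact: (iface_closure S false).
Qed.

Definition jcost X a t tau := \int[mu]_(s in `[0, tau]) running_cost (X s) (t - s) (a s).

Lemma integrable_bdd (a b : R) (f : R -> R) (B : R) (br1 br2 : bool) :
  measurable_fun `[a, b] f -> (forall s, s \in `[a, b] -> `|f s| <= B) ->
  mu.-integrable [set` Interval (BSide br1 a) (BSide br2 b)] (EFin \o f).
Proof.
move=> mf fB.
have sub : [set` Interval (BSide br1 a) (BSide br2 b)] `<=` `[a, b].
  by case: br1; case: br2 => x /=; rewrite !in_itv/= => /andP[h1 h2]; apply/andP;
    split; rewrite // ltW.
have : mu.-integrable `[a, b] (EFin \o f).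
  apply: measurable_bounded_integrable => //.
    by have := @lebesgue_measure_itv R `[a, b]; rewrite /= => ->; case: ifP; rewrite ?ltry.
  exists B; split=> [|C BC x xI]; first exact: num_real.
  by rewrite /= (le_trans (fB _ xI) (ltW BC)).
exact: integrableS.
Qed.

Lemma running_cost_ptraj_le r x t tau X a s : 0 <= tau <= t -> t <= T ->
  ptraj M r x t tau X a -> s \in `[0, tau] ->
  `|running_cost (X s) (t - s) (a s)| <= M.
Proof.
move=> /andP[t0 tt] tT [_ _ [la _] _ _] sI; apply: (running_cost_le S); last exact: la.
by move: sI; rewrite in_itv/= => /andP[h1 h2]; apply/andP; split; lra.
Qed.

Lemma jcost_le r x t tau X a : 0 <= tau <= t -> t <= T ->
  ptraj M r x t tau X a -> `|jcost X a t tau| <= M * tau.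
Proof.
move=> tI tT pX; have tau0 : 0 <= tau by case/andP: tI.
have M0 := st_M0 S.
have mf := measurable_running_cost tI tT pX.
have bf s := @running_cost_ptraj_le _ _ _ _ _ _ s tI tT pX.
rewrite (le_trans (le_normr_Rintegral _ _))//; first exact: integrable_bdd bf.
have -> : M * tau = \int[mu]_(s in `[0, tau]) M.
  rewrite Rintegral_cst//= lebesgue_measure_itv/= lte_fin.
  by case: ltgtP tau0 => //= [_ _|<- _]; rewrite ?subr0 ?mulr0.
apply: le_Rintegral => //.
- by apply: integrable_norm; exact: integrable_bdd bf.
- apply: (@integrable_bdd _ _ _ M) => [|s _]; first exact: measurable_cst.
  by rewrite ger0_norm// ltW.
Qed.

Lemma jcost_shift r x t tau sg X a : 0 <= sg <= tau -> tau <= t -> t <= T ->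
  ptraj M r x t tau X a ->
  jcost X a t tau = jcost X a t sg +
    jcost (fun s => X (s + sg)) (fun s => a (s + sg)) (t - sg) (tau - sg).
Proof.
move=> /andP[s0 st] taut tT pX.
have tI : 0 <= tau <= t by rewrite taut (le_trans s0).
have mf := measurable_running_cost tI tT pX.
have bf s := @running_cost_ptraj_le _ _ _ _ _ _ s tI tT pX.
pose f s := running_cost (X s) (t - s) (a s).
have -> : jcost X a t tau = \int[mu]_(s in `[0, sg]) f s + \int[mu]_(s in `]sg, tau]) f s.
  rewrite -(@Rintegral_itvB _ f (BLeft 0) (BRight tau) sg)//= ?bnd_simp//.
    by rewrite addrC subrK.
  exact: integrable_bdd bf.
congr (_ + _); have sub : `[sg, tau] `<=` `[0, tau].
  by move=> s /=; rewrite !in_itv/= => /andP[h1 h2]; rewrite h2 (le_trans s0).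
have mf' : measurable_fun `[sg, sg + (tau - sg)] f.
  by rewrite addrC subrK; exact: measurable_funS mf.
rewrite Rintegral_itv_obnd_cbnd; last first.
  have := integrable_bdd true false mf bf; apply: integrableS => //.
  by move=> s /=; rewrite !in_itv/= => /andP[h1 h2]; rewrite h2 (le_trans s0 (ltW h1)).
have -> : `[sg, tau]%classic = `[sg, sg + (tau - sg)]%classic by rewrite addrC subrK.
rewrite (@Rintegral_shift _ sg (tau - sg) M f)//.
  by apply: eq_Rintegral => s _; rewrite /f opprD addrA addrAC.
by move=> s; rewrite addrC subrK => sI; apply: bf; exact: sub.
Qed.

Lemma jcost_glue r x t tau sg X a Y c : 0 <= sg <= tau -> tau <= t -> t <= T ->
  ptraj M r x t sg X a -> ptraj M r (X sg) (t - sg) (tau - sg) Y c ->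
  jcost (glue sg X Y) (glue sg a c) t tau =
  jcost X a t sg + jcost Y c (t - sg) (tau - sg).
Proof.
move=> sI taut tT pX pY; have pZ := ptraj_glue sI pX pY.
have /andP[s0 st] := sI.
rewrite (jcost_shift sI taut tT pZ); congr (_ + _).
  apply: eq_Rintegral => s /set_mem; rewrite /= in_itv/= => /andP[_ h].
  by rewrite /glue h.
have tI' : 0 <= tau - sg <= t - sg by apply/andP; split; lra.
have tT' : t - sg <= T by lra.
have := ptraj_shift sI pZ; set Z := (fun s => glue sg X Y (s + sg)).
set c' := (fun s => glue sg a c (s + sg)) => pZ'.
have mf := measurable_running_cost tI' tT' pZ'.
have bf s := @running_cost_ptraj_le _ _ _ _ _ _ s tI' tT' pZ'.
have mg := measurable_running_cost tI' tT' pY.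
have bg s := @running_cost_ptraj_le _ _ _ _ _ _ s tI' tT' pY.
(* At [s = 0] the shifted control is [a sg] and not [c 0], so the left endpoint is dropped from both
   integrals. *)
rewrite /jcost -[LHS]Rintegral_itv_obnd_cbnd; last exact: integrable_bdd bf.
rewrite -[RHS]Rintegral_itv_obnd_cbnd; last exact: integrable_bdd bg.
apply: eq_Rintegral => s /set_mem; rewrite /= in_itv/= => /andP[h _].
by rewrite /Z /c' /glue (_ : (s + sg <= sg) = false) ?addrK//; apply/negbTE; rewrite -ltNge ltrDr.
Qed.

(** [value true] is [Uplus] and [value false] is [Uminus]. *)
Definition value r (p : V * R) : R := inf [set payoff p.2 Xa | Xa in @trajs R N P r p.1 p.2].

Lemma payoff_le r x t Xa : 0 <= t <= T -> @trajs R N P r x t Xa ->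
  `|payoff t Xa| <= M * T + M.
Proof.
case: Xa => X a tI /(trajs_ptraj S _ _ _ _ tI) pX; have /andP[t0 tT] := tI.
rewrite /payoff /= -/(jcost X a t t) (le_trans (ler_normD _ _))//.
rewrite lerD ?(st_term S)// (le_trans (jcost_le _ _ pX))//.
  by rewrite t0 lexx.
by rewrite ler_wpM2l// ltW// (st_M0 S).
Qed.

Lemma payoff_lbound r x t : 0 <= t <= T ->
  has_lbound [set payoff t Xa | Xa in @trajs R N P r x t].
Proof.
move=> tI; exists (- (M * T + M)) => _ [Xa /(payoff_le tI) h <-].
by move: h; rewrite ler_norml => /andP[].
Qed.

(** The first half of dynamic programming: the tail of a trajectory competes from the point where it
    starts. *)
Lemma value_ge r x t tau X a : 0 <= tau <= t -> t <= T -> ptraj M r x t t X a ->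
  jcost X a t tau + value r (X tau, t - tau) <= payoff t (X, a).
Proof.
move=> /andP[tau0 taut] tT pX.
have tI : 0 <= tau <= t by rewrite tau0.
have t'I : 0 <= t - tau <= T by apply/andP; split; lra.
have pY := ptraj_shift tI pX.
rewrite /payoff /= -/(jcost X a t t) (jcost_shift tI _ tT pX)// -addrA lerD2l.
apply: ge_inf; first exact: payoff_lbound.
exists (fun s => X (s + tau), fun s => a (s + tau)).
  exact/(trajs_ptraj S).
by rewrite /payoff /= subrK.
Qed.

(** The infimum of the empty set is 0 by convention, so an upper bound on a value requires that
    trajectories exist; this is established once sliding is available. *)
Hypothesis Hex : forall x t, 0 <= t <= T -> exists X a, ptraj M true x t t X a.

Lemma trajs_ne r x t : 0 <= t <= T -> exists Xa, @trajs R N P r x t Xa.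
Proof.
move=> tI; have [X [a pX]] := Hex x tI; exists (X, a); apply/(trajs_ptraj S) => //.
by case: r => //; exact: ptrajW pX.
Qed.

Lemma value_bound r x t : 0 <= t <= T -> `|value r (x, t)| <= M * T + M.
Proof.
move=> tI; have [Xa tX] := trajs_ne r x tI.
rewrite ler_norml; apply/andP; split.
  apply: lb_le_inf; first by exists (payoff t Xa); exists Xa.
  by move=> _ [Ya /(payoff_le tI) h <-]; move: h; rewrite ler_norml => /andP[].
apply: (@le_trans _ _ (payoff t Xa)).
  by apply: ge_inf; [exact: payoff_lbound|exists Xa].
by have := payoff_le tI tX; rewrite ler_norml => /andP[].
Qed.

Lemma value_le r x t tau X a : 0 <= tau <= t -> t <= T -> ptraj M r x t tau X a ->
  value r (x, t) <= jcost X a t tau + value r (X tau, t - tau).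
Proof.
move=> tI tT pX; have /andP[tau0 taut] := tI.
have t'I : 0 <= t - tau <= T by apply/andP; split; lra.
have t0I : 0 <= t <= T by apply/andP; split; lra.
rewrite -lerBlDl; apply: lb_le_inf.
  by have [Ya tY] := trajs_ne r (X tau) t'I; exists (payoff (t - tau) Ya); exists Ya.
move=> _ [[Y c] /(trajs_ptraj S _ _ _ _ t'I) pY <-]; rewrite lerBlDl.
have pZ := ptraj_glue tI pX pY.
apply: (@le_trans _ _ (payoff t (glue tau X Y, glue tau a c))).
  apply: ge_inf; first exact: payoff_lbound.
  exists (glue tau X Y, glue tau a c) => //; exact/(trajs_ptraj S).
rewrite /payoff /= -/(jcost _ _ t t) (jcost_glue tI _ tT pX pY)// -addrA !lerD2l.
(* At the junction the left branch is used, which matters when [tau = t]: then the terminal point is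
   [X tau], equal to [Y 0]. *)
rewrite /glue; case: ifPn => // h.
have -> : t = tau by apply/eqP; rewrite eq_le h taut.
by rewrite subrr; have [-> _ _ _ _] := pY.
Qed.

End Values.

(** * The interface as a level set *)

Section Geometry.
Context {R : realType} {N : nat} (P : control_problem R N) (M L : R).
Local Notation V := 'rV[R]_N.
Local Notation Ga := (iface P).
Local Notation sd := (signed_dist P).
Hypothesis S : standing P M L.

(** With this sign [sgn i * sd] is negative in region [i] and positive in the other one. *)
Definition sgn (i : bool) : R := if i then 1 else -1.

Lemma dist_ge0 (A : set V) x : 0 <= dist_to A x.
Proof.
rewrite /dist_to; have [A0|A0] := pselect (A !=set0).
  apply: lb_le_inf; first by have [z Az] := A0; exists (enorm (x - z)); exists z.
  by move=> d [z _ <-]; exact: sqrtr_ge0.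
have -> : [set enorm (x - z) | z in A] = set0.
  by apply/seteqP; split=> // d [z Az _]; apply: A0; exists z.
by rewrite inf0.
Qed.

Lemma dist_le (A : set V) x z : A z -> dist_to A x <= enorm (x - z).
Proof.
move=> Az; apply: ge_inf; last by exists z.
by exists 0 => _ [y _ <-]; exact: sqrtr_ge0.
Qed.

Lemma dist_gt0 (A : set V) x : closed A -> A !=set0 -> ~ A x -> 0 < dist_to A x.
Proof.
move=> cA [z Az] nA.
have /nbhs_ballP[e /= e0 He] : nbhs x (~` A).
  by apply: open_nbhs_nbhs; split=> //; exact: closed_openC.
apply: (lt_le_trans e0); apply: lb_le_inf; first by exists (enorm (x - z)); exists z.
move=> _ [y Ay <-]; rewrite leNgt; apply/negP => h.
apply: (He y) Ay; rewrite -ball_normE /=.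
by apply: le_lt_trans h; exact: norm_le_enorm.
Qed.

Lemma sd_iface z : Ga z -> sd z = 0.
Proof.
move=> Gz; rewrite /signed_dist memNset; last exact: (iface_notin1 S Gz).
apply/eqP; rewrite eq_le dist_ge0 andbT.
by rewrite (le_trans (dist_le _ Gz))// subrr enorm0.
Qed.

(** For an empty interface [dist_to] would be the infimum of the empty set, that is 0; hence the
    nonemptiness hypothesis here and below. *)
Lemma sd_dom i x : Ga !=set0 -> dom (reg P i) x -> sgn i * sd x < 0.
Proof.
move=> G0; case: i => /= h; rewrite /signed_dist /sgn.
  rewrite mem_set// mul1r oppr_lt0 dist_gt0//; first exact: (iface_closed S).
  by move=> /(iface_notin1 S).
rewrite memNset; last by move=> /(dom_disj S) /(_ h).
rewrite mulN1r oppr_lt0 dist_gt0//; first exact: (iface_closed S).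
by move=> /(iface_notin2 S).
Qed.

Lemma sd_eq0 x : Ga !=set0 -> sd x = 0 -> Ga x.
Proof.
move=> G0 x0; have [h|h|//] := tricho S x.
  by have := @sd_dom true x G0 h; rewrite x0 mulr0 ltxx.
by have := @sd_dom false x G0 h; rewrite x0 mulr0 ltxx.
Qed.

Lemma sd_lt0 i x : Ga !=set0 -> sgn i * sd x < 0 -> dom (reg P i) x.
Proof.
move=> G0; have [h|h|h] := tricho S x; last by rewrite sd_iface// mulr0 ltxx.
  case: i => //; have := @sd_dom true x G0 h; rewrite /sgn mul1r mulN1r => h1 h2.
  by exfalso; lra.
case: i => //; have := @sd_dom false x G0 h; rewrite /sgn mul1r mulN1r => h1 h2.
by exfalso; lra.
Qed.

Lemma sd_normE x : Ga !=set0 -> `|sd x| = dist_to Ga x.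
Proof.
move=> G0; have d0 := dist_ge0 Ga x.
by rewrite /signed_dist; case: ifP => _; [rewrite normrN ger0_norm|rewrite ger0_norm].
Qed.

(** A ball inside the neighbourhood where [sd] is regular is convex, so the segment condition of
    [W2infty_on] holds between any two of its points. *)
Lemma sd_regular z : Ga z -> exists r K, [/\ 0 < r, 0 < K,
  (forall x, `|x - z| < r -> differentiable sd x /\ `|grad sd x| <= K) &
  (forall x y, `|x - z| < r -> `|y - z| < r ->
     `|grad sd x - grad sd y| <= K * `|x - y|)].
Proof.
move=> Gz; have [_ _ _ [D [oD GD [dD [K [K1 K2]]]]] _] := st_geo S.
have /nbhs_ballP[r /= r0 rD] : nbhs z D.
  by apply: open_nbhs_nbhs; split=> //; exact: GD.
have zD x : `|x - z| < r -> D x.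
  by move=> xz; apply: rD; rewrite -ball_normE /= distrC.
exists r, (`|K| * (N%:R + 1) + 1); split=> //.
- move=> x /zD Dx; split; first exact: dD.
  have [_ h] := K1 x Dx; rewrite (le_trans (norm_le_enorm _))// (le_trans h)//.
  rewrite (le_trans (ler_norm _))// ler_wpDr// ler_peMr// lerDr//.
- move=> x y xz yz; rewrite (le_trans (norm_le_enorm _))//.
  have h : enorm (grad sd x - grad sd y) <= K * enorm (x - y).
    apply: K2 => u /andP[u0 u1]; apply: zD.
    have -> : y + u *: (x - y) - z = (1 - u) *: (y - z) + u *: (x - z).
      by apply/rowP => i; rewrite !mxE; ring.
    rewrite (le_lt_trans (ler_normD _ _))// !normrZ (ger0_norm u0) ger0_norm ?subr_ge0//.
    have [u1'|u1'] := eqVneq u 1; first by rewrite u1' subrr mul0r add0r mul1r.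
    have h1 : (1 - u) * `|y - z| < (1 - u) * r.
      by rewrite ltr_pM2l// subr_gt0 lt_neqAle u1'.
    have h2 : u * `|x - z| <= u * r by rewrite ler_wpM2l// ltW.
    lra.
  rewrite (le_trans h)//.
  rewrite (@le_trans _ _ (`|K| * (N%:R * `|x - y|)))//.
    rewrite (@le_trans _ _ (`|K| * enorm (x - y)))//.
      by rewrite ler_wpM2r ?sqrtr_ge0// ler_norm.
    by rewrite ler_wpM2l// enorm_le_norm.
  rewrite mulrDr mulr1 mulrA !mulrDl -addrA lerDl addr_ge0// mulr_ge0//.
Qed.

Lemma is_derive_grad (f : V -> R) (X : R -> V) (s : R) (v : V) :
  differentiable f (X s) -> is_derive s 1 X v ->
  is_derive s 1 (fun u => f (X u)) (edot (grad f (X s)) v).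
Proof.
move=> df dX; have He := @expansion_grad _ _ f (X s, s) df.
have := @is_derive_chain _ _ setT (fun q => f q.1) _ 0 X id s v 1 He dX (is_derive_id s 1).
rewrite /= mul0r addr0; apply; exact: (@filterT _ (nbhs (0 : R))).
Qed.

(** If the gradient vanished at [z], its Lipschitz continuity would make [sd] Lipschitz with
    constant 1/2 near [z]. But a point [x] of the first region near [z] has an interface point [y]
    with [|y - x|] less than twice the distance of [x], while [|sd x|] is that distance. *)
Lemma iface_grad_neq0 z : Ga z -> grad sd z != 0.
Proof.
move=> Gz; apply/eqP => g0.
have G0 : Ga !=set0 by exists z.
have [r [K [r0 K0 Hd HL]]] := sd_regular Gz.
(* On this ball [N * |grad sd|] is at most 1/2; the factor [N] comes from [edot_le]. *)
pose r1 := Num.min r (2 * K * (N%:R + 1))^-1.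
have r10 : 0 < r1 by rewrite lt_min r0 invr_gt0 !mulr_gt0.
have r1r : r1 <= r by rewrite ge_min lexx.
have small x : `|x - z| < r1 -> N%:R * `|grad sd x| <= 2^-1.
  move=> xz; have := HL x z (lt_le_trans xz r1r); rewrite subrr normr0 g0 subr0.
  move=> /(_ r0) h; have h2 : `|x - z| <= (2 * K * (N%:R + 1))^-1.
    by rewrite (le_trans (ltW xz))// ge_min lexx orbT.
  rewrite (@le_trans _ _ ((N%:R + 1) * (K * (2 * K * (N%:R + 1))^-1)))//.
    apply: ler_pM => //; first by rewrite lerDl.
    by rewrite (le_trans h)// ler_wpM2l// ltW.
  rewrite le_eqVlt; apply/orP; left; apply/eqP; field.
  by rewrite !gt_eqF.
have half x y : `|x - z| < r1 -> `|y - z| < r1 -> `|sd y - sd x| <= 2^-1 * `|y - x|.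
  move=> xz yz.
  have seg u : 0 <= u -> u <= 1 -> `|x + u *: (y - x) - z| < r1.
    move=> u0 u1; have -> : x + u *: (y - x) - z = (1 - u) *: (x - z) + u *: (y - z).
      by apply/rowP => i; rewrite !mxE; ring.
    rewrite (le_lt_trans (ler_normD _ _))// !normrZ (ger0_norm u0) ger0_norm ?subr_ge0//.
    have [u1'|u1'] := eqVneq u 1; first by rewrite u1' subrr mul0r add0r mul1r.
    have h1 : (1 - u) * `|x - z| < (1 - u) * r1.
      by rewrite ltr_pM2l// subr_gt0 lt_neqAle u1'.
    have h2 : u * `|y - z| <= u * r1 by rewrite ler_wpM2l// ltW.
    lra.
  pose X (u : R) : V := x + u *: (y - x).
  have dX (u : R) : is_derive u 1 X (y - x).
    apply: is_derive_row => i; apply/is_deriveP => e e0; near=> h.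
    rewrite /X !mxE.
    have -> : x 0 i + (u + h) * (y 0 i - x 0 i) - (x 0 i + u * (y 0 i - x 0 i)) -
      h *: (y 0 i - x 0 i) = 0 by rewrite -[h *: _]/(h * _); ring.
    by rewrite normr0 mulr_ge0// ltW.
  have dsd (u : R) : 0 <= u -> u <= 1 ->
      is_derive u 1 (fun u => sd (X u)) (edot (grad sd (X u)) (y - x)).
    move=> u0 u1; apply: is_derive_grad (dX u).
    by apply: (Hd _ _).1; apply: lt_le_trans r1r; exact: seg.
  have := @increment_norm_le _ (fun u => sd (X u)) (fun u => edot (grad sd (X u)) (y - x))
    0 1 (2^-1 * `|y - x|) ler01.
  rewrite /X scale1r scale0r addr0 subrKC subr0 mulr1; apply.
    apply: derivable_within_continuous => u; rewrite in_itv/= => /andP[u0 u1].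
    exact: (@ex_derive _ _ _ _ _ _ _ (dsd u u0 u1)).
  move=> u; rewrite in_itv/= => /andP[u0 u1]; split; first exact: (dsd _ (ltW u0) (ltW u1)).
  rewrite (le_trans (edot_le _ _))// ler_wpM2r// small//.
  exact: (seg _ (ltW u0) (ltW u1)).
(* The distance of [x] is at most [(N + 1) * r2], so [y] lies within [2 * (N + 1) * r2 + r2 = r1] of
   [z]. *)
pose r2 := r1 / (2 * (N%:R + 1) + 1).
have r20 : 0 < r2 by rewrite divr_gt0.
have r21 : (2 * (N%:R + 1) + 1) * r2 = r1 by rewrite mulrC divfK// gt_eqF.
have [x [Ox xz]] : exists x, dom (reg1 P) x /\ `|x - z| < r2.
  have cz : closure (dom (reg1 P)) z := iface_closure S true Gz.
  have [x [Ox /=]] := cz _ (nbhsx_ballx z _ r20).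
  by rewrite -ball_normE /= distrC => h; exists x.
have rho0 : 0 < dist_to Ga x.
  apply: dist_gt0 => //; first exact: (iface_closed S).
  by move=> /(iface_notin1 S).
have hasinf : has_inf [set enorm (x - y) | y in Ga].
  split; first by exists (enorm (x - z)); exists z.
  by exists 0 => _ [y _ <-]; exact: sqrtr_ge0.
(* The slack in the infimum is the distance itself, whence the factor 2. *)
have [_ [y Gy <-] yx] := inf_adherent rho0 hasinf.
rewrite -/(dist_to Ga x) in yx.
have xz' : enorm (x - z) <= (N%:R + 1) * r2.
  rewrite (le_trans (enorm_le_norm _))// ler_pM//; first by rewrite lerDl.
  exact: ltW.
have rhoz := dist_le x Gz.
have yx' : `|y - x| < 2 * dist_to Ga x.
  rewrite distrC (le_lt_trans (norm_le_enorm _))// (lt_le_trans yx)//; lra.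
have xr1 : `|x - z| < r1 by rewrite (lt_le_trans xz)// -r21 ler_peMl ?(ltW r20)//
  lerDr mulr_ge0// ltW.
have yr1 : `|y - z| < r1.
  rewrite -(subrKA x) (le_lt_trans (ler_normD _ _))//.
  have : 2 * dist_to Ga x <= 2 * ((N%:R + 1) * r2) by lra.
  rewrite mulrDl mul1r in r21; lra.
have := half x y xr1 yr1; rewrite (sd_iface Gy) sub0r normrN sd_normE//; lra.
Unshelve. all: by end_near. Qed.

End Geometry.

(** * Flows with uniform life time and curves in level sets *)

Section Flow.
Context {R : realType} {N : nat}.
Local Notation V := 'rV[R]_N.

(** Time runs backwards in the field, as in the definition of trajectories. [K] depends on neither
    the starting point nor the starting time, so the life time is uniform. *)
Lemma local_flow (D : set (V * R)) (F : V * R -> V) : vbdd_lip D F ->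
  exists2 K, 0 < K & forall (x0 : V) (t : R), exists X : R -> V, [/\ X 0 = x0,
    (forall s s', `|X s - X s'| <= K * `|s - s'|) &
    forall s : R, `|s| < (2 * K)^-1 -> D (X s, t - s) ->
      is_derive s 1 X (F (X s, t - s))].
Proof.
move=> /vector_extension[G [K K0 [GF GK GL]]]; exists K => // x0 t.
have GL' p q : `|G (p.1, t - p.2) - G (q.1, t - q.2)| <= K * `|p - q|.
  rewrite (le_trans (GL _ _))// ler_wpM2l ?(ltW K0)// !prod_normE /=.
  by rewrite (_ : t - p.2 - (t - q.2) = - (p.2 - q.2)) ?normrN//; ring.
have [X [X0 XK dX]] := picard x0 K0 (fun p => GK (p.1, t - p.2)) GL'.
exists X; split=> // s sK Ds; rewrite -GF//; exact: dX sK.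
Qed.

Lemma bdd_lip_fst (D : set (V * R)) (B : set V) (F : V -> V) (K : R) : 0 <= K ->
  (forall p, D p -> B p.1) ->
  (forall x, B x -> `|F x| <= K) ->
  (forall x y, B x -> B y -> `|F x - F y| <= K * `|x - y|) ->
  vbdd_lip D (fun p => F p.1).
Proof.
move=> K0 DB h1 h2; apply: (vbdd_lip_norm K0) => [p /DB/h1//|p q /DB Bp /DB Bq].
rewrite (le_trans (h2 _ _ Bp Bq))// ler_wpM2l// prod_normE le_max.
by rewrite lexx.
Qed.

Lemma norm_pair_fst (x z : V) (s : R) : `|(x, s) - (z, s)| = `|x - z|.
Proof. by rewrite prod_normE /= subrr normr0 max_l. Qed.

Lemma derive0_cst (f : R -> R) (rho : R) : (forall s : R, `|s| < rho -> is_derive s 1 f 0) ->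
  forall s, `|s| < rho -> f s = f 0.
Proof.
move=> df s srho; apply/eqP; rewrite -subr_eq0 -normr_le0.
have key a b : a <= b -> - rho < a -> b < rho -> `|f b - f a| <= 0.
  move=> ab h1 h2; have hI u : u \in `[a, b] -> `|u| < rho.
    by rewrite in_itv/= => /andP[h3 h4]; rewrite ltr_norml; apply/andP; split; lra.
  have := @increment_norm_le _ f (fun=> 0) a b 0 ab; rewrite mul0r; apply.
    apply: derivable_within_continuous => u /hI/df hu; exact: (@ex_derive _ _ _ _ _ _ _ hu).
  move=> u uI; rewrite normr0; split=> //; apply: df; apply: hI.
  by move: uI; rewrite !in_itv/= => /andP[/ltW-> /ltW->].
move: srho; rewrite ltr_norml => /andP[s1 s2].
case: (leP 0 s) => [s0|/ltW s0]; first by apply: key => //; lra.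
by rewrite distrC; apply: key => //; lra.
Qed.

(** The constant field [v] is projected orthogonally to [n]. Along the flow of the projected field
    [f] has zero derivative, and at [z] the projection leaves [v] unchanged. *)
Lemma level_curve (f : V -> R) (n : V -> V) (z v : V) (r K : R) : 0 < r -> 0 < K ->
  (forall x, `|x - z| < r -> `|n x| <= K) ->
  (forall x y, `|x - z| < r -> `|y - z| < r -> `|n x - n y| <= K * `|x - y|) ->
  (forall (X : R -> V) (s : R) w, `|X s - z| < r -> is_derive s 1 X w ->
     is_derive s 1 (fun u => f (X u)) (edot (n (X s)) w)) ->
  n z != 0 -> edot (n z) v = 0 ->
  exists X : R -> V, [/\ X 0 = z, (\forall s \near 0, f (X s) = f z) &
    is_derive (0 : R) 1 X v].
Proof.
move=> r0 K0 nK nL df nz0 nv.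
pose B := [set x : V | `|x - z| < r].
pose D := [set p : V * R | `|p.1 - z| < r].
have lbn : vbdd_lip D (fun p => n p.1).
  by apply: (@bdd_lip_fst D B n K) => //; exact: ltW.
have [C C0 [_ hC]] := bdd_lip_edot lbn lbn.
have nz : 0 < edot (n z) (n z) by exact: edotvv_gt0.
(* Half of [n . n] at [z] remains a lower bound nearby, which keeps the quotient in the projection
   Lipschitz. *)
pose e := edot (n z) (n z) / 2; have e0 : 0 < e by rewrite divr_gt0.
pose r1 := Num.min r (e / (C + 1)).
have C1 : 0 < C + 1 by rewrite ltr_wpDl.
have r10 : 0 < r1 by rewrite lt_min r0 divr_gt0.
have r1r : r1 <= r by rewrite ge_min lexx.
have nlow x : `|x - z| < r1 -> e <= edot (n x) (n x).
  move=> xz; have xr := lt_le_trans xz r1r.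
  have Dz : D (z, 0) by rewrite /D/= subrr normr0.
  have h : `|edot (n x) (n x) - edot (n z) (n z)| <= C * `|x - z|.
    by rewrite -(norm_pair_fst x z 0); exact: (hC (x, 0) (z, 0) xr Dz).
  have h2 : C * `|x - z| <= e.
    rewrite (@le_trans _ _ ((C + 1) * (e / (C + 1))))//.
      apply: ler_pM => //; first by rewrite lerDl.
      by rewrite (le_trans (ltW xz))// ge_min lexx orbT.
    by rewrite mulrC divfK// gt_eqF.
  move: (le_trans h h2); rewrite ler_norml => /andP[h3 _].
  have E2 : edot (n z) (n z) = e + e by rewrite /e -splitr.
  by move: h3; rewrite E2 lerBrDr addKr.
pose D1 := [set p : V * R | `|p.1 - z| < r1].
have lbn1 : vbdd_lip D1 (fun p => n p.1).
  by move=> i; apply: bdd_lipS (lbn i) => p /= h; exact: lt_le_trans r1r.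
pose F (p : V * R) : V :=
  v + (- (edot v (n p.1) * (edot (n p.1) (n p.1))^-1)) *: n p.1.
have lbv : vbdd_lip D1 (fun=> v) by move=> i; exact: bdd_lip_cst.
have lbF : vbdd_lip D1 F.
  apply: vbdd_lipD => //; apply: vbdd_lipZ => //; apply: bdd_lipN.
  apply: bdd_lipM; first exact: bdd_lip_edot.
  apply: (bdd_lipV e0); last exact: bdd_lip_edot.
  by move=> p Dp; rewrite (le_trans (nlow _ Dp))// ler_norm.
have Fn x t : `|x - z| < r1 -> edot (n x) (F (x, t)) = 0.
  move=> xz; rewrite /F /= edotDr edotZr mulNr -mulrA mulVf ?mulr1; last first.
    by rewrite gt_eqF// (lt_le_trans e0)// nlow.
  by rewrite edotC subrr.
have Fz t : F (z, t) = v.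
  by rewrite /F /= edotC nv mul0r oppr0 scale0r addr0.
have [K1 K10 /(_ z 0)[X [X0 XK dX]]] := local_flow lbF.
pose rho := Num.min (2 * K1)^-1 (r1 / (K1 + 1)).
have K11 : 0 < K1 + 1 by rewrite ltr_wpDl// ltW.
have rho0 : 0 < rho by rewrite lt_min invr_gt0 mulr_gt0// divr_gt0.
have Xr s : `|s| < rho -> `|X s - z| < r1.
  rewrite lt_min => /andP[_ h]; rewrite -X0 (le_lt_trans (XK _ _))// subr0.
  rewrite (@le_lt_trans _ _ (`|s| * (K1 + 1)))//.
    by rewrite mulrC ler_wpM2l// lerDl.
  by rewrite -ltr_pdivlMr.
have dX' (s : R) : `|s| < rho -> is_derive s 1 X (F (X s, 0 - s)).
  move=> h; apply: dX; first by move: h; rewrite lt_min => /andP[].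
  exact: Xr.
have fX s : `|s| < rho -> f (X s) = f z.
  move=> h; rewrite -X0; apply: (@derive0_cst (fun s => f (X s)) rho) => // u hu.
  rewrite -(@Fn (X u) (0 - u)) ?Xr//; apply: df; last exact: dX'.
  by rewrite (lt_le_trans _ r1r)// Xr.
exists X; split=> //.
- have hn : \forall s \near (0 : R), `|s| < rho by have := nbhs0_lt rho0.
  by apply: filterS hn => s; exact: fX.
- by have := dX' 0; rewrite normr0 X0 Fz; apply.
Qed.

End Flow.

(** * Tangent vectors and normals of the interface *)

Section Normals.
Context {R : realType} {N : nat} (P : control_problem R N) (M L : R).
Local Notation V := 'rV[R]_N.
Local Notation Ga := (iface P).
Local Notation sd := (signed_dist P).
Hypothesis S : standing P M L.

(** Unit normals are defined by orthogonality to tangent vectors, so enough tangent vectors must be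
    exhibited to determine them. *)
Lemma iface_tangent z v : Ga z -> edot (grad sd z) v = 0 -> tangent Ga z v.
Proof.
move=> Gz nv; have [r [K [r0 K0 Hd HL]]] := sd_regular S Gz.
have df (X : R -> V) (s : R) w : `|X s - z| < r -> is_derive s 1 X w ->
    is_derive s 1 (fun u => sd (X u)) (edot (grad sd (X s)) w).
  by move=> h; apply: is_derive_grad; exact: (Hd _ h).1.
have [X [X0 fX dX]] := @level_curve _ _ sd (grad sd) z v r K r0 K0
    (fun x h => (Hd x h).2) HL df (iface_grad_neq0 S Gz) nv.
exists X; split=> //; apply: filterS fX => s; rewrite (sd_iface S Gz).
by apply: (sd_eq0 S); exists z.
Qed.

Let sgn_absurd (b : bool) (h d : R) : sgn b * h < 0 -> sgn (~~ b) * d < 0 ->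
  - (- (sgn b * h) / 2) <= d - h -> d - h <= - (sgn b * h) / 2 -> False.
Proof. by case: b; rewrite /sgn ?mul1r ?mulN1r => *; lra. Qed.

(** The component of the normal orthogonal to the gradient is a tangent vector, hence orthogonal to
    the normal itself, hence zero. The sign follows from the ray along the normal, which runs in the
    opposite region, where [sgn i * sd] is positive. *)
Lemma normal_grad i z : Ga z ->
  exists2 k, 0 < k & normal (reg P i) z = k *: (sgn i *: grad sd z).
Proof.
move=> Gz; have [_ e1 e2 _ Hn] := st_geo S.
have G0 : Ga !=set0 by exists z.
have [m1 mt mo] : outward_unit_normal (dom (reg P i)) z (normal (reg P i) z).
  by have [h1 h2] := Hn _ Gz; case: i; [exact: h1|exact: h2].
move: (normal (reg P i) z) m1 mt mo => m m1 mt mo.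
have ht w : edot (grad sd z) w = 0 -> tangent Ga z w by exact: iface_tangent.
have nz0 := iface_grad_neq0 S Gz.
have [r [K [r0 K0 Hd _]]] := sd_regular S Gz.
have dsd : is_derive (0 : R) 1 (fun s => sd (z + s *: m)) (edot (grad sd z) m).
  have dX : is_derive (0 : R) 1 (fun s => z + s *: m) m.
    apply: is_derive_row => j; apply/is_deriveP => e e0; near=> h.
    rewrite !mxE add0r mul0r addr0.
    have -> : z 0 j + h * m 0 j - z 0 j - h *: m 0 j = 0.
      by rewrite -[h *: _]/(h * _); ring.
    by rewrite normr0 mulr_ge0// ltW.
  have := @is_derive_grad _ _ sd (fun s => z + s *: m) 0 m.
  rewrite scale0r addr0; apply => //.
  by apply: (Hd _ _).1; rewrite subrr normr0.
move: (grad sd z) ht nz0 dsd => n ht nz0 dsd.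
have nz : 0 < edot n n by exact: edotvv_gt0.
pose c := edot m n / edot n n.
have mE : m = c *: n.
  apply/eqP; rewrite -subr_eq0; apply/eqP; apply: edotvv_eq0.
  have tn : edot n (m - c *: n) = 0.
    by rewrite edotBr edotZr (edotC n m) /c divfK ?subrr// gt_eqF.
  rewrite edotBl edotZl tn mulr0 subr0.
  apply: mt; case: (i) => /=; [rewrite -e1|rewrite -e2]; exact: ht.
have c0 : c != 0.
  apply/eqP => c0; move: m1; rewrite mE c0 scale0r enorm0 => /esym/eqP.
  by rewrite oner_eq0.
have sm : 0 <= sgn i * edot n m.
  (* With a negative slope, the expansion at half that slope would put nearby points of the ray in
     region [i]. *)
  rewrite leNgt; apply/negP => neg.
  pose e := - (sgn i * edot n m) / 2.
  have e0 : 0 < e by rewrite divr_gt0// oppr_gt0.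
  have /is_deriveP/(_ _ e0) H := dsd.
  have H2 : \forall h \near 0^'+, ~ closure (dom (reg P i)) (z + h *: m) /\
      `|sd (z + (0 + h) *: m) - sd (z + 0 *: m) - h *: edot n m| <= e * `|h|.
    have H' : \forall h \near 0^'+,
        `|sd (z + (0 + h) *: m) - sd (z + 0 *: m) - h *: edot n m| <= e * `|h|.
      by apply: (@filterS _ (nbhs (0 : R)) _ _ _ _ H) => h hh _.
    exact: filterI mo H'.
  have [h [h0 [nc hh]]] : exists h : R, 0 < h /\ (~ closure (dom (reg P i)) (z + h *: m) /\
      `|sd (z + (0 + h) *: m) - sd (z + 0 *: m) - h *: edot n m| <= e * `|h|).
    have h3 : \forall h \near 0^'+, (0 : R) < h by exact: nbhs_right_gt.
    have [h [h1 h2]] := filter_ex (@filterI _ (0 : R)^'+ _ _ _ h3 H2).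
    by exists h.
  have := notin_closure S nc; move=> /(sd_dom S G0).
  move: hh; rewrite add0r scale0r addr0 (sd_iface S Gz) subr0 (gtr0_norm h0).
  rewrite -[h *: edot n m]/(h * edot n m) ler_norml => /andP[].
  have -> : e * h = - (sgn i * (h * edot n m)) / 2 by rewrite /e; ring.
  have ha : sgn i * (h * edot n m) < 0 by rewrite mulrCA pmulr_rlt0.
  by move=> h1 h2 h3; exact: (sgn_absurd ha h3 h1 h2).
have sn : sgn i * sgn i = 1 :> R.
  by case: (i); rewrite /sgn /=; [rewrite mul1r|rewrite mulN1r opprK].
exists (sgn i * c).
  have : 0 <= sgn i * c.
    have : sgn i * edot n m = (sgn i * c) * edot n n by rewrite mE edotZr; ring.
    move=> h; move: sm; rewrite h pmulr_lge0//.
  rewrite le_eqVlt => /predU1P[|//] /esym/eqP; rewrite mulf_eq0 (negbTE c0) orbF.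
  by case: (i); rewrite /sgn /=; [rewrite oner_eq0|rewrite oppr_eq0 oner_eq0].
by rewrite scalerA mulrAC sn mul1r.
Unshelve. all: by end_near. Qed.

End Normals.

(** * Trajectories driven by constant and feedback controls *)

Section Strategies.
Context {R : realType} {N : nat} (P : control_problem R N) (M L : R).
Local Notation V := 'rV[R]_N.
Local Notation T := (horizon P).
Local Notation Ga := (iface P).
Local Notation ctl := (control P).
Hypothesis S : standing P M L.

Lemma ptraj_intro (r : bool) (y : V) (t tau : R) (X : R -> V) (a : R -> ctl) (K : R) : 0 <= tau <= t -> t <= T ->
  X 0 = y -> 0 <= K -> (forall s s', `|X s - X s'| <= K * `|s - s'|) ->
  Linfty_control tau a ->
  (forall s : R, 0 < s < tau -> is_derive s 1 X (drift (X s) (t - s) (a s))) ->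
  (r -> forall s : R, 0 < s < tau -> Ga (X s) -> A0reg (X s) (t - s) (a s)) ->
  ptraj M r y t tau X a.
Proof.
move=> /andP[tau0 taut] tT X0 K0 XK la dX rX; split=> //.
- move=> s s' sI s'I; apply: norm_le_coord => [|i].
    by rewrite mulr_ge0// ltW// (st_M0 S).
  rewrite !mxE; apply: (@lip_ae_norm_le _ (fun u => X u 0 i) tau K) => //.
    by move=> u v _ _; rewrite (le_trans _ (XK _ _))// (le_trans _ (coord_le_norm _ i))// !mxE.
  apply: aeW => u; rewrite in_itv/= => uI; have /andP[u0 u1] := uI.
  exists (drift (X u) (t - u) (a u) 0 i); first exact: is_derive_coord (dX _ uI).
  rewrite (le_trans (coord_le_norm _ _))// (drift_le S)//.
    by apply/andP; split; lra.
  by apply: la.1; rewrite in_itv/= !ltW.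
- by apply: aeW => s; rewrite in_itv/=; exact: dX.
- by move=> rr; apply: aeW => s; rewrite in_itv/=; exact: rX.
Qed.

Lemma inj_ctrl i (al : ctrl (reg P i)) : exists c : ctl, [/\ ctrl_set c,
  (forall z s, dom (reg P i) z -> drift z s c = dyn z s al) &
  (forall z s, dom (reg P i) z -> running_cost z s c = cost z s al)].
Proof.
have [d1 _] := ctrl_ne S true; have [d2 _] := ctrl_ne S false.
case: i al => al.
  exists (al, d2, 1); split; first by rewrite /ctrl_set/= ler01 lexx.
    by move=> z s Oz; rewrite (drift_dom S (i:=true)).
  by move=> z s Oz; rewrite (running_cost_dom S (i:=true)).
exists (d1, al, 0); split; first by rewrite /ctrl_set/= ler01 lexx.
  by move=> z s Oz; rewrite (drift_dom S (i:=false)).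
by move=> z s Oz; rewrite (running_cost_dom S (i:=false)).
Qed.

Lemma Linfty_cst (t : R) (c : ctl) : ctrl_set c -> Linfty_control t (cst c).
Proof.
move=> cc; split=> [//|U oU]; have [Uc|Uc] := pselect (U c).
  rewrite (_ : _ `&` _ = `[0, t]%classic)//.
  by apply/seteqP; split=> s [] //.
rewrite (_ : _ `&` _ = set0)//.
by apply/seteqP; split=> s // [].
Qed.

Definition stset i : set (V * R) := [set p | spacetime (reg P i) T p.1 p.2].

Lemma dyn_bdd_lip i (al : ctrl (reg P i)) :
  vbdd_lip (stset i) (fun p => dyn p.1 p.2 al).
Proof.
have M0 := st_M0 S; have L0 := st_L0 S.
apply: (@vbdd_lip_norm _ _ _ _ _ (M + 2 * L)).
- by rewrite addr_ge0 ?mulr_ge0// ltW.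
- move=> p Dp; rewrite ler_wpDr ?mulr_ge0// ?(ltW L0)//; exact: (st_dyn S).
- move=> p q Dp Dq; rewrite (le_trans (st_lip S _ Dp Dq))// mulrDl.
  rewrite ler_wpDl ?mulr_ge0 ?(ltW M0)// [X in X * `|_|]mulrC -mulrA ler_wpM2l ?(ltW L0)//.
  rewrite mulr_natl mulr2n lerD// prod_normE le_max lexx// orbT//.
Qed.

(** The flow of the extended field is followed up to the exit time, or to [tau] if that comes first.
    Before it the curve avoids the interface, so it is regular vacuously; at the exit it is in the
    closure of the region, hence on the interface. *)
Lemma run i (al : ctrl (reg P i)) : exists c : ctl, exists2 tau1, 0 < tau1 &
  [/\ ctrl_set c,
    (forall z s, dom (reg P i) z -> drift z s c = dyn z s al),
    (forall z s, dom (reg P i) z -> running_cost z s c = cost z s al) &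
   forall y t tau, dom (reg P i) y -> 0 <= tau -> tau <= tau1 -> tau <= t -> t <= T ->
   exists sg X, continuous X /\ [/\ 0 <= sg <= tau, ptraj M true y t sg X (cst c),
     sg = tau \/ Ga (X sg), (forall s, 0 <= s < sg -> dom (reg P i) (X s)) &
     forall s : R, 0 < s < sg -> is_derive s 1 X (dyn (X s) (t - s) al)]].
Proof.
have [c [cc dc rc]] := inj_ctrl al.
have [K K0 HX] := local_flow (dyn_bdd_lip al).
(* Half of the life time, so that the flow equation also holds at the final time. *)
exists c, ((2 * K)^-1 / 2); first by rewrite divr_gt0// invr_gt0 mulr_gt0.
split=> // y t tau Oy tau0 taut1 taut tT.
have [X [X0 XK dX]] := HX y t.
have cX : continuous X by exact: (lipschitz_continuous XK).
(* The exit time is the supremum of this set. If the curve were still in the open region there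
   before time [tau], it would stay in it a little longer. *)
pose E := [set s | 0 <= s <= tau /\ forall u, 0 <= u <= s -> dom (reg P i) (X u)].
have E0 : E 0.
  split; first by rewrite lexx.
  by move=> u /andP[u0 u0']; have -> : u = 0 by [apply/eqP; rewrite eq_le u0 u0']; rewrite X0.
have hE : has_sup E by split; [exists 0|exists tau => s [/andP[]]].
pose sg := sup E.
have sg0 : 0 <= sg by exact: ub_le_sup hE.2 _ E0.
have sgt : sg <= tau by apply: ge_sup; [exists 0|move=> s [/andP[]]].
have Hdom s : 0 <= s < sg -> dom (reg P i) (X s).
  move=> /andP[s0 ssg]; have e0 : 0 < sg - s by rewrite subr_gt0.
  have [u [_ Eu]] := sup_adherent e0 hE; rewrite -/sg subKr => su.
  by apply: Eu; rewrite s0 ltW.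
have cl : closure (dom (reg P i)) (X sg).
  have [s0|s0] := eqVneq sg 0; first by rewrite s0 X0; exact: subset_closure.
  move=> B /cX /= /nbhs_ballP[e /= e0 HB].
  have sg_gt0 : 0 < sg by rewrite lt_neqAle eq_sym s0.
  pose k := Num.min (e / 2) sg.
  have k0 : 0 < k by rewrite lt_min divr_gt0.
  have ks : k <= sg by rewrite ge_min lexx orbT.
  have ke : k < e.
    rewrite (@le_lt_trans _ _ (e / 2)) ?ge_min ?lexx// ltr_pdivrMr// ltr_pMr//.
    by rewrite ltr1n.
  exists (X (sg - k)); split.
    by apply: Hdom; apply/andP; split; lra.
  by apply: HB; rewrite /ball/= subKr gtr0_norm.
have st s : 0 <= s <= sg -> spacetime (reg P i) T (X s) (t - s).
  move=> /andP[s0 ssg]; split; last by apply/andP; split; lra.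
  have [->//|ns] := eqVneq s sg.
  by apply: subset_closure; apply: Hdom; rewrite s0 lt_neqAle ns.
have dX' s : 0 < s < sg -> is_derive s 1 X (dyn (X s) (t - s) al).
  move=> /andP[s0 ssg]; apply: dX; last by apply: st; rewrite !ltW.
  rewrite gtr0_norm//; have h : 0 < (2 * K)^-1 by rewrite invr_gt0 mulr_gt0.
  lra.
exists sg, X; split=> //; split=> //.
- by rewrite sg0.
- apply: (@ptraj_intro _ _ _ _ _ _ K) => //.
  + by rewrite sg0 (le_trans sgt).
  + exact: ltW.
  + exact: Linfty_cst.
  + move=> s sI; rewrite dc; first exact: dX'.
    by apply: Hdom; case/andP: sI => /ltW-> ->.
  + move=> _ s sI Gs; exfalso; have := Hdom s; case/andP: sI => /ltW-> -> /(_ isT).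
    by case: (i) => ?; [exact: (iface_notin1 S Gs)|exact: (iface_notin2 S Gs)].
- have [h|h] := closure_dom S cl; [left|by right].
  apply/eqP; rewrite eq_le sgt leNgt; apply/negP => lt.
  have /cX /= /nbhs_ballP[e /= e0 HB] : nbhs (X sg) (dom (reg P i)).
    by apply: open_nbhs_nbhs; split=> //; exact: (@dom_open _ _ _ _ _ S i).
  pose k := Num.min (e / 2) (tau - sg).
  have k0 : 0 < k by rewrite lt_min divr_gt0//= subr_gt0.
  have ks : k <= tau - sg by rewrite ge_min lexx orbT.
  have ke : k < e.
    rewrite (@le_lt_trans _ _ (e / 2)) ?ge_min ?lexx// ltr_pdivrMr// ltr_pMr//.
    by rewrite ltr1n.
  have : E (sg + k).
    split; first by apply/andP; split; lra.
    move=> u /andP[u0 uk]; case: (ltP u sg) => us; first by apply: Hdom; rewrite u0.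
    by apply: HB; rewrite /ball/= distrC ger0_norm; lra.
  by move=> /(ub_le_sup hE.2); rewrite -/sg; lra.
Qed.

End Strategies.

(** * Entering a region from the interface *)

Section Entering.
Context {R : realType} {N : nat} (P : control_problem R N) (M L : R).
Local Notation V := 'rV[R]_N.
Local Notation T := (horizon P).
Local Notation Ga := (iface P).
Local Notation sd := (signed_dist P).
Local Notation ctl := (control P).
Hypothesis S : standing P M L.

Lemma bdd_lip_near {E : normedModType R} (D : set E) (f : E -> R) (e : R) :
  bdd_lip D f -> 0 < e ->
  exists2 d, 0 < d & forall p q, D p -> D q -> `|p - q| < d -> `|f p - f q| < e.
Proof.
move=> [K K0 [_ h]] e0; have K1 : 0 < K + 1 by rewrite ltr_wpDl.
exists (e / (K + 1)); first by rewrite divr_gt0.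
move=> p q Dp Dq pq; rewrite (le_lt_trans (h _ _ Dp Dq))//.
rewrite (@le_lt_trans _ _ ((K + 1) * `|p - q|))//.
  by rewrite ler_wpM2r// lerDl.
by rewrite mulrC -ltr_pdivlMr.
Qed.

Lemma ctrl_field i (al : ctrl (reg P i)) : exists G : V * R -> V,
  vbdd_lip setT G /\ forall p, stset P i p -> G p = dyn p.1 p.2 al.
Proof.
have [G [K K0 [h1 h2 h3]]] := vector_extension (dyn_bdd_lip S al).
exists G; split=> //; apply: (@vbdd_lip_norm _ _ _ _ _ K) => //; exact: ltW.
Qed.

Lemma pair_norm_lt (p q : V * R) (d : R) : `|p.1 - q.1| < d -> `|p.2 - q.2| < d ->
  `|p - q| < d.
Proof. by move=> h1 h2; rewrite prod_normE gt_max h1 h2. Qed.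

Definition tube (z : V) (d : R) : set (V * R) := [set p | `|p.1 - z| < d].

Lemma normal_speed (G : V * R -> V) z : Ga z -> vbdd_lip setT G ->
  exists2 r, 0 < r & (forall x, `|x - z| < r -> differentiable sd x) /\
    bdd_lip (tube z r) (fun p => edot (G p) (grad sd p.1)).
Proof.
move=> Gz lG; have [r [K [r0 K0 Hd HL]]] := sd_regular S Gz.
exists r => //; split; first by move=> x /Hd[].
apply: bdd_lip_edot; first by move=> i; apply: bdd_lipS (lG i).
apply: (@bdd_lip_fst _ _ _ [set x | `|x - z| < r] (grad sd) K) => //; first exact: ltW.
by move=> x /Hd[].
Qed.

Lemma short_time (X : R -> V) (z y : V) (K rho s : R) : 0 < K -> X 0 = y ->
  (forall s s', `|X s - X s'| <= K * `|s - s'|) ->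
  `|y - z| < rho / 2 -> `|s| < rho / 2 / (K + 1) -> `|X s - z| < rho.
Proof.
move=> K0 X0 XK yz ss; have K1 : 0 < K + 1 by rewrite ltr_wpDl// ltW.
rewrite -(subrKA y) (le_lt_trans (ler_normD _ _))// [ltRHS]splitr ltrD// -X0.
rewrite (le_lt_trans (XK _ _))// subr0 (@le_lt_trans _ _ (`|s| * (K + 1)))//.
  by rewrite mulrC ler_wpM2l// lerDl.
by rewrite -ltr_pdivlMr.
Qed.

(** The dynamics is defined only on the closure of the region, which the curve is not yet known to
    enter, so the flow of an extension is used. Along it [sgn i * sd] starts at 0 and decreases at
    rate at least [e]; this puts the curve in the region, where the extension is the true
    dynamics. *)
Lemma enter i (al : ctrl (reg P i)) z s0 : Ga z -> 0 <= s0 <= T ->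
  sgn i * edot (dyn z s0 al) (grad sd z) < 0 ->
  exists c : ctl, exists rho tau1, [/\ [/\ 0 < rho, 0 < tau1 & ctrl_set c],
    (forall z s, dom (reg P i) z -> drift z s c = dyn z s al),
    (forall z s, dom (reg P i) z -> running_cost z s c = cost z s al) &
   forall y t tau, Ga y -> `|y - z| < rho -> `|t - s0| < rho ->
   0 <= tau -> tau <= tau1 -> tau <= t -> t <= T ->
   exists X, [/\ ptraj M true y t tau X (cst c),
     (forall s, 0 < s <= tau -> dom (reg P i) (X s)) &
     forall s : R, 0 < s < tau -> is_derive s 1 X (dyn (X s) (t - s) al)]].
Proof.
move=> Gz s0I neg; have G0 : Ga !=set0 by exists z.
have [c [cc dc rc]] := inj_ctrl S al.
have [G [lG GE]] := ctrl_field al.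
have [r r0 [Hd lf]] := normal_speed Gz lG.
have Gz0 : G (z, s0) = dyn z s0 al.
  by apply: GE; split=> //; exact: (iface_closure S i).
set b := sgn i * _ in neg; pose e := - b / 2.
have e0 : 0 < e by rewrite divr_gt0// oppr_gt0.
have [d d0 Hnear] := bdd_lip_near lf e0.
have [K K0 HX] := local_flow lG.
pose rho := Num.min r d; have rho0 : 0 < rho by rewrite lt_min r0.
have rr : rho <= r by rewrite ge_min lexx.
have rd : rho <= d by rewrite ge_min lexx orbT.
have K1 : 0 < K + 1 by rewrite ltr_wpDl// ltW.
pose tau1 := Num.min ((2 * K)^-1 / 2) (Num.min (rho / 2 / (K + 1) / 2) (rho / 2)).
have tau10 : 0 < tau1.
  by rewrite !lt_min !divr_gt0// invr_gt0 mulr_gt0.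
exists c, (rho / 2), tau1; split=> //; first by split=> //; rewrite divr_gt0.
move=> y t tau Gy yz ts tau0 taut1 taut tT.
have [X [X0 XK dX]] := HX y t.
have h1 : tau <= (2 * K)^-1 / 2 by rewrite (le_trans taut1)// ge_min lexx.
have h2 : tau <= rho / 2 / (K + 1) / 2.
  by rewrite (le_trans taut1)// ge_min; apply/orP; right; rewrite ge_min lexx.
have h3 : tau <= rho / 2.
  by rewrite (le_trans taut1)// !ge_min lexx !orbT.
have p1 : 0 < (2 * K)^-1 by rewrite invr_gt0 mulr_gt0.
have p2 : 0 < rho / 2 / (K + 1) by rewrite !divr_gt0.
have dXs (s : R) : 0 <= s <= tau -> is_derive s 1 X (G (X s, t - s)).
  by move=> /andP[u0 u1]; apply: dX => //; rewrite ger0_norm//; clear - u1 h1 p1; lra.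
have Xz s : 0 <= s <= tau -> `|X s - z| < rho.
  move=> /andP[u0 u1]; apply: (@short_time _ _ _ _ rho _ K0 X0 XK yz).
  by rewrite ger0_norm//; clear - u1 h2 p2; lra.
have speed s : 0 <= s <= tau -> sgn i * edot (grad sd (X s)) (G (X s, t - s)) <= - e.
  move=> sI; have := Hnear (X s, t - s) (z, s0).
  rewrite /tube/= subrr normr0 => /(_ (lt_le_trans (Xz _ sI) rr) r0).
  have hh : `|(X s, t - s) - (z, s0)| < d.
    apply: pair_norm_lt => /=; first exact: lt_le_trans (Xz _ sI) rd.
    apply: lt_le_trans rd; case/andP: sI => u0 u1.
    move: ts; rewrite !ltr_norml => /andP[k1 k2].
    by clear - k1 k2 u0 u1 h3; apply/andP; split; lra.
  move=> /(_ hh); rewrite Gz0 (edotC (grad _ _)).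
  have : b = sgn i * edot (dyn z s0 al) (grad sd z) by [].
  move: (edot _ _) (edot _ _) => q q' bq; rewrite ltr_norml => /andP[k1 k2].
  rewrite /e bq in k1 k2 *.
  by move: k1 k2; case: (i); rewrite /sgn /= ?mul1r ?mulN1r => k1 k2; clear - k1 k2; lra.
have dsd (s : R) : 0 <= s <= tau ->
    is_derive s 1 (fun u => sgn i * sd (X u)) (sgn i * edot (grad sd (X s)) (G (X s, t - s))).
  move=> sI; apply: is_deriveZ; apply: is_derive_grad (dXs _ sI).
  by apply: Hd; apply: lt_le_trans rr; exact: Xz.
have Xdom s : 0 < s <= tau -> dom (reg P i) (X s).
  move=> /andP[u0 u1]; apply: (sd_lt0 S) => //.
  have := @increment_le _ (fun u => sgn i * sd (X u))
    (fun u => sgn i * edot (grad sd (X u)) (G (X u, t - u))) 0 s (- e) (ltW u0).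
  rewrite X0 (sd_iface S Gy) mulr0 !subr0 => H.
  apply: (@le_lt_trans _ _ (- e * s)); last by rewrite mulNr oppr_lt0 mulr_gt0.
  apply: H.
    apply: derivable_within_continuous => u; rewrite in_itv/= => /andP[v0 v1].
    have /dsd hu : 0 <= u <= tau by rewrite v0 (le_trans v1).
    exact: (@ex_derive _ _ _ _ _ _ _ hu).
  move=> u; rewrite in_itv/= => /andP[v0 v1].
  have uI : 0 <= u <= tau by rewrite (ltW v0) (le_trans (ltW v1)).
  by split; [exact: dsd|exact: speed].
have dX' s : 0 < s < tau -> is_derive s 1 X (dyn (X s) (t - s) al).
  move=> /andP[u0 u1]; rewrite -(GE (X s, t - s)).
    by apply: dXs; rewrite !ltW.
  split; last by apply: (time_left _ taut tT); rewrite !ltW.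
  by apply: subset_closure; apply: Xdom; rewrite u0 ltW.
exists X; split=> //; apply: (@ptraj_intro _ _ _ _ _ S _ _ _ _ _ _ K) => //.
- by rewrite tau0.
- exact: ltW.
- exact: Linfty_cst.
- move=> s sI; rewrite dc; first exact: dX'.
  by apply: Xdom; case/andP: sI => -> /ltW.
- move=> _ s sI Gs; exfalso; have := Xdom s; case/andP: sI => -> /ltW-> /(_ isT).
  by case: (i) => ?; [exact: (iface_notin1 S Gs)|exact: (iface_notin2 S Gs)].
Qed.

End Entering.

(** * Reaching the interface in a time proportional to the distance *)

Section Hitting.
Context {R : realType} {N : nat} (P : control_problem R N) (M L : R).
Local Notation T := (horizon P).
Local Notation Ga := (iface P).
Local Notation sd := (signed_dist P).
Local Notation ctl := (control P).
Hypothesis S : standing P M L.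

(** While the curve stays in region [i], [sgn i * sd] is negative, yet it grows at rate at least [e]
    from a value no lower than [- N * |y - z|]. The region is therefore left before time
    [C * |y - z|]. *)
Lemma hit i (al : ctrl (reg P i)) z s0 : Ga z -> 0 <= s0 <= T ->
  0 < sgn i * edot (dyn z s0 al) (grad sd z) ->
  exists c : ctl, exists rho C, [/\ 0 < rho, 0 < C &
   forall y t, dom (reg P i) y -> `|y - z| < rho -> `|t - s0| < rho ->
   C * `|y - z| <= t -> t <= T ->
   exists sg X, [/\ 0 <= sg <= C * `|y - z|, ptraj M true y t sg X (cst c) & Ga (X sg)]].
Proof.
move=> Gz s0I pos; have G0 : Ga !=set0 by exists z.
have M0 := st_M0 S.
have [c [tau1 tau10 [cc dc rc Hrun]]] := run S al.
have [G [lG GE]] := ctrl_field S al.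
have [r r0 [Hd lf]] := normal_speed S Gz lG.
have Gz0 : G (z, s0) = dyn z s0 al.
  by apply: GE; split=> //; exact: (iface_closure S i).
set b := sgn i * _ in pos; pose e := b / 2.
have e0 : 0 < e by rewrite divr_gt0.
have [d d0 Hnear] := bdd_lip_near lf e0.
pose q := Num.min r d; have q0 : 0 < q by rewrite lt_min r0.
have qr : q <= r by rewrite ge_min lexx.
have qd : q <= d by rewrite ge_min lexx orbT.
(* The distance to the interface is exhausted after [N / e * |y - z|]; the extra 1 makes the
   allotted time strictly longer. *)
pose C := (N%:R + 1) / e; have C0 : 0 < C by rewrite divr_gt0.
(* [rho * B] adds up the initial distance, the displacement at speed [M] during [C * rho], and that
   duration, so the motion stays where the speed estimate is valid. *)
pose B := 1 + (M + 1) * C; have B0 : 0 < B by rewrite addr_gt0// mulr_gt0// addr_gt0.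
pose rho := Num.min (q / B) (tau1 / C).
have rho0 : 0 < rho by rewrite lt_min !divr_gt0.
have rB : rho * B <= q.
  by rewrite -ler_pdivlMr// ge_min lexx.
have rC : rho * C <= tau1 by rewrite -ler_pdivlMr// ge_min lexx orbT.
exists c, rho, C; split=> // y t Oy yz ts yt tT.
have yz0 : 0 < `|y - z|.
  rewrite normr_gt0 subr_eq0; apply/eqP => E; rewrite E in Oy.
  by case: (i) Oy => ?; [exact: (iface_notin1 S Gz)|exact: (iface_notin2 S Gz)].
have tau0 : 0 <= C * `|y - z| by rewrite mulr_ge0// ltW.
have Cy : C * `|y - z| < C * rho by rewrite ltr_pM2l.
have taut1 : C * `|y - z| <= tau1.
  by rewrite (le_trans (ltW Cy))// mulrC.
have [sg [X [cX [sgI pX alt Xdom dX]]]] := Hrun y t _ Oy tau0 taut1 yt tT.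
have /andP[sg0 sgt] := sgI.
exists sg, X; split=> //; case: alt => // sgE; exfalso.
have X0 : X 0 = y by case: pX.
have rBE : rho * B = rho + M * (C * rho) + C * rho by rewrite /B; ring.
have Xz s : 0 <= s <= sg -> `|X s - z| < q.
  move=> sI; have /andP[u0 u1] := sI; have h := ptraj_disp pX sI.
  rewrite -(subrKA y) (le_lt_trans (ler_normD _ _))//.
  have h2 : M * s <= M * (C * rho) by rewrite ler_wpM2l ?(ltW M0)// (le_trans u1)// (le_trans sgt)// ltW.
  have h3 := mulr_ge0 (ltW C0) (ltW rho0).
  by clear - yz h h2 h3 rB rBE; lra.
have tsq s : 0 <= s <= sg -> `|t - s - s0| < q.
  move=> /andP[u0 u1]; rewrite (addrAC t) (le_lt_trans (ler_normB _ _))//.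
  rewrite (ger0_norm u0).
  have h3 := mulr_ge0 (ltW M0) (mulr_ge0 (ltW C0) (ltW rho0)).
  by clear - ts u1 sgt Cy h3 rB rBE; lra.
have st s : 0 <= s < sg -> stset P i (X s, t - s).
  move=> sI; have /andP[u0 u1] := sI; split; last first.
    by apply: (time_left _ (le_trans sgt yt) tT); rewrite u0 ltW.
  by apply: subset_closure; exact: Xdom.
have speed s : 0 < s < sg -> e <= sgn i * edot (grad sd (X s)) (dyn (X s) (t - s) al).
  move=> /andP[u0 u1]; have sI : 0 <= s <= sg by rewrite !ltW.
  have := Hnear (X s, t - s) (z, s0).
  rewrite /tube/= subrr normr0 => /(_ (lt_le_trans (Xz _ sI) qr) r0).
  have hh : `|(X s, t - s) - (z, s0)| < d.
    apply: pair_norm_lt => /=; first exact: lt_le_trans (Xz _ sI) qd.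
    exact: lt_le_trans (tsq _ sI) qd.
  move=> /(_ hh); rewrite Gz0 (edotC (grad _ _)).
  rewrite (GE (X s, t - s)); last by apply: st; rewrite ltW.
  have : b = sgn i * edot (dyn z s0 al) (grad sd z) by [].
  move: (edot _ _) (edot _ _) => u v bq; rewrite ltr_norml => /andP[k1 k2].
  rewrite /e bq in k1 k2 *.
  by move: k1 k2; case: (i); rewrite /sgn /= ?mul1r ?mulN1r => k1 k2; clear - k1 k2; lra.
have dsd (s : R) : 0 < s < sg ->
    is_derive s 1 (fun u => sgn i * sd (X u))
      (sgn i * edot (grad sd (X s)) (dyn (X s) (t - s) al)).
  move=> sI; apply: is_deriveZ; apply: is_derive_grad (dX _ sI).
  by apply: Hd; apply: lt_le_trans qr; apply: Xz; case/andP: sI => /ltW-> /ltW->.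
(* By this time [sgn i * sd] would have become nonnegative although the curve is still in the
   region. *)
pose s1 := N%:R / e * `|y - z|.
have s10 : 0 <= s1 by rewrite !mulr_ge0// ?invr_ge0 ltW.
have s1sg : s1 < sg.
  rewrite sgE /s1 /C ltr_pM2r// ltr_pM2r ?invr_gt0// ltrDl//.
have sdy : - (e * s1) <= sgn i * sd y.
  have h : `|sd y| <= e * s1.
    have -> : e * s1 = N%:R * `|y - z| by rewrite /s1 mulrA (mulrC e) divfK// gt_eqF.
    rewrite (sd_normE _ G0) (le_trans (dist_le _ Gz))//; exact: enorm_le_norm.
  move: h; rewrite ler_norml.
  by case: (i); rewrite /sgn /= ?mul1r ?mulN1r => /andP[k1 k2]; clear - k1 k2; lra.
have sdX u : 0 <= u <= sg -> {for u, continuous (fun u => - (sgn i * sd (X u)))}.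
  move=> uI; have cs : {for X u, continuous sd}.
    by apply: differentiable_continuous; apply: Hd; apply: lt_le_trans qr; exact: Xz.
  have csX : {for u, continuous (sd \o X)} by apply: continuous_comp; [exact: cX|].
  have c1 : (sgn i * sd (X v)) @[v --> u] --> sgn i * sd (X u).
    by apply: cvgMl_tmp; exact: csX.
  by apply: (cvgN c1).
have cX' : {within `[0, s1], continuous (fun u => - (sgn i * sd (X u)))}.
  apply: continuous_in_subspaceT => u /set_mem; rewrite /= in_itv/= => /andP[u0 u1].
  by apply: sdX; rewrite u0 (le_trans u1)// ltW.
have := Xdom s1; rewrite s10 s1sg => /(_ isT)/(sd_dom S G0).
have H : - (sgn i * sd (X s1)) - - (sgn i * sd (X 0)) <= - e * (s1 - 0).
  apply: (@increment_le _ (fun u => - (sgn i * sd (X u)))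
    (fun u => - (sgn i * edot (grad sd (X u)) (dyn (X u) (t - u) al)))) => //.
  move=> u; rewrite in_itv/= => /andP[u0 u1].
  have uI : 0 < u < sg by rewrite u0 (lt_trans u1).
  split; first by apply: is_deriveN; exact: dsd.
  by rewrite lerN2; exact: speed.
rewrite X0 subr0 in H; move=> H'; clear - H H' sdy; lra.
Qed.

End Hitting.

(** * Sliding along the interface under a feedback control *)

Section Sliding.
Context {R : realType} {N : nat} (P : control_problem R N) (M L : R).
Local Notation V := 'rV[R]_N.
Local Notation T := (horizon P).
Local Notation Ga := (iface P).
Local Notation sd := (signed_dist P).
Local Notation ctl := (control P).
Hypothesis S : standing P M L.

(** Only the third component varies, so measurability reduces to that of a Lipschitz real
    function. *)
Lemma feedback_control (a1 : ctrl (reg1 P)) (a2 : ctrl (reg2 P)) (f : R -> R) tau C :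
  0 <= C -> (forall s s', 0 <= s <= tau -> 0 <= s' <= tau -> `|f s - f s'| <= C * `|s - s'|) ->
  (forall s, 0 <= s <= tau -> 0 <= f s <= 1) ->
  Linfty_control (P:=P) tau (fun s => (a1, a2, f s)).
Proof.
move=> C0 fl f01; split; first by move=> s; rewrite in_itv /=; exact: f01.
move=> U oU; have C1 : 0 < C + 1 by rewrite ltr_wpDl.
have mg : measurable_fun `[0, tau] f.
  apply: unif_measurable => // eps eps0.
  exists (eps / (C + 1)); first by rewrite divr_gt0.
  move=> s s'; rewrite /= !in_itv/= => sI s'I ss.
  rewrite (le_lt_trans (fl _ _ sI s'I))//.
  apply: (@le_lt_trans _ _ ((C + 1) * `|s - s'|)); first by rewrite ler_wpM2r// lerDl.
  by rewrite mulrC -ltr_pdivlMr.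
have oU' : open ((fun u : R => (a1, a2, u)) @^-1` U).
  apply: open_comp => // u _.
  have h1 : (fun _ : R => (a1, a2)) x @[x --> u] --> (a1, a2) by exact: cvg_cst.
  exact: (cvg_pair h1 (@cvg_id _ (nbhs u))).
exact: (mg (measurable_itv _) _ (open_measurable oU')).
Qed.

(* The feedback [m = B2 / (B1 + B2)] makes the mixed dynamics tangent to the
   interface; [e] tells whether both dynamics point outwards or both inwards. *)
Lemma slide (e : bool) z s0 (a1 : ctrl (reg1 P)) (a2 : ctrl (reg2 P)) (B1 B2 : R) :
  Ga z -> 0 <= s0 <= T ->
  B1 = edot (dyn z s0 a1) (grad sd z) -> B2 = - edot (dyn z s0 a2) (grad sd z) ->
  0 < sgn e * B1 -> 0 < sgn e * B2 ->
  exists (m : V * R -> R) rho tau1, [/\ 0 < rho, 0 < tau1, m (z, s0) = B2 / (B1 + B2),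
   (forall eps, 0 < eps -> exists2 d, 0 < d & forall p, `|p.1 - z| < d ->
      `|p.2 - s0| < d -> `|m p - m (z, s0)| < eps) &
   forall y t tau, Ga y -> `|y - z| < rho -> `|t - s0| < rho ->
   0 <= tau -> tau <= tau1 -> tau <= t -> t <= T ->
   exists X, [/\ ptraj M e y t tau X (fun s => (a1, a2, m (X s, t - s))),
     (forall s, 0 <= s <= tau -> Ga (X s)), (forall s, 0 <= s <= tau -> 0 <= m (X s, t - s) <= 1) &
     forall s : R, 0 < s < tau -> is_derive s 1 X
        (dyn_iface (P:=P) (X s) (t - s) (a1, a2, m (X s, t - s)))]].
Proof.
move=> Gz s0I B1E B2E B10 B20; have G0 : Ga !=set0 by exists z.
have [G1 [lG1 GE1]] := ctrl_field S (i:=true) a1.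
have [G2 [lG2 GE2]] := ctrl_field S (i:=false) a2.
have [r1 r10 [Hd1 lf1]] := normal_speed S Gz lG1.
have [r2 r20 [Hd2 lf2]] := normal_speed S Gz lG2.
pose f1 p := edot (G1 p) (grad sd p.1).
(* With this sign [f2], like [f1], is positive for motion out of its own region. *)
pose f2 p := - edot (G2 p) (grad sd p.1).
have f1z : f1 (z, s0) = B1.
  by rewrite B1E /f1 GE1//; split=> //; exact: (iface_closure S true).
have f2z : f2 (z, s0) = B2.
  by rewrite B2E /f2 GE2//; split=> //; exact: (iface_closure S false).
have {}lf2 : bdd_lip (tube z r2) f2 by exact: bdd_lipN.
have {}lf1 : bdd_lip (tube z r1) f1 by exact: lf1.
have e10 : 0 < sgn e * B1 / 2 by rewrite divr_gt0.
have e20 : 0 < sgn e * B2 / 2 by rewrite divr_gt0.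
have [d1 d10 near1] := bdd_lip_near lf1 e10.
have [d2 d20 near2] := bdd_lip_near lf2 e20.
pose q := Num.min (Num.min r1 r2) (Num.min d1 d2).
have q0 : 0 < q by rewrite !lt_min r10 r20 d10.
have qr1 : q <= r1 by rewrite !ge_min lexx.
have qr2 : q <= r2 by rewrite !ge_min lexx orbT.
have qd1 : q <= d1 by rewrite !ge_min lexx !orbT.
have qd2 : q <= d2 by rewrite !ge_min lexx !orbT.
pose D := [set p : V * R | `|p.1 - z| < q /\ `|p.2 - s0| < q].
have Dz : D (z, s0) by split; rewrite /= subrr normr0.
have DT1 : D `<=` tube z r1 by move=> p [h _]; exact: lt_le_trans qr1.
have DT2 : D `<=` tube z r2 by move=> p [h _]; exact: lt_le_trans qr2.
have lo1 p : D p -> sgn e * B1 / 2 <= sgn e * f1 p.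
  move=> Dp; have [h1 h2] := Dp.
  have h := near1 p (z, s0) (DT1 _ Dp) (DT1 _ Dz)
    (lt_le_trans (pair_norm_lt (q:=(z, s0)) h1 h2) qd1).
  move: h; rewrite f1z ltr_norml; move: (f1 p) => u.
  by case: (e); rewrite /sgn /= ?mul1r ?mulN1r => /andP[k1 k2]; clear - k1 k2; lra.
have lo2 p : D p -> sgn e * B2 / 2 <= sgn e * f2 p.
  move=> Dp; have [h1 h2] := Dp.
  have h := near2 p (z, s0) (DT2 _ Dp) (DT2 _ Dz)
    (lt_le_trans (pair_norm_lt (q:=(z, s0)) h1 h2) qd2).
  move: h; rewrite f2z ltr_norml; move: (f2 p) => u.
  by case: (e); rewrite /sgn /= ?mul1r ?mulN1r => /andP[k1 k2]; clear - k1 k2; lra.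
have sgnn (u : R) : 0 < sgn e * u -> sgn e * u = `|u|.
  case: (e); rewrite /sgn /= ?mul1r ?mulN1r => h; first by rewrite gtr0_norm.
  by rewrite ltr0_norm// -oppr_gt0.
pose den p := f1 p + f2 p.
pose cc := sgn e * B1 / 2 + sgn e * B2 / 2.
have cc0 : 0 < cc by rewrite addr_gt0.
have denlow p : D p -> cc <= sgn e * den p.
  by move=> Dp; rewrite mulrDr lerD ?lo1 ?lo2.
have denn p : D p -> cc <= `|den p|.
  by move=> Dp; rewrite -sgnn ?denlow// (lt_le_trans cc0 (denlow _ Dp)).
have den0 p : D p -> den p != 0.
  by move=> Dp; rewrite -normr_gt0 (lt_le_trans cc0 (denn _ Dp)).
pose m p := f2 p * (den p)^-1.
have lm : bdd_lip D m.
  apply: bdd_lipM; first by apply: bdd_lipS lf2.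
  apply: (bdd_lipV cc0 denn); apply: bdd_lipD; [by apply: bdd_lipS lf1|by apply: bdd_lipS lf2].
have mI p : D p -> 0 <= m p <= 1.
  move=> Dp; have h1 := lt_le_trans e10 (lo1 _ Dp); have h2 := lt_le_trans e20 (lo2 _ Dp).
  have h3 := lt_le_trans cc0 (denlow _ Dp).
  have mE : m p = (sgn e * f2 p) / (sgn e * den p).
    rewrite /m invfM mulrACA divff ?mul1r//.
    by case: (e); rewrite /sgn /= ?oner_neq0// oppr_eq0 oner_neq0.
  rewrite mE divr_ge0 ?(ltW h2) ?(ltW h3)//= ler_pdivrMr// mul1r /den mulrDr lerDr.
  exact: ltW.
pose F p := m p *: G1 p + (1 - m p) *: G2 p.
have lF : vbdd_lip D F.
  apply: vbdd_lipD; apply: vbdd_lipZ => //.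
  - by move=> i; apply: bdd_lipS (lG1 i).
  - by apply: bdd_lipD; [exact: bdd_lip_cst|exact: bdd_lipN].
  - by move=> i; apply: bdd_lipS (lG2 i).
have tang p : D p -> edot (F p) (grad sd p.1) = 0.
  move=> Dp; rewrite /F edotDl !edotZl -/(f1 p).
  rewrite -[edot (G2 p) (grad sd p.1)]opprK -/(f2 p).
  have := den0 _ Dp; rewrite /m /den; move: (f1 p) (f2 p) => u v uv.
  by field.
have [K K0 HX] := local_flow lF.
have K1 : 0 < K + 1 by rewrite ltr_wpDl// ltW.
(* The three bounds are the life time of the flow and the times during which the curve and the clock
   stay within [q] of [z] and [s0]. *)
pose T1 := Num.min (2 * K)^-1 (Num.min (q / 2 / (K + 1)) (q / 2)).
have T10 : 0 < T1 by rewrite !lt_min !divr_gt0// invr_gt0 mulr_gt0.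
exists m, (q / 2), (T1 / 2); split.
- by rewrite divr_gt0.
- by rewrite divr_gt0.
- by rewrite /m /den f1z f2z.
- move=> eps eps0; have [d d0 Hd] := bdd_lip_near lm eps0.
  exists (Num.min q d); first by rewrite lt_min q0.
  move=> p; rewrite lt_min => /andP[h1 h2]; rewrite lt_min => /andP[h3 h4].
  have Dp : D p by split.
  exact: (Hd p (z, s0) Dp Dz (pair_norm_lt (q:=(z, s0)) h2 h4)).
move=> y t tau Gy yz ts tau0 taut1 taut tT.
have [X [X0 XK dX]] := HX y t.
have XD (s : R) : `|s| < T1 -> D (X s, t - s).
  rewrite !lt_min => /andP[_ /andP[h1 h2]]; split => /=.
    exact: (short_time K0 X0 XK yz).
  rewrite (addrAC t) (le_lt_trans (ler_normB _ _))// [ltRHS]splitr ltrD//.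
have dX' (s : R) : `|s| < T1 -> is_derive s 1 X (F (X s, t - s)).
  by move=> h; apply: dX; [move: h; rewrite lt_min => /andP[]|exact: XD].
have GX (s : R) : `|s| < T1 -> Ga (X s).
  move=> h; apply: (sd_eq0 S) => //; rewrite -(sd_iface S Gy) -X0.
  apply: (@derive0_cst _ (fun s => sd (X s)) T1) => // u hu.
  rewrite -(tang _ (XD _ hu)) edotC; apply: is_derive_grad (dX' _ hu).
  by apply: Hd1; have [h1 _] := XD _ hu; exact: lt_le_trans qr1.
have small s : 0 <= s <= tau -> `|s| < T1.
  move=> /andP[u0 u1]; rewrite ger0_norm// (le_lt_trans (le_trans u1 taut1))//.
  by rewrite ltr_pdivrMr// ltr_pMr// ltr1n.
have FE s : 0 <= s <= tau -> F (X s, t - s) = dyn_iface (P:=P) (X s) (t - s) (a1, a2, m (X s, t - s)).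
  move=> sI; have Gs := GX _ (small _ sI).
  have tsI := time_left sI taut tT.
  have g1 : G1 (X s, t - s) = dyn (X s) (t - s) a1.
    by rewrite GE1//; split=> //; exact: (iface_closure S true).
  have g2 : G2 (X s, t - s) = dyn (X s) (t - s) a2.
    by rewrite GE2//; split=> //; exact: (iface_closure S false).
  by rewrite /F /dyn_iface /= g1 g2.
have dX2 (s : R) : 0 < s < tau -> is_derive s 1 X
    (dyn_iface (P:=P) (X s) (t - s) (a1, a2, m (X s, t - s))).
  move=> /andP[u0 u1]; have sI : 0 <= s <= tau by rewrite !ltW.
  by rewrite -FE//; apply: dX'; exact: small.
have mX s : 0 <= s <= tau -> 0 <= m (X s, t - s) <= 1.
  by move=> sI; apply: mI; apply: XD; exact: small.
have pos s : e -> 0 <= s <= tau -> 0 <= edot (G1 (X s, t - s)) (grad sd (X s)) /\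
    0 <= - edot (G2 (X s, t - s)) (grad sd (X s)).
  move=> ee sI; have Ds := XD _ (small _ sI).
  have := lo1 _ Ds; have := lo2 _ Ds.
  move: e10 e20; rewrite ee /sgn /= !mul1r => q1 q2 q3 q4; split.
    exact: le_trans (ltW q1) q4.
  exact: le_trans (ltW q2) q3.
have {}tang s : 0 <= s <= tau -> edot (F (X s, t - s)) (grad sd (X s)) = 0.
  by move=> sI; exact: tang (XD _ (small _ sI)).
clearbody F m.
have tau0t : 0 <= tau <= t by rewrite tau0.
have la : Linfty_control (P:=P) tau (fun s => (a1, a2, m (X s, t - s))).
  have [Km Km0 [_ Kml]] := lm.
  apply: (@feedback_control _ _ _ _ (Km * (K + 1))); [by rewrite mulr_ge0// ltW| |exact: mX].
  move=> s s' sI s'I.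
  rewrite (le_trans (Kml _ _ (XD _ (small _ sI)) (XD _ (small _ s'I))))//.
  rewrite -mulrA ler_wpM2l// prod_normE ge_max /=.
  apply/andP; split; first by rewrite (le_trans (XK _ _))// ler_wpM2r// lerDl.
  rewrite (_ : t - s - (t - s') = - (s - s')); last by ring.
  by rewrite normrN ler_peMl// lerDr ltW.
have dX3 (s : R) : 0 < s < tau -> is_derive s 1 X
    (drift (X s) (t - s) ((a1, a2, m (X s, t - s)) : ctl)).
  move=> sI; rewrite (drift_iface S); first exact: dX2.
  by apply: GX; apply: small; case/andP: sI => /ltW-> /ltW->.
have rX : e -> forall s : R, 0 < s < tau -> Ga (X s) ->
    A0reg (X s) (t - s) ((a1, a2, m (X s, t - s)) : ctl).
  move=> ee s /andP[u0 u1] _; have sI : 0 <= s <= tau by rewrite !ltW.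
  have Gs := GX _ (small _ sI); have Ds := XD _ (small _ sI).
  have tsI := time_left sI taut tT.
  have [k1 k10 n1E] := normal_grad S true Gs.
  have [k2 k20 n2E] := normal_grad S false Gs.
  have g1 : dyn (X s) (t - s) a1 = G1 (X s, t - s).
    by rewrite GE1//; split=> //; exact: (iface_closure S true).
  have g2 : dyn (X s) (t - s) a2 = G2 (X s, t - s).
    by rewrite GE2//; split=> //; exact: (iface_closure S false).
  have [p1 p2] := pos _ ee sI.
  split; first split.
  + exact: mX.
  + by rewrite -FE// [normal _ _]n1E !edotZr (tang _ sI) !mulr0.
  + rewrite [normal _ _]n1E !edotZr /= g1 /sgn mul1r mulr_ge0 ?(ltW k10)//.
  + rewrite [normal _ _]n2E !edotZr /= g2 /sgn mulN1r mulr_ge0 ?(ltW k20)//.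
have GX' s : 0 <= s <= tau -> Ga (X s) by move=> /small; exact: GX.
clear - S X0 XK dX2 mX GX' tau0t tT K0 la dX3 rX.
exists X; split; [|exact: GX'|exact: mX|exact: dX2].
exact: (@ptraj_intro _ _ _ _ _ S e y t tau X _ K tau0t tT X0 (ltW K0) XK la dX3 rX).
Qed.

End Sliding.

(** * Existence of regular trajectories *)

Section Existence.
Context {R : realType} {N : nat} (P : control_problem R N) (M L : R).
Local Notation V := 'rV[R]_N.
Local Notation T := (horizon P).
Local Notation Ga := (iface P).
Local Notation sd := (signed_dist P).
Local Notation ctl := (control P).
Hypothesis S : standing P M L.

Lemma normal_ctrl : exists2 d, 0 < d & forall i z s r, Ga z -> 0 <= s <= T -> - d <= r <= d ->
  exists al : ctrl (reg P i), edot (dyn z s al) (normal (reg P i) z) = r.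
Proof.
have [_ _ _ [d d0 H]] := st_ctl S; exists d => // -[] z s r Gz sI rI.
  exact: (H z s r Gz sI rI).1.
exact: (H z s r Gz sI rI).2.
Qed.

Lemma edot_normal i z : Ga z -> exists2 k, 0 < k &
  forall v, edot v (normal (reg P i) z) = k * (sgn i * edot v (grad sd z)).
Proof.
move=> Gz; have [k k0 E] := normal_grad S i Gz; exists k => // v.
by rewrite E !edotZr.
Qed.

(** By (C4) both controls can have outward normal speed [d > 0], and sliding with both dynamics
    pointing outwards is regular. *)
Lemma slide_step z s0 : Ga z -> 0 <= s0 <= T -> exists rho tau1 : R, [/\ 0 < rho, 0 < tau1 &
  forall y (t tau : R), Ga y -> `|y - z| < rho -> `|t - s0| < rho ->
   0 <= tau -> tau <= tau1 -> tau <= t -> t <= T ->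
   exists (X : R -> V) (a : R -> ctl), ptraj M true y t tau X a].
Proof.
move=> Gz s0I; have [d d0 Hd] := normal_ctrl.
have dI : - d <= d <= d by rewrite lexx andbT; rewrite (@le_trans _ _ 0)// ?oppr_le0 ltW.
have [a1 h1] := Hd true z s0 d Gz s0I dI.
have [a2 h2] := Hd false z s0 d Gz s0I dI.
have [k1 k10 E1] := edot_normal true Gz.
have [k2 k20 E2] := edot_normal false Gz.
rewrite E1 /sgn mul1r in h1; rewrite E2 /sgn mulN1r in h2.
have p1 : 0 < edot (dyn z s0 a1) (grad sd z) by rewrite -(pmulr_rgt0 _ k10) h1.
have p2 : 0 < - edot (dyn z s0 a2) (grad sd z) by rewrite -(pmulr_rgt0 _ k20) h2.
have q1 : 0 < sgn true * edot (dyn z s0 a1) (grad sd z) by rewrite /sgn mul1r.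
have q2 : 0 < sgn true * - edot (dyn z s0 a2) (grad sd z) by rewrite /sgn mul1r.
have [m [rho [tau1 [rho0 tau10 _ _ H]]]] := slide S Gz s0I erefl erefl q1 q2.
exists rho, tau1; split=> // y t tau h3 h4 h5 h6 h7 h8 h9.
by have [X [pX _ _ _]] := H y t tau h3 h4 h5 h6 h7 h8 h9; exists X; eexists; exact: pX.
Qed.

(** The step length found near each point is made uniform by compactness of the part of the
    interface in a ball, times [[0, T]]. *)
Lemma uniform_slide_step (x : V) (r : R) : exists2 tau1, 0 < tau1 &
  forall y (t tau : R), Ga y -> `|y - x| <= r -> 0 <= tau -> tau <= tau1 -> tau <= t -> t <= T ->
   exists (X : R -> V) (a : R -> ctl), ptraj M true y t tau X a.
Proof.
pose K : set (V * R) := (Ga `&` [set y | `|y - x| <= r]) `*` `[0, T].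
have cK : compact K.
  apply: compact_setX; last exact: segment_compact.
  rewrite setIC; apply: compact_closedI; last exact: (iface_closed S).
  apply: bounded_closed_compact.
    exists (r + `|x|); split; first exact: num_real.
    move=> B rB y /= yr; rewrite -(subrK x y) (le_trans (ler_normD _ _))// (le_trans _ (ltW rB))//.
    by rewrite lerD2r.
  move=> p cp; apply/ler_addgt0Pr => e e0.
  have [y [/= yr]] := cp _ (nbhsx_ballx p e e0); rewrite -ball_normE/= => py.
  by rewrite -(subrKA y) (le_trans (ler_normD _ _))// [leRHS]addrC lerD// ltW.
pose Pr (th : R) (p : V * R) := forall tau, Ga p.1 -> 0 <= tau -> tau <= th -> tau <= p.2 ->
  p.2 <= T -> exists (X : R -> V) (a : R -> ctl), ptraj M true p.1 p.2 tau X a.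
have loc p : K p -> \forall p' \near p & th \near (0 : R)^'+, Pr th p'.
  move=> [[Gp _]]; rewrite /= in_itv/= => pI.
  have [rho [tau1 [rho0 tau10 H]]] := slide_step Gp pI.
  exists ([set q : V * R | `|q.1 - p.1| < rho /\ `|q.2 - p.2| < rho], [set th | th < tau1]) => /=.
    split; last exact: nbhs_right_lt.
    apply/nbhs_ballP; exists rho => // q; rewrite -ball_normE /= prod_normE gt_max => /andP[h1 h2].
    by split; rewrite distrC; [exact: h1|exact: h2].
  move=> [q th] /= [[h1 h2] h3] tau Gq tau0 tauth; apply: H => //.
  by rewrite (le_trans tauth)// ltW.
have /compact_near_coveringP/(_ _ _ _ _ loc) near1 := cK.
have [tau1 [t0 Ht]] := filter_ex (@filterI _ (0:R)^'+ _ _ _ (nbhs_right_gt (0 : R)) near1).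
exists tau1 => // y t tau Gy yr tau0 taut1 taut tT.
apply: (Ht (y, t) _ tau) => //; split=> //=.
by rewrite in_itv/= tT (le_trans tau0).
Qed.

(** One step of length at most [h] consists in running until the interface is met and then sliding
    for the remaining time. Finitely many steps cover [[0, t]]. *)
Lemma reg_ptraj_ex x t : 0 <= t <= T -> exists (X : R -> V) (a : R -> ctl), ptraj M true x t t X a.
Proof.
have M0 := st_M0 S; have T0 := st_T S.
(* A step starts within [M * T] of [x], and the curve may travel another [M * T] before it
   slides. *)
have [th th0 Hs] := uniform_slide_step x (M * T + M * T).
have [al1 _] := ctrl_ne S true; have [al2 _] := ctrl_ne S false.
have [c1 [u1 u10 [_ _ _ R1]]] := run S al1.
have [c2 [u2 u20 [_ _ _ R2]]] := run S al2.
pose h := Num.min th (Num.min u1 u2).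
have h0 : 0 < h by rewrite !lt_min th0 u10.
have hth : h <= th by rewrite ge_min lexx.
have hu1 : h <= u1 by rewrite !ge_min lexx !orbT.
have hu2 : h <= u2 by rewrite !ge_min lexx !orbT.
have step (y : V) (t' tau : R) : `|y - x| <= M * T -> 0 <= tau -> tau <= h -> tau <= t' -> t' <= T ->
    exists (X : R -> V) (a : R -> ctl), ptraj M true y t' tau X a.
  move=> yx tau0 tauh taut tT.
  have fin (sg : R) (X : R -> V) (a : R -> ctl) : 0 <= sg <= tau -> ptraj M true y t' sg X a -> sg = tau \/ Ga (X sg) ->
      exists (X : R -> V) (a : R -> ctl), ptraj M true y t' tau X a.
    move=> /[dup] sI /andP[s0 st] pX [<-|GX]; first by exists X, a.
    have [|||||Y [b pY]] := Hs (X sg) (t' - sg) (tau - sg) GX.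
    - have := ptraj_disp pX; move=> /(_ sg); rewrite s0 lexx => /(_ isT) hd.
      rewrite -(subrKA y) (le_trans (ler_normD _ _))// addrC lerD//.
      rewrite (le_trans hd)// ler_wpM2l// ?(ltW M0)//; lra.
    - lra.
    - lra.
    - lra.
    - lra.
    - by exists (glue sg X Y), (glue sg a b); exact: ptraj_glue.
  have [Dy1|Dy2|Gy] := tricho S y.
  - have [sg [X [_ [sI pX e _ _]]]] := R1 y t' tau Dy1 tau0 (le_trans tauh hu1) taut tT.
    exact: (fin sg X _ sI pX e).
  - have [sg [X [_ [sI pX e _ _]]]] := R2 y t' tau Dy2 tau0 (le_trans tauh hu2) taut tT.
    exact: (fin sg X _ sI pX e).
  - apply: (Hs y t' tau) => //; last exact: le_trans hth.
    by rewrite (le_trans yx)// lerDl mulr_ge0// ltW.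
move=> tI.
(* The induction keeps [y] within the distance that speed [M] covers in the elapsed time, which is
   at most [T - t']. *)
have key n : forall (y : V) (t' : R), `|y - x| <= M * (T - t') -> 0 <= t' <= T -> t' <= n%:R * h ->
    exists (X : R -> V) (a : R -> ctl), ptraj M true y t' t' X a.
  elim: n => [|n IH] y t' yx /andP[t0 tT].
    rewrite mul0r => t0'; have t'0 : t' = 0 by apply/eqP; rewrite eq_le t0 t0'.
    move: yx; rewrite t'0 subr0 => yx; apply: step => //; exact: ltW.
  rewrite -natr1 mulrDl mul1r => tn.
  pose tau := Num.min t' h.
  have tau0 : 0 <= tau by rewrite le_min t0 ltW.
  have taut : tau <= t' by rewrite ge_min lexx.
  have tauh : tau <= h by rewrite ge_min lexx orbT.
  have yx' : `|y - x| <= M * T.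
    by rewrite (le_trans yx)// ler_wpM2l ?(ltW M0)// gerBl.
  have [X [a pX]] := step y t' tau yx' tau0 tauh taut tT.
  have [|||Y [b pY]] := IH (X tau) (t' - tau).
  - have := ptraj_disp pX; move=> /(_ tau); rewrite tau0 lexx => /(_ isT) hd.
    rewrite -(subrKA y) (le_trans (ler_normD _ _))//.
    rewrite (le_trans (lerD hd yx))// -mulrDr ler_wpM2l ?(ltW M0)//; lra.
  - by apply/andP; split; lra.
  - rewrite lerBlDr; have nh : 0 <= n%:R * h by rewrite mulr_ge0// ltW.
    by have [e|e] := leP t' h; [rewrite /tau min_l//; lra|rewrite /tau min_r ?(ltW e)//].
  by exists (glue tau X Y), (glue tau a b); apply: ptraj_glue => //; rewrite tau0.
have [n nt] : exists n : nat, T <= n%:R * h.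
  have := Num.Theory.archi_boundP (ltW (divr_gt0 T0 h0)).
  by move=> /ltW hn; exists (Num.bound (T / h)); rewrite -ler_pdivrMr.
apply: (key n) => //; first by rewrite subrr normr0 mulr_ge0 ?(ltW M0)// subr_ge0; case/andP: tI.
by rewrite (le_trans _ nt)//; case/andP: tI.
Qed.

End Existence.

(** * Semicontinuous envelopes *)

Section Envelopes.
Context {R : realType} {N : nat} (P : control_problem R N).
Local Notation V := 'rV[R]_N.
Local Notation T := (horizon P).
Variable B : R.
Implicit Types (w : V * R -> R) (p q : V * R).

Lemma cylinder_near p : cylinder P p -> \forall q \near p, cylinder P q.
Proof.
move=> /andP[p0 pT]; pose e := Num.min p.2 (T - p.2).
have e0 : 0 < e by rewrite lt_min p0 subr_gt0.
apply/nbhs_ballP; exists e => // q; rewrite -ball_normE /= prod_normE gt_max => /andP[_].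
rewrite lt_min !ltr_norml /= => /andP[/andP[h1 h2] /andP[h3 h4]].
by apply/andP; split; lra.
Qed.

Lemma cylinder_domain p : cylinder P p -> value_domain P p.
Proof. by move=> /andP[/ltW p0 pT]; apply/andP. Qed.

(** Points of the open cylinder are interior to the domain of the value functions, so the
    restriction in the envelope disappears there. *)
Lemma cylinder_within p (A : set (V * R)) : cylinder P p ->
  within (value_domain P) (nbhs p) A <-> nbhs p A.
Proof.
move=> cp; split; last by apply: filterS.
move=> H; have h : nbhs p (fun q => value_domain P q -> A q) by exact: H.
by apply: filterS2 (cylinder_near cp) h => q /cylinder_domain cq; exact.
Qed.

Definition domain_bounded w := forall q, value_domain P q -> `|w q| <= B.

(** The bound keeps the limit superior finite, so [fine] returns it faithfully. *)
Lemma usc_envE w p : domain_bounded w -> cylinder P p ->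
  (usc_env P w p)%:E = limf_esup (fun q => (w q)%:E) (within (value_domain P) (nbhs p)) /\
  `|usc_env P w p| <= B.
Proof.
move=> wB cp; pose l := limf_esup (fun q => (w q)%:E) (within (value_domain P) (nbhs p)).
have lB : (l <= B%:E)%E.
  apply: ge_ereal_inf; exists (ereal_sup ((fun q => (w q)%:E) @` value_domain P)); last first.
    by apply: ge_ereal_sup => _ [q /wB h <-]; rewrite lee_fin (le_trans (ler_norm _)).
  by exists (value_domain P) => //; exact: withinT.
have Bl : ((- B)%:E <= l)%E.
  apply: le_ereal_inf_tmp => _ [A /(cylinder_within _ cp) nA <-].
  have Ap : A p by exact: nbhs_singleton.
  apply: (@le_trans _ _ (w p)%:E); last by apply: ereal_sup_ubound; exists p.
  by rewrite lee_fin; have := wB _ (cylinder_domain cp); rewrite ler_norml => /andP[].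
have lf : l \is a fin_num by rewrite fin_numElt (lt_le_trans _ Bl) ?ltNyr// (le_lt_trans lB) ?ltry.
rewrite /usc_env -/l fineK//; split=> //.
by rewrite ler_norml -!lee_fin fineK// Bl lB.
Qed.

Lemma usc_env_near w p c : domain_bounded w -> cylinder P p -> usc_env P w p < c ->
  \forall q \near p, w q < c /\ usc_env P w q < c.
Proof.
move=> wB cp; rewrite -lte_fin (usc_envE wB cp).1 => /ereal_inf_lt[_ [A /(cylinder_within _ cp) nA <-] Ac].
have := cylinder_near cp; move: nA => /nbhs_interior; apply: filterS2 => q {}nA cq.
have Aq := nbhs_singleton nA; split; rewrite -lte_fin; apply: le_lt_trans Ac.
  by apply: ereal_sup_ubound; exists q.
rewrite (usc_envE wB cq).1; apply: ereal_inf_lbound; exists A => //.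
exact/(cylinder_within _ cq).
Qed.

Lemma usc_env_freq w p c (A : set (V * R)) : domain_bounded w -> cylinder P p -> c < usc_env P w p ->
  nbhs p A -> exists q, [/\ A q, cylinder P q & c < w q].
Proof.
move=> wB cp + nA; rewrite -lte_fin (usc_envE wB cp).1 => cl.
have cA : nbhs p (A `&` cylinder P) by apply: filterI => //; exact: cylinder_near.
apply: contrapT => H; move: cl; rewrite ltNge => /negP; apply.
apply: ge_ereal_inf; exists (ereal_sup ((fun q => (w q)%:E) @` (A `&` cylinder P))).
  by exists (A `&` cylinder P) => //; apply/(cylinder_within _ cp).
apply: ge_ereal_sup => _ [q [Aq cq] <-]; rewrite lee_fin leNgt; apply/negP => h.
by apply: H; exists q.
Qed.

(** The neighbourhood filter is not punctured: [p] itself contributes to the limit superior. *)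
Lemma usc_env_ge w p : domain_bounded w -> cylinder P p -> w p <= usc_env P w p.
Proof.
move=> wB cp; rewrite leNgt; apply/negP => /(usc_env_near wB cp)/nbhs_singleton[].
by rewrite ltxx.
Qed.

Lemma usc_env_usc w : domain_bounded w -> usc_on_cylinder P (usc_env P w).
Proof. by move=> wB p cp c /(usc_env_near wB cp); apply: filterS => q []. Qed.

Lemma bounded_cylinder w : (forall p, cylinder P p -> `|w p| <= B) -> [bounded w p | p in cylinder P].
Proof.
move=> wB; exists B; split; first exact: num_real.
by move=> x Bx p cp; exact: le_trans (wB _ cp) (ltW Bx).
Qed.

Lemma usc_env_bounded w : domain_bounded w -> [bounded usc_env P w p | p in cylinder P].
Proof. by move=> wB; apply: bounded_cylinder => p /(usc_envE wB)[]. Qed.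

Lemma lsc_envE w p : lsc_env P w p = - usc_env P (fun q => - w q) p.
Proof. by rewrite /lsc_env /usc_env /limf_einf fineN. Qed.

Lemma domain_boundedN w : domain_bounded w -> domain_bounded (fun q => - w q).
Proof. by move=> wB q /wB; rewrite normrN. Qed.

Lemma lsc_env_lsc w : domain_bounded w -> lsc_on_cylinder P (lsc_env P w).
Proof.
move=> /domain_boundedN wB p cp c; rewrite lsc_envE ltrNr => /(usc_env_usc wB cp).
by apply: filterS => q; rewrite lsc_envE ltrNr.
Qed.

Lemma lsc_env_bounded w : domain_bounded w -> [bounded lsc_env P w p | p in cylinder P].
Proof.
move=> /domain_boundedN wB; apply: bounded_cylinder => p /(usc_envE wB)[_ h].
by rewrite lsc_envE normrN.
Qed.

End Envelopes.

(** * Test functions along trajectories *)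

Section Verification.
Context {R : realType} {N : nat} (P : control_problem R N) (M L : R).
Local Notation V := 'rV[R]_N.
Local Notation T := (horizon P).
Local Notation ctl := (control P).
Hypothesis S : standing P M L.

Lemma expansion_lip (E : set (V * R)) phi p D d : expansion E phi p D d ->
  exists2 dl, 0 < dl & forall q, E q -> `|q.1 - p.1| < dl -> `|q.2 - p.2| < dl ->
    `|phi q - phi p| <= (N%:R * `|D| + `|d| + 1) * (`|q.1 - p.1| + `|q.2 - p.2|).
Proof.
move=> /(_ _ ltr01) /nbhs_ballP[dl /= dl0 H]; exists dl => // q Eq h1 h2.
have {}H := H q; rewrite mul1r in H.
have /H/(_ Eq) h : ball p dl q.
  by rewrite -ball_normE /= prod_normE gt_max /= !(distrC _ q.1, distrC _ q.2) h1.
move: h; have := edot_le D (q.1 - p.1); have := normrM d (q.2 - p.2).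
move: (edot _ _) (d * _) (phi q - phi p) => u v w hv hu h.
have -> : w = (w - u - v) + (u + v) by ring.
rewrite (le_trans (ler_normD _ _))// [leRHS]mulrDl mul1r [leRHS]addrC lerD//.
rewrite (le_trans (ler_normD _ _))// mulrDl lerD//.
  by rewrite (le_trans hu)// ler_wpM2l ?mulr_ge0// lerDl.
by rewrite hv ler_wpM2l// lerDr.
Qed.

(** For tangential tests [phi] is controlled only on [E], so its variation along the curve cannot be
    estimated off [E]. The Lipschitz bound of [s |-> phi (X s, t - s)] comes instead from its
    derivative, which exists at every interior time because the curve solves its equation
    everywhere. *)
Lemma verification (E : set (V * R)) phi (D : V * R -> V) (d : V * R -> R)
    r y (t tau : R) (X : R -> V) (a : R -> ctl) (c K : R) :
  0 <= tau <= t -> t <= T -> ptraj M r y t tau X a -> 0 <= K ->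
  (forall s : R, 0 <= s <= tau -> [/\ E (X s, t - s),
     expansion E phi (X s, t - s) (D (X s, t - s)) (d (X s, t - s)),
     `|D (X s, t - s)| <= K & `|d (X s, t - s)| <= K]) ->
  (forall s : R, 0 < s < tau -> is_derive s 1 X (drift (X s) (t - s) (a s))) ->
  (forall s : R, 0 < s < tau -> edot (D (X s, t - s)) (drift (X s) (t - s) (a s))
     - d (X s, t - s) + running_cost (X s) (t - s) (a s) <= c) ->
  phi (X tau, t - tau) - phi (y, t) + jcost X a t tau <= c * tau.
Proof.
move=> tI tT pX K0 HE dX Hc; have /andP[tau0 taut] := tI.
have M0 := st_M0 S; have [X0 lX la _ _] := pX.
pose f s := phi (X s, t - s).
have cf : {within `[0, tau], continuous f}.
  apply/subspace_continuousP => s0; rewrite /= in_itv/= => sI.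
  have [Es ex _ _] := HE _ sI; have [dl dl0 H] := expansion_lip ex.
  rewrite /= in H; set C := (_ + 1) in H.
  have C0 : 0 < C by rewrite ltr_wpDl ?addr_ge0 ?mulr_ge0.
  have CM : 0 < C * (M + 1) by rewrite mulr_gt0// addr_gt0.
  have M1 : 0 < M + 1 by rewrite addr_gt0.
  apply/cvgrPdist_le => e e0.
  pose k := Num.min (dl / (M + 1)) (e / (C * (M + 1))).
  have k0 : 0 < k by rewrite lt_min !divr_gt0.
  apply/nbhs_ballP; exists k => // s /=; rewrite /ball/= lt_min => /andP[k1 k2].
  rewrite in_itv/= => s'I; have [Es' _ _ _] := HE _ s'I.
  have e1 : t - s - (t - s0) = s0 - s by ring.
  rewrite ltr_pdivlMr// in k1; rewrite ltr_pdivlMr// in k2.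
  have lXs : `|X s - X s0| <= M * `|s0 - s| by rewrite distrC lX.
  have := H _ Es'; rewrite /= e1 => {}H.
  rewrite distrC (le_trans (H _ _))//.
  - by rewrite (le_lt_trans lXs)// (le_lt_trans _ k1)// mulrC ler_wpM2l// lerDl.
  - by rewrite (le_lt_trans _ k1)// ler_peMr// lerDr ltW.
  - rewrite (le_trans _ (ltW k2))// mulrCA ler_wpM2l ?(ltW C0)//.
    by rewrite mulrDr mulr1 lerD// mulrC.
have df (s : R) : 0 < s < tau -> is_derive s 1 f
    (edot (D (X s, t - s)) (drift (X s) (t - s) (a s)) - d (X s, t - s)).
  move=> sI; have [|_ ex _ _] := HE s; first by case/andP: sI => /ltW-> /ltW->.
  have dth : is_derive s 1 (fun u : R => t - u) (- 1 : R).
    by rewrite -[X in is_derive _ _ _ X]add0r; apply: is_deriveB.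
  have -> : edot (D (X s, t - s)) (drift (X s) (t - s) (a s)) - d (X s, t - s) =
      edot (D (X s, t - s)) (drift (X s) (t - s) (a s)) + d (X s, t - s) * -1 by ring.
  apply: (@is_derive_chain _ _ E phi _ _ X (fun u => t - u) s _ _ ex (dX _ sI) dth); case/andP: sI => u0 u1.
  have n1 : \forall k \near (0 : R), `|k| < s by have := nbhs0_lt u0.
  have n2 : \forall k \near (0 : R), `|k| < tau - s.
    have u2 : 0 < tau - s by rewrite subr_gt0.
    by have := nbhs0_lt u2.
  near=> h; suff hI : 0 <= s + h <= tau by have [] := HE _ hI.
  have h1 : `|h| < s by near: h.
  have h2 : `|h| < tau - s by near: h.
  by move: h1 h2; rewrite !ltr_norml => /andP[? ?] /andP[? ?]; apply/andP; split; lra.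
pose C := N%:R * K * M + K.
have C0 : 0 <= C by rewrite addr_ge0// !mulr_ge0// ltW.
have dC s : 0 < s < tau ->
    `|edot (D (X s, t - s)) (drift (X s) (t - s) (a s)) - d (X s, t - s)| <= C.
  move=> /andP[u0 u1]; have [|_ _ D1 d1] := HE s; first by rewrite !ltW.
  rewrite (le_trans (ler_normB _ _))// lerD// (le_trans (edot_le _ _))//.
  rewrite ler_pM ?mulr_ge0 ?ler_wpM2l// (drift_le S)//; first by apply/andP; split; lra.
  by apply: la.1; rewrite in_itv/= !ltW.
have fK s s' : 0 <= s -> s <= s' -> s' <= tau -> `|f s' - f s| <= C * `|s' - s|.
  move=> h1 h2 h3; rewrite [X in C * X]ger0_norm ?subr_ge0//.
  apply: (increment_norm_le h2 _ (df:=fun s => edot (D (X s, t - s)) (drift (X s) (t - s) (a s)) - d (X s, t - s))).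
    apply: continuous_subspaceW cf => u /=; rewrite !in_itv/= => /andP[u0 u1].
    by rewrite (le_trans h1)//= (le_trans u1).
  move=> u; rewrite in_itv/= => /andP[u0 u1].
  have uI : 0 < u < tau by rewrite (le_lt_trans h1)//= (lt_le_trans u1).
  by split; [exact: df|exact: dC].
have := @rate_le _ f (fun s => running_cost (X s) (t - s) (a s)) tau c C M tau0 C0 (ltW M0).
rewrite /f X0 subr0; apply.
- move=> s s' /andP[s0 st] /andP[s'0 s't]; case: (leP s s') => [h|/ltW h]; last exact: fK.
  by rewrite distrC (distrC s); exact: fK.
- exact: (measurable_running_cost S tI tT pX).
- by move=> s sI; exact: (running_cost_ptraj_le S tI tT pX).
- apply: aeW => s; rewrite in_itv/= => sI; eexists; first exact: df.
  exact: Hc.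
Unshelve. all: by end_near. Qed.

End Verification.

(** * Continuity of rates near a contact point *)

Section Rates.
Context {R : realType} {N : nat} (P : control_problem R N) (M L : R).
Local Notation V := 'rV[R]_N.
Hypothesis S : standing P M L.

Lemma box_near (p : V * R) (Q : set (V * R)) : (\forall q \near p, Q q) <->
  exists2 e, 0 < e & forall q : V * R, `|q.1 - p.1| < e -> `|q.2 - p.2| < e -> Q q.
Proof.
split=> [/nbhs_ballP[e /= e0 H]|[e e0 H]].
  exists e => // q h1 h2; apply: H.
  by rewrite -ball_normE /= prod_normE gt_max /= !(distrC _ q.1, distrC _ q.2) h1.
apply/nbhs_ballP; exists e => // q; rewrite -ball_normE /= prod_normE gt_max /=.
by move=> /andP[h1 h2]; apply: H; rewrite distrC.
Qed.

Lemma nearS (p : V * R) (A B : set (V * R)) : nbhs p A -> A `<=` B -> nbhs p B.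
Proof. by move=> nA AB; exact: filterS nA. Qed.

Lemma nearS2 (p : V * R) (A B C : set (V * R)) : nbhs p A -> nbhs p B -> A `&` B `<=` C ->
  nbhs p C.
Proof. by move=> nA nB; apply: nearS; exact: filterI. Qed.

(** Continuity at [p] relative to [A]; no topology is put on [A], so sets can be changed freely. *)
Definition ncont (W : normedModType R) (A : set (V * R)) (p : V * R) (f : V * R -> W) :=
  forall e, 0 < e -> \forall q \near p, A q -> `|f q - f p| <= e.

Lemma ncont_cst (W : normedModType R) A p (w : W) : ncont A p (fun=> w).
Proof. by move=> e e0; apply/box_near; exists 1 => // q _ _ _; rewrite subrr normr0 ltW. Qed.

Lemma ncontS (W : normedModType R) (A B : set (V * R)) p (f : V * R -> W) : A `<=` B ->
  ncont B p f -> ncont A p f.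
Proof. by move=> AB H e e0; apply: (nearS (H _ e0)) => q h /AB; exact: h. Qed.

Lemma ncontD (W : normedModType R) A p (f g : V * R -> W) : ncont A p f -> ncont A p g ->
  ncont A p (fun q => f q + g q).
Proof.
move=> hf hg e e0; have e2 : 0 < e / 2 by rewrite divr_gt0.
apply: (nearS2 (hf _ e2) (hg _ e2)) => q [h1 h2] Aq.
have -> : f q + g q - (f p + g p) = (f q - f p) + (g q - g p).
  by rewrite opprD addrACA.
by rewrite (le_trans (ler_normD _ _))// [leRHS]splitr lerD ?h1 ?h2.
Qed.

Lemma ncontN (W : normedModType R) A p (f : V * R -> W) : ncont A p f ->
  ncont A p (fun q => - f q).
Proof. by move=> hf e e0; apply: (nearS (hf _ e0)) => q h /h; rewrite -opprD normrN. Qed.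

Lemma ncont_bilinear (U W Z : normedModType R) A p (op : U -> W -> Z) (C : R) f g : 0 <= C ->
  (forall u v w, op (u - v) w = op u w - op v w) ->
  (forall u v w, op u (v - w) = op u v - op u w) ->
  (forall u w, `|op u w| <= C * `|u| * `|w|) ->
  ncont A p f -> ncont A p g -> ncont A p (fun q => op (f q) (g q)).
Proof.
move=> C0 opl opr opn hf hg e e0.
pose B1 := C * (`|g p| + 1) + 1; have B10 : 0 < B1 by rewrite ltr_wpDl// mulr_ge0// addr_ge0.
pose B2 := C * `|f p| + 1; have B20 : 0 < B2 by rewrite ltr_wpDl// mulr_ge0.
have e1 : 0 < e / 2 / B1 by rewrite !divr_gt0.
have e2 : 0 < e / 2 / B2 by rewrite !divr_gt0.
apply: (nearS2 (nearS2 (hf _ e1) (hg _ e2) (@subset_refl _ _)) (hg _ ltr01)) => q [[h1 h2] h3] Aq.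
have {}h1 := h1 Aq; have {}h2 := h2 Aq; have {}h3 := h3 Aq.
have -> : op (f q) (g q) - op (f p) (g p) =
    op (f q - f p) (g q) + op (f p) (g q - g p) by rewrite opl opr subrKA.
rewrite (le_trans (ler_normD _ _))// [leRHS]splitr lerD//.
  rewrite (le_trans (opn _ _))// -(divfK (lt0r_neq0 B10) (e / 2)) mulrAC [leRHS]mulrC.
  rewrite ler_pM ?mulr_ge0// /B1 ler_wpDr// ler_wpM2l//.
  by rewrite -(subrK (g p) (g q)) (le_trans (ler_normD _ _))// addrC lerD2l.
rewrite (le_trans (opn _ _))// -(divfK (lt0r_neq0 B20) (e / 2)) [leRHS]mulrC.
by rewrite ler_pM ?mulr_ge0// /B2 lerDl.
Qed.

Lemma ncontZ (W : normedModType R) A p (f : V * R -> R) (g : V * R -> W) :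
  ncont A p f -> ncont A p g -> ncont A p (fun q => f q *: g q).
Proof.
apply: (@ncont_bilinear _ _ _ A p (fun (k : R) (w : W) => k *: w) 1) => //.
- by move=> u v w; rewrite scalerBl.
- by move=> u v w; rewrite scalerBr.
- by move=> u w; rewrite normrZ mul1r.
Qed.

Lemma ncont_edot A p (f g : V * R -> V) :
  ncont A p f -> ncont A p g -> ncont A p (fun q => edot (f q) (g q)).
Proof.
apply: (@ncont_bilinear _ _ R^o A p (fun u v : V => edot u v : R^o) N%:R) => //.
- by move=> u v w; rewrite edotBl.
- by move=> u v w; rewrite edotBr.
- by move=> u w; exact: edot_le.
Qed.

Lemma ncont_dyn i (al : ctrl (reg P i)) p : stset P i p ->
  ncont (stset P i) p (fun q => dyn q.1 q.2 al).
Proof.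
move=> sp e e0; have L0 := st_L0 S; have e1 : 0 < e / (2 * L) by rewrite divr_gt0// mulr_gt0.
apply/box_near; exists (e / (2 * L)) => // q h1 h2 sq.
rewrite (le_trans (st_lip S al sq sp))//.
rewrite (@le_trans _ _ (L * (e / (2 * L) + e / (2 * L))))//.
  by rewrite ler_wpM2l ?(ltW L0)// lerD// ltW.
by have -> : L * (e / (2 * L) + e / (2 * L)) = e by field; rewrite gt_eqF.
Qed.

Lemma ncont_cost i (al : ctrl (reg P i)) p : stset P i p ->
  ncont (stset P i) p (fun q => cost q.1 q.2 al : R^o).
Proof.
move=> sp e e0; have [dl dl0 H] := cost_uniform S i e0.
apply/box_near; exists dl => // q h1 h2 sq.
by apply/ltW/H => //; rewrite mdistxx.
Qed.

Section Test.
Variables (phi : V * R -> R) (D : V * R -> V) (d : V * R -> R).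

(** Common form of the two notions of test function: [E] is the whole space in the viscosity
    inequalities and the interface cylinder in the tangential ones. *)
Definition test (E : set (V * R)) (p : V * R) : Prop :=
  [/\ \forall q \near p, E q -> expansion E phi q (D q) (d q),
      ncont E p D & ncont E p (d : V * R -> R^o)].

(** The quantitative content of [test] on a box, as [verification] consumes it. *)
Definition tested (E : set (V * R)) (p : V * R) (rad K : R) : Prop :=
  [/\ 0 < rad, 0 <= K & forall q : V * R, E q -> `|q.1 - p.1| < rad -> `|q.2 - p.2| < rad ->
    [/\ expansion E phi q (D q) (d q), `|D q| <= K & `|d q| <= K]].

Lemma test_tested E p : test E p -> exists rad K, tested E p rad K.
Proof.
move=> [h1 h2 h3].
have h := nearS2 (nearS2 h1 (h2 _ ltr01) (@subset_refl _ _)) (h3 _ ltr01) (@subset_refl _ _).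
have [e e0 H] := (box_near _ _).1 h.
exists e, (`|D p| + `|d p| + 1); split=> // q Eq q1 q2.
have [[k1 k2] k3] := H q q1 q2; split; first exact: k1.
- have := ler_normD (D q - D p) (D p); rewrite subrK => h'.
  by rewrite (le_trans h')// addrC -[leRHS]addrA lerD2l ler_wpDl// k2.
- have := ler_normD (d q - d p) (d p); rewrite subrK => h'.
  by rewrite (le_trans h')// addrC -[leRHS]addrA ler_wpDl// lerD2l k3.
Qed.

Lemma testedW E p rad rad' K : 0 < rad' -> rad' <= rad -> tested E p rad K -> tested E p rad' K.
Proof.
move=> r0 rr [_ K0 H]; split=> // q Eq h1 h2; apply: H => //; exact: lt_le_trans rr.
Qed.

Definition rates (A : set (V * R)) (p : V * R) (rad c : R) (b : V * R -> V) (l : V * R -> R) :=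
  forall q : V * R, A q -> `|q.1 - p.1| < rad -> `|q.2 - p.2| < rad ->
    edot (D q) (b q) - d q + l q <= c.

Lemma rates_near E A p b (l : V * R -> R) c : test E p -> A `<=` E -> ncont A p b ->
  ncont A p (l : V * R -> R^o) -> edot (D p) (b p) - d p + l p < c ->
  exists2 rad, 0 < rad & rates A p rad c b l.
Proof.
move=> [_ hD hd] AE hb hl Hc.
have h : ncont A p (fun q => edot (D q) (b q) - d q + l q : R^o).
  apply: (@ncontD R^o) => //; apply: (@ncontD R^o).
    by apply: ncont_edot => //; exact: ncontS hD.
  by apply: (@ncontN R^o); exact: ncontS hd.
have e0 : 0 < c - (edot (D p) (b p) - d p + l p) by rewrite subr_gt0.
have [rad rad0 H] := (box_near _ _).1 (h _ e0); exists rad => // q Aq q1 q2.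
have := H q q1 q2 Aq; move: (_ - _ + _) (_ - _ + _) => u v.
by rewrite ler_norml => /andP[_]; rewrite lerBlDr subrK.
Qed.

End Test.

End Rates.

(** * Strategies that keep the rate below a constant *)

Section Good.
Context {R : realType} {N : nat} (P : control_problem R N) (M L : R).
Local Notation V := 'rV[R]_N.
Local Notation T := (horizon P).
Local Notation Ga := (iface P).
Local Notation sd := (signed_dist P).
Local Notation ctl := (control P).
Hypothesis S : standing P M L.

Lemma short_ptraj r y (t tau : R) (X : R -> V) (a : R -> ctl) (p : V * R) (rad : R) :
  ptraj M r y t tau X a -> `|y - p.1| < rad / 2 -> `|t - p.2| < rad / 2 ->
  tau <= rad / 2 / (M + 1) ->
  forall s, 0 <= s <= tau -> `|X s - p.1| < rad /\ `|t - s - p.2| < rad.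
Proof.
move=> pX yp tp taur s sI; have /andP[s0 st] := sI; have M0 := st_M0 S.
have M1 : 0 < M + 1 by rewrite addr_gt0.
have : s * (M + 1) <= rad / 2 by rewrite -ler_pdivlMr// (le_trans st).
rewrite mulrDr mulr1 => h; have sM : 0 <= M * s by rewrite mulr_ge0// ltW.
have hX := ptraj_disp pX sI; rewrite mulrC in h.
split; last by move: tp; rewrite !ltr_norml => /andP[? ?]; apply/andP; split; lra.
have := ler_normD (X s - y) (y - p.1); rewrite subrKA; lra.
Qed.

Variables (phi : V * R -> R) (D : V * R -> V) (d : V * R -> R).

Definition gain (y : V) (t tau : R) (X : R -> V) (a : R -> ctl) (c : R) : Prop :=
  phi (X tau, t - tau) - phi (y, t) + jcost X a t tau <= c * tau.

Lemma short_gain (E : set (V * R)) (A : set (V * R)) p rad K c b l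
    r y (t tau : R) (X : R -> V) (a : R -> ctl) :
  tested phi D d E p rad K -> rates D d A p rad c b l ->
  0 <= tau <= t -> t <= T -> ptraj M r y t tau X a ->
  `|y - p.1| < rad / 2 -> `|t - p.2| < rad / 2 -> tau <= rad / 2 / (M + 1) ->
  (forall s : R, 0 <= s <= tau -> E (X s, t - s)) ->
  (forall s : R, 0 < s < tau -> A (X s, t - s)) ->
  (forall s : R, 0 < s < tau -> drift (X s) (t - s) (a s) = b (X s, t - s) /\
     running_cost (X s) (t - s) (a s) = l (X s, t - s)) ->
  (forall s : R, 0 < s < tau -> is_derive s 1 X (drift (X s) (t - s) (a s))) ->
  gain y t tau X a c.
Proof.
move=> [_ K0 HE] HA tI tT pX yp tp taur EX AX bl dX.
have near1 := short_ptraj pX yp tp taur.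
apply: (@verification _ _ _ _ _ S E phi D d r y t tau X a c K) => //.
- move=> s sI; have [h1 h2] := near1 s sI; have Es := EX s sI.
  by have [k1 k2 k3] := HE _ Es h1 h2.
- move=> s sI; have [e1 e2] := bl s sI.
  have [h1 h2] : `|X s - p.1| < rad /\ `|t - s - p.2| < rad.
    by apply: near1; case/andP: sI => /ltW-> /ltW->.
  rewrite e1 e2; exact: (HA _ (AX s sI) h1 h2).
Qed.

(** Durations and radius are uniform in the starting point. [Y] restricts the start and [Z] the end:
    both are [Ga] for tangential tests, where maximality is known only along the interface. *)
Definition good (r : bool) (Y Z : set V) (p : V * R) (c : R) : Prop :=
  exists rho tau1 : R, [/\ 0 < rho, 0 < tau1 & forall (y : V) (t tau : R), Y y ->
    `|y - p.1| < rho -> `|t - p.2| < rho -> 0 <= tau -> tau <= tau1 -> tau <= t -> t <= T ->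
    exists (X : R -> V) (a : R -> ctl),
      [/\ ptraj M r y t tau X a, Z (X tau) & gain y t tau X a c]].

(** The motion may stop early, but then it stops on the interface, from where another strategy takes
    over. *)
Definition run_good (r i : bool) (p : V * R) (c : R) : Prop :=
  exists rho tau1 : R, [/\ 0 < rho, 0 < tau1 & forall (y : V) (t tau : R), dom (reg P i) y ->
    `|y - p.1| < rho -> `|t - p.2| < rho -> 0 <= tau -> tau <= tau1 -> tau <= t -> t <= T ->
    exists (sg : R) (X : R -> V) (a : R -> ctl),
      [/\ 0 <= sg <= tau, ptraj M r y t sg X a, sg = tau \/ Ga (X sg) & gain y t sg X a c]].

Lemma ptraj_le (r e : bool) y (t tau : R) (X : R -> V) (a : R -> ctl) : (r -> e) ->
  ptraj M e y t tau X a -> ptraj M r y t tau X a.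
Proof.
case: r => [/(_ isT) -> //|_ pX]; exact: ptrajW pX.
Qed.

Lemma run_goodP (r i : bool) (al : ctrl (reg P i)) p c :
  test phi D d setT p -> stset P i p ->
  edot (D p) (dyn p.1 p.2 al) - d p + cost p.1 p.2 al < c -> run_good r i p c.
Proof.
move=> tp sp Hc; have [rad1 [K te]] := test_tested tp.
have [rad2 rad20 ra] := rates_near tp (@subsetT _ _) (ncont_dyn S al sp) (ncont_cost S al sp) Hc.
have [ca [tau1 tau10 [cc dc rc Hrun]]] := run S al.
pose rad := Num.min rad1 rad2; have [rad10 _ _] := te.
have rad0 : 0 < rad by rewrite lt_min rad10.
have le1 : rad <= rad1 by rewrite ge_min lexx.
have le2 : rad <= rad2 by rewrite ge_min lexx orbT.
have te' := testedW rad0 le1 te.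
have M1 : 0 < M + 1 by rewrite addr_gt0// (st_M0 S).
exists (rad / 2), (Num.min tau1 (rad / 2 / (M + 1))); split.
- by rewrite divr_gt0.
- by rewrite lt_min tau10 !divr_gt0.
move=> y t tau Dy yp tp' tau0; rewrite le_min => /andP[taut1 taur] taut tT.
have [sg [X [_ [sI pX e Xd dX]]]] := Hrun y t tau Dy tau0 taut1 taut tT.
have /andP[s0 st] := sI.
exists sg, X, (cst ca); split=> //; first by case: (r) => //; exact: ptrajW pX.
apply: (short_gain (A:=stset P i) te' _ _ _ pX yp tp') => //.
- move=> q Aq q1 q2; apply: (ra q Aq); [exact: lt_le_trans le2|exact: lt_le_trans le2].
- by rewrite s0 (le_trans st).
- exact: le_trans taur.
- move=> s /andP[u0 u1]; split; last first.
    by apply: (time_left _ (le_trans st taut) tT); rewrite !ltW.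
  by apply: subset_closure; apply: Xd; rewrite (ltW u0).
- move=> s /andP[u0 u1]; have Xs : dom (reg P i) (X s) by apply: Xd; rewrite (ltW u0).
  by rewrite dc ?rc.
- move=> s sI'; rewrite dc; first exact: dX.
  by apply: Xd; case/andP: sI' => /ltW -> ->.
Qed.

Lemma run_good_vacuous (r i : bool) (p : V * R) c : ~ closure (dom (reg P i)) p.1 -> run_good r i p c.
Proof.
move=> np; have := notin_closure S np => np'.
have : nbhs p.1 (dom (reg P (~~ i))).
  by apply: open_nbhs_nbhs; split=> //; exact: (@dom_open _ _ _ _ _ S (~~ i)).
move=> /nbhs_ballP[e /= e0 H]; exists e, 1; split=> // y t tau Dy yp; exfalso.
have := H y; rewrite -ball_normE /= distrC => /(_ yp) Dy'.
by move: Dy Dy'; case: (i) => h1 h2; [exact: (dom_disj S h1 h2)|exact: (dom_disj S h2 h1)].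
Qed.

Lemma iface_good_vacuous (r : bool) (Z : set V) (p : V * R) c : ~ Ga p.1 -> good r Ga Z p c.
Proof.
move=> np; have : nbhs p.1 (~` Ga).
  by apply: open_nbhs_nbhs; split=> //; apply: closed_openC; exact: (iface_closed S).
move=> /nbhs_ballP[e /= e0 H]; exists e, 1; split=> // y t tau Gy yp; exfalso.
by have := H y; rewrite -ball_normE /= distrC => /(_ yp); exact.
Qed.

Lemma enter_good (r i : bool) (al : ctrl (reg P i)) (p : V * R) c :
  test phi D d setT p -> Ga p.1 -> 0 <= p.2 <= T ->
  edot (D p) (dyn p.1 p.2 al) - d p + cost p.1 p.2 al < c ->
  sgn i * edot (dyn p.1 p.2 al) (grad sd p.1) < 0 -> good r Ga setT p c.
Proof.
move=> tp Gp pI Hc neg; have sp : stset P i p by split=> //; exact: (iface_closure S i).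
have [rad1 [K te]] := test_tested tp.
have [rad2 rad20 ra] := rates_near tp (@subsetT _ _) (ncont_dyn S al sp) (ncont_cost S al sp) Hc.
have [ca [rho [tau1 [[rho0 tau10 cc] dc rc He]]]] := enter S Gp pI neg.
pose rad := Num.min rad1 rad2; have [rad10 _ _] := te.
have rad0 : 0 < rad by rewrite lt_min rad10.
have le1 : rad <= rad1 by rewrite ge_min lexx.
have le2 : rad <= rad2 by rewrite ge_min lexx orbT.
have te' := testedW rad0 le1 te.
have M1 : 0 < M + 1 by rewrite addr_gt0// (st_M0 S).
exists (Num.min rho (rad / 2)), (Num.min tau1 (rad / 2 / (M + 1))); split.
- by rewrite lt_min rho0 divr_gt0.
- by rewrite lt_min tau10 !divr_gt0.
move=> y t tau Gy; rewrite !lt_min => /andP[y1 y2] /andP[t1 t2] tau0.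
rewrite le_min => /andP[taut1 taur] taut tT.
have [X [pX Xd dX]] := He y t tau Gy y1 t1 tau0 taut1 taut tT.
exists X, (cst ca); split=> //; first by case: (r) => //; exact: ptrajW pX.
apply: (short_gain (A:=stset P i) te' _ _ _ pX y2 t2) => //.
- move=> q Aq q1 q2; apply: (ra q Aq); [exact: lt_le_trans le2|exact: lt_le_trans le2].
- by rewrite tau0.
- move=> s /andP[u0 u1]; split; last by apply: (time_left _ taut tT); rewrite !ltW.
  by apply: subset_closure; apply: Xd; rewrite u0 ltW.
- move=> s /andP[u0 u1]; have Xs : dom (reg P i) (X s) by apply: Xd; rewrite u0 ltW.
  by rewrite dc ?rc.
- move=> s sI'; rewrite dc; first exact: dX.
  by apply: Xd; case/andP: sI' => -> /ltW ->.
Qed.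

Lemma slide_good (r e : bool) (E : set (V * R)) (a1 : ctrl (reg1 P)) (a2 : ctrl (reg2 P))
    (p : V * R) (B1 B2 c : R) : (r -> e) ->
  test phi D d E p -> Ga p.1 -> 0 <= p.2 <= T -> iface_cylinder P `<=` E ->
  B1 = edot (dyn p.1 p.2 a1) (grad sd p.1) -> B2 = - edot (dyn p.1 p.2 a2) (grad sd p.1) ->
  0 < sgn e * B1 -> 0 < sgn e * B2 ->
  edot (D p) (dyn_iface (P:=P) p.1 p.2 (a1, a2, B2 / (B1 + B2))) - d p
    + cost_iface (P:=P) p.1 p.2 (a1, a2, B2 / (B1 + B2)) < c -> good r Ga Ga p c.
Proof.
move=> re tp Gp pI GE B1E B2E B10 B20 Hc.
have [m [rho [tau1 [rho0 tau10 mp cm Hs]]]] := slide S Gp pI B1E B2E B10 B20.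
have sp1 : stset P true p by split=> //; exact: (iface_closure S true).
have sp2 : stset P false p by split=> //; exact: (iface_closure S false).
have G1 : iface_cylinder P `<=` stset P true.
  by move=> q [Gq qI]; split=> //; exact: (iface_closure S true).
have G2 : iface_cylinder P `<=` stset P false.
  by move=> q [Gq qI]; split=> //; exact: (iface_closure S false).
have p_eq : (p.1, p.2) = p by case: (p).
rewrite p_eq in mp cm.
have nm : ncont (iface_cylinder P) p (m : V * R -> R^o).
  move=> eps eps0; have [dl dl0 H] := cm _ eps0.
  by apply/box_near; exists dl => // q h1 h2 _; exact/ltW/H.
have nm1 : ncont (iface_cylinder P) p (fun q => 1 - m q : R^o).
  by apply: (@ncontD R N R^o); [exact: ncont_cst|exact: (@ncontN R N R^o)].
have d1 := ncontS G1 (ncont_dyn S (i:=true) a1 sp1).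
have d2 := ncontS G2 (ncont_dyn S (i:=false) a2 sp2).
have l1 := ncontS G1 (ncont_cost S (i:=true) a1 sp1).
have l2 := ncontS G2 (ncont_cost S (i:=false) a2 sp2).
have nb := ncontD (ncontZ nm d1) (ncontZ nm1 d2).
have nl := ncontD (ncontZ nm l1) (ncontZ nm1 l2).
rewrite -mp in Hc.
have [rad2 rad20 ra] := rates_near tp GE nb nl Hc.
have [rad1 [K te]] := test_tested tp.
pose rad := Num.min rad1 rad2; have [rad10 _ _] := te.
have rad0 : 0 < rad by rewrite lt_min rad10.
have le1 : rad <= rad1 by rewrite ge_min lexx.
have le2 : rad <= rad2 by rewrite ge_min lexx orbT.
have te' := testedW rad0 le1 te.
have M1 : 0 < M + 1 by rewrite addr_gt0// (st_M0 S).
exists (Num.min rho (rad / 2)), (Num.min tau1 (rad / 2 / (M + 1))); split.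
- by rewrite lt_min rho0 divr_gt0.
- by rewrite lt_min tau10 !divr_gt0.
move=> y t tau Gy; rewrite !lt_min => /andP[y1 y2] /andP[t1 t2] tau0.
rewrite le_min => /andP[taut1 taur] taut tT.
have [X [pX XG mX dX]] := Hs y t tau Gy y1 t1 tau0 taut1 taut tT.
exists X; eexists; split; [exact: (ptraj_le re pX)|by apply: XG; rewrite tau0 lexx|].
have XGI s : 0 <= s <= tau -> iface_cylinder P (X s, t - s).
  move=> sI; split; first exact: XG.
  exact: time_left sI taut tT.
apply: (short_gain (A:=iface_cylinder P) te' _ _ _ pX y2 t2) => //.
- move=> q Aq q1 q2; apply: (ra q Aq); [exact: lt_le_trans le2|exact: lt_le_trans le2].
- by rewrite tau0.
- by move=> s sI; apply: GE; exact: XGI.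
- by move=> s /andP[u0 u1]; apply: XGI; rewrite !ltW.
- move=> s /andP[u0 u1]; have Gs : Ga (X s) by apply: XG; rewrite !ltW.
  by rewrite (drift_iface S) // (running_cost_iface S).
- move=> s sI'; rewrite (drift_iface S); first exact: dX.
  by apply: XG; case/andP: sI' => /ltW -> /ltW ->.
Qed.

(** Run until the interface is met, then follow the interface strategy. The gains add up because the
    second piece starts with exactly the time left by the first. *)
Lemma good_glue (r : bool) (p : V * R) c : (forall i, run_good r i p c) -> good r Ga setT p c ->
  good r setT setT p c.
Proof.
move=> Hr [rho [tau1 [rho0 tau10 Hg]]].
have M0 := st_M0 S.
have [rho1 [u1 [rho10 u10 H1]]] := Hr true.
have [rho2 [u2 [rho20 u20 H2]]] := Hr false.
(* Half of [rho] is kept for the motion before arrival, so the second strategy starts within its own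
   radius. *)
pose rh := Num.min (rho / 2) (Num.min rho1 rho2).
pose u := Num.min (Num.min tau1 (rho / 2 / (M + 1))) (Num.min u1 u2).
have M1 : 0 < M + 1 by rewrite addr_gt0.
exists rh, u; split; first by rewrite !lt_min divr_gt0// rho10.
  by rewrite !lt_min tau10 !divr_gt0// u10.
move=> y t tau _; rewrite !lt_min => /andP[y0 /andP[y1 y2]] /andP[t0 /andP[t1 t2]] tau0.
rewrite !le_min => /andP[/andP[ta1 ta2] /andP[ta3 ta4]] taut tT.
have rr : rho / 2 < rho by rewrite ltr_pdivrMr// ltr_pMr// ltr1n.
have fin (sg : R) (X : R -> V) (a : R -> ctl) : 0 <= sg <= tau -> ptraj M r y t sg X a ->
    sg = tau \/ Ga (X sg) -> gain y t sg X a c ->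
    exists (X : R -> V) (a : R -> ctl),
      [/\ ptraj M r y t tau X a, [set: V] (X tau) & gain y t tau X a c].
  move=> sI pX; have /andP[s0 st] := sI; case=> [<-|GX] gX; first by exists X, a.
  have sr : sg <= rho / 2 / (M + 1) by exact: le_trans ta2.
  have [|n1 n2] := short_ptraj pX y0 t0 sr (s:=sg); first by rewrite s0 lexx.
  have q1 : 0 <= tau - sg by rewrite subr_ge0.
  have q2 : tau - sg <= tau1 by rewrite (le_trans _ ta1)// gerBl.
  have q3 : tau - sg <= t - sg by rewrite lerD2r.
  have q4 : t - sg <= T by rewrite (le_trans _ tT)// gerBl.
  have [Y [b [pY _ gY]]] := Hg (X sg) (t - sg) (tau - sg) GX n1 n2 q1 q2 q3 q4.
  exists (glue sg X Y), (glue sg a b); split=> //; first exact: ptraj_glue.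
  rewrite /gain (jcost_glue S sI taut tT pX pY).
  have -> : glue sg X Y tau = Y (tau - sg).
    rewrite /glue; case: ifP => // h; have e : tau = sg by apply/eqP; rewrite eq_le st h.
    by rewrite e subrr; have [-> _ _ _ _] := pY.
  move: gX gY; rewrite /gain.
  have -> : t - sg - (tau - sg) = t - tau by ring.
  move: (phi _) (phi _) (phi _) (jcost _ _ _ _) (jcost _ _ _ _) => v1 v2 v3 v4 v5 g1 g2.
  have -> : c * tau = c * sg + c * (tau - sg) by ring.
  clear - g1 g2; lra.
have [Dy|Dy|Gy] := tricho S y.
- have [sg [X [a [h1 h2 h3 h4]]]] := H1 y t tau Dy y1 t1 tau0 ta3 taut tT.
  exact: (fin sg X a).
- have [sg [X [a [h1 h2 h3 h4]]]] := H2 y t tau Dy y2 t2 tau0 ta4 taut tT.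
  exact: (fin sg X a).
- apply: (Hg y t tau) => //; exact: lt_trans rr.
Qed.

End Good.

(** * Viscosity inequalities *)

Section Core.
Context {R : realType} {N : nat} (P : control_problem R N) (M L : R).
Local Notation V := 'rV[R]_N.
Local Notation T := (horizon P).
Local Notation Ga := (iface P).
Local Notation sd := (signed_dist P).
Local Notation ctl := (control P).
Hypothesis S : standing P M L.

Lemma close_le (s t rad tau : R) : `|t - s| < rad / 2 -> tau <= rad / 2 -> rad <= s -> tau <= t.
Proof. by rewrite ltr_norml => /andP[h1 h2] h3 h4; lra. Qed.

Lemma value_domain_bounded r : domain_bounded P (M * T + M) (value P r).
Proof.
move=> [x t] /andP[/= t0 tT]; apply: (value_bound S (reg_ptraj_ex S)).
by rewrite t0 ltW.
Qed.

(** A start [q] is taken near [p] with value close to the envelope at [p]. Dynamic programming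
    bounds that value by cost plus value at the end point, and maximality at [p] turns the latter
    into a difference of [phi]; the gain [c * tau < 0] then exceeds the errors. [tau] is fixed
    before [q]. *)
Lemma sub_core (phi : V * R -> R) r (Y Z : set V) (p : V * R) c :
  cylinder P p -> c < 0 -> good P M phi r Y Z p c ->
  (\forall q \near p, Z q.1 -> usc_env P (value P r) q - phi q <= usc_env P (value P r) p - phi p) ->
  (forall (A : set (V * R)) c', nbhs p A -> c' < usc_env P (value P r) p ->
     exists q, [/\ A q, cylinder P q, Y q.1 & c' < value P r q]) ->
  (forall e, 0 < e -> \forall q \near p, Y q.1 -> `|phi q - phi p| <= e) -> False.
Proof.
move=> cp c0 [rho [tau1 [rho0 tau10 Hg]]] max_p freq cphi.
have M0 := st_M0 S; have M1 : 0 < M + 1 by rewrite addr_gt0.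
have wB := value_domain_bounded r.
have [e1 e10 H1] := (box_near _ _).1 max_p.
have [e2 e20 H2] := (box_near _ _).1 (cylinder_near cp).
have /andP[p20 p2T] := cp.
pose rad := Num.min (Num.min e1 e2) p.2.
have rad0 : 0 < rad by rewrite !lt_min e10 e20.
have r1 : rad <= e1 by rewrite !ge_min lexx.
have r2 : rad <= e2 by rewrite !ge_min lexx orbT.
have r3 : rad <= p.2 by rewrite !ge_min lexx orbT.
pose tau := Num.min tau1 (rad / 2 / (M + 1)).
have tau0 : 0 < tau by rewrite lt_min tau10 !divr_gt0.
have ta1 : tau <= tau1 by rewrite ge_min lexx.
have ta2 : tau <= rad / 2 / (M + 1) by rewrite ge_min lexx orbT.
have ta3 : tau <= rad / 2.
  by rewrite (le_trans ta2)// ler_pdivrMr// ler_peMr ?divr_ge0 ?(ltW rad0)// lerDr ltW.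
(* The choice of [q] costs [ep] in the value and [ep] in [phi], against a gain of [4 * ep]. *)
pose ep := - (c * tau) / 4.
have ep0 : 0 < ep by rewrite divr_gt0// oppr_gt0 nmulr_rlt0.
have bx : \forall q \near p, [/\ `|q.1 - p.1| < rho, `|q.2 - p.2| < rho,
    `|q.1 - p.1| < rad / 2 & `|q.2 - p.2| < rad / 2].
  apply/box_near; exists (Num.min rho (rad / 2)); first by rewrite lt_min rho0 divr_gt0.
  by move=> q; rewrite !lt_min => /andP[? ?] /andP[? ?].
have cl : usc_env P (value P r) p - ep < usc_env P (value P r) p by rewrite gtrBl.
have [[y t] [[[y1 t1 y2 t2] hphi] cq Yy wq]] :=
  freq _ _ (nearS2 bx (cphi _ ep0) (@subset_refl _ _)) cl.
rewrite /= in y1 t1 y2 t2 Yy hphi; have {}hphi := hphi Yy.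
have /andP[/= t0 tT] := cq.
have taut : tau <= t by exact: close_le t2 ta3 r3.
have [X [a [pX ZX gX]]] := Hg y t tau Yy y1 t1 (ltW tau0) ta1 taut (ltW tT).
have tI : 0 <= tau <= tau by rewrite lexx ltW.
have [n1 n2] := short_ptraj S pX y2 t2 ta2 tI.
have max1 := H1 (X tau, t - tau) (lt_le_trans n1 r1) (lt_le_trans n2 r1) ZX.
have ce := H2 (X tau, t - tau) (lt_le_trans n1 r2) (lt_le_trans n2 r2).
have tI' : 0 <= tau <= t by rewrite (ltW tau0).
have := value_le S (reg_ptraj_ex S) tI' (ltW tT) pX.
have := usc_env_ge wB ce.
have cE : c * tau = - (4 * ep) by rewrite /ep; field.
move: gX wq hphi max1; rewrite /gain cE ler_norml.
move: (value P r _) (value P r _) (jcost _ _ _ _) (phi _) (phi _) (phi _) (usc_env _ _ _) (usc_env _ _ _).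
move=> v1 v2 v3 v4 v5 v6 v7 v8 h1 h2 /andP[h3 h4] h5 h6 h7.
clear - ep0 h1 h2 h3 h4 h5 h6 h7; lra.
Qed.

(** (C4) with the unit normals replaced by the gradient; dividing [d] by [k1 + k2] accounts for both
    proportionality factors. *)
Lemma speed_ctrl (z : V) : Ga z -> exists2 dl, 0 < dl & forall i s r, 0 <= s <= T -> `|r| <= dl ->
  exists al : ctrl (reg P i), sgn i * edot (dyn z s al) (grad sd z) = r.
Proof.
move=> Gz; have [d d0 Hd] := normal_ctrl S.
have [k1 k10 E1] := edot_normal S true Gz.
have [k2 k20 E2] := edot_normal S false Gz.
have k0 : 0 < k1 + k2 by rewrite addr_gt0.
exists (d / (k1 + k2)); first by rewrite divr_gt0.
move=> i s r sI rd; have kd k : 0 < k -> k <= k1 + k2 -> - d <= k * r <= d.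
  move=> kk0 kk; rewrite -ler_norml normrM gtr0_norm//.
  rewrite (@le_trans _ _ ((k1 + k2) * (d / (k1 + k2))))//; first by rewrite ler_pM// ltW.
  by rewrite mulrCA divff ?mulr1// gt_eqF.
case: i.
  have kI : - d <= k1 * r <= d by apply: kd => //; rewrite lerDl ltW.
  have [al Ha] := Hd true z s _ Gz sI kI; exists al; rewrite E1 in Ha.
  exact: (mulfI (lt0r_neq0 k10) Ha).
have kI : - d <= k2 * r <= d by apply: kd => //; rewrite lerDr ltW.
have [al Ha] := Hd false z s _ Gz sI kI; exists al; rewrite E2 in Ha.
exact: (mulfI (lt0r_neq0 k20) Ha).
Qed.

(** The envelope takes all nearby points into account, whereas a tangential test sees only the
    interface. Bringing a nearby point to the interface lowers the value by at most [M] times the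
    duration, so the envelope is also approached along the interface. *)
Lemma iface_freq r (p : V * R) (A : set (V * R)) c' : cylinder P p -> Ga p.1 -> nbhs p A ->
  c' < usc_env P (value P r) p ->
  exists q, [/\ A q, cylinder P q, Ga q.1 & c' < value P r q].
Proof.
move=> cp Gp nA cl; have M0 := st_M0 S; have wB := value_domain_bounded r.
have /andP[p20 p2T] := cp; have pI : 0 <= p.2 <= T by rewrite !ltW.
have [dl dl0 Hd] := speed_ctrl Gp.
have dd : `|dl| <= dl by rewrite gtr0_norm.
have [al1 h1] := Hd true p.2 dl pI dd; have [al2 h2] := Hd false p.2 dl pI dd.
have q1 : 0 < sgn true * edot (dyn p.1 p.2 al1) (grad sd p.1) by rewrite h1.
have q2 : 0 < sgn false * edot (dyn p.1 p.2 al2) (grad sd p.1) by rewrite h2.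
have [ca1 [rho1 [K1 [rho10 K10 H1]]]] := hit S Gp pI q1.
have [ca2 [rho2 [K2 [rho20 K20 H2]]]] := hit S Gp pI q2.
have [e e0 He] := (box_near _ _).1 (nearS2 nA (cylinder_near cp) (@subset_refl _ _)).
pose K := K1 + K2; have K0 : 0 < K by rewrite addr_gt0.
(* Half of the gap goes into finding a point near [p], the other half pays for its way to the
   interface. *)
pose k := (usc_env P (value P r) p - c') / 2.
have k0 : 0 < k by rewrite divr_gt0// subr_gt0.
(* [h * Q] adds up the initial distance, the bound [M * (K * h)] on displacement and on cost, and
   the duration. *)
pose Q := 1 + (M + 1) * K; have Q0 : 0 < Q by rewrite addr_gt0// mulr_gt0// addr_gt0.
pose h := Num.min (Num.min rho1 rho2) (Num.min (Num.min e p.2) k / Q).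
have h0 : 0 < h by rewrite !lt_min rho10 rho20 divr_gt0// !lt_min e0 p20.
have hr1 : h <= rho1 by rewrite !ge_min lexx.
have hr2 : h <= rho2 by rewrite !ge_min lexx orbT.
have hQ : h * Q <= Num.min (Num.min e p.2) k by rewrite -ler_pdivlMr// ge_min lexx orbT.
move: hQ; rewrite !le_min => /andP[/andP[hQe hQp] hQk].
have QE : h * Q = h + M * (K * h) + K * h by rewrite /Q; ring.
have Kh : 0 < K * h by rewrite mulr_gt0.
have MKh : 0 < M * (K * h) by rewrite mulr_gt0.
rewrite QE in hQe hQp hQk.
have cl' : c' + k < usc_env P (value P r) p.
  have e' : usc_env P (value P r) p = c' + k + k by rewrite /k; field.
  by rewrite [ltRHS]e' ltrDl.
have bx : \forall q \near p, `|q.1 - p.1| < h /\ `|q.2 - p.2| < h.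
  by apply/box_near; exists h.
have K1K : K1 <= K by rewrite lerDl ltW.
have K2K : K2 <= K by rewrite lerDr ltW.
clearbody h Q k K.
have hKp : h + K * h <= p.2 by clear - hQp MKh; lra.
have hKe : h + K * h <= e by clear - hQe MKh; lra.
have he : h <= e by clear - hKe Kh; lra.
have [[y t] [[/= y1 t1] cq wq]] := usc_env_freq wB cp cl' bx.
have /andP[/= t0 tT] := cq.
have fin (sg : R) (X : R -> V) (a : R -> ctl) : 0 <= sg <= K * h -> ptraj M true y t sg X a ->
    Ga (X sg) -> exists q, [/\ A q, cylinder P q, Ga q.1 & c' < value P r q].
  move=> /andP[s0 sK] pX GX; exists (X sg, t - sg).
  have hX : `|X sg - y| <= M * sg by apply: ptraj_disp pX _; rewrite s0 lexx.
  have Ms : M * sg <= M * (K * h) by rewrite ler_wpM2l// ltW.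
  have n1 : `|X sg - p.1| < e.
    have h3 := ler_normD (X sg - y) (y - p.1); rewrite subrKA in h3.
    by clear - h3 hX Ms y1 hQe Kh; lra.
  have n2 : `|t - sg - p.2| < e.
    move: t1; rewrite !ltr_norml => /andP[u1 u2].
    by clear - u1 u2 s0 sK hKe; apply/andP; split; lra.
  have [Aq cq'] := He (X sg, t - sg) n1 n2; split=> //.
  have sI : 0 <= sg <= t.
    by rewrite s0 /=; move: t1; rewrite ltr_norml => /andP[u1 _]; clear - u1 sK hKp; lra.
  have pX' : ptraj M r y t sg X a by apply: ptraj_le pX.
  have := value_le S (reg_ptraj_ex S) sI (ltW tT) pX'.
  have := jcost_le S sI (ltW tT) pX'; rewrite ler_norml => /andP[_].
  move: wq; move: (value P r _) (value P r _) (jcost _ _ _ _) => v1 v2 v3 u1 u2 u3.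
  by clear - u1 u2 u3 Ms hQk h0 Kh; lra.
have arr K' : 0 < K' -> K' <= K -> K' * `|y - p.1| <= K * h /\ K' * `|y - p.1| <= t.
  move=> K'0 K'K; have le1 : K' * `|y - p.1| <= K * h.
    by apply: ler_pM => //; exact: ltW.
  by split=> //; move: t1; rewrite ltr_norml => /andP[u1 _]; clear - u1 le1 hKp; lra.
have [Dy|Dy|Gy] := tricho S y.
- have [||a1 a2] := arr K1 => //.
  have [sg [X [sI pX GX]]] := H1 y t Dy (lt_le_trans y1 hr1) (lt_le_trans t1 hr1) a2 (ltW tT).
  by apply: (fin sg X _ _ pX GX); case/andP: sI => -> /le_trans; apply.
- have [||a1 a2] := arr K2 => //.
  have [sg [X [sI pX GX]]] := H2 y t Dy (lt_le_trans y1 hr2) (lt_le_trans t1 hr2) a2 (ltW tT).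
  by apply: (fin sg X _ _ pX GX); case/andP: sI => -> /le_trans; apply.
- exists (y, t); have [Aq _] := He (y, t) (lt_le_trans y1 he) (lt_le_trans t1 he).
  by split=> //; rewrite (lt_trans _ wq)// ltrDl.
Qed.

End Core.

(** * Perturbation of controls by convexity *)

Section Perturbation.
Context {R : realType} {N : nat} (P : control_problem R N) (M L : R).
Local Notation V := 'rV[R]_N.
Local Notation T := (horizon P).
Local Notation Ga := (iface P).
Local Notation sd := (signed_dist P).
Hypothesis S : standing P M L.

Lemma mix_ctrl i (al be : ctrl (reg P i)) z s l : spacetime (reg P i) T z s -> 0 <= l <= 1 ->
  exists ga : ctrl (reg P i), dyn z s ga = (1 - l) *: dyn z s al + l *: dyn z s be /\
    cost z s ga = (1 - l) * cost z s al + l * cost z s be.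
Proof.
move=> st /andP[l0 l1].
have C3i : C3 T (reg P i) by case: (st_ctl S) => _ _ [h1 h2] _; case: (i).
have [_ cv] := C3i z s st.
have m (u : ctrl (reg P i)) : (dyn z s u, cost z s u : R^o) \in
    [set (dyn z s a, cost z s a : R^o) | a in [set: ctrl (reg P i)]].
  by rewrite inE; exists u.
have := cv _ _ (Itv01 l0 l1) (m be) (m al); rewrite inE => -[ga _ [e1 e2]].
by exists ga; rewrite e1 e2; split; rewrite addrC.
Qed.

Lemma small_mix (u v c : R) : u < c -> exists l, [/\ 0 < l, l <= 1 & (1 - l) * u + l * v < c].
Proof.
move=> uc; have w0 : 0 < `|v - u| + 1 by rewrite ltr_wpDl.
have cu : 0 < (c - u) / 2 by rewrite divr_gt0// subr_gt0.
exists (Num.min 1 ((c - u) / 2 / (`|v - u| + 1))); set l := Num.min _ _.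
have l0 : 0 < l by rewrite lt_min ltr01 divr_gt0.
split=> //; first by rewrite ge_min lexx.
have : l * (`|v - u| + 1) <= (c - u) / 2 by rewrite -ler_pdivlMr// ge_min lexx orbT.
rewrite mulrDr mulr1 => h1.
have h2 : l * (v - u) <= l * `|v - u| by rewrite ler_pM2l// ler_norm.
have -> : (1 - l) * u + l * v = u + l * (v - u) by ring.
by move: h1 h2; move: (l * _) (l * _) => a b; lra.
Qed.

Variables (phi : V * R -> R) (D : V * R -> V) (d : V * R -> R).

Definition rate (i : bool) (p : V * R) (al : ctrl (reg P i)) : R :=
  edot (D p) (dyn p.1 p.2 al) - d p + cost p.1 p.2 al.

Definition speed (i : bool) (p : V * R) (al : ctrl (reg P i)) : R :=
  sgn i * edot (dyn p.1 p.2 al) (grad sd p.1).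

Lemma mix_rate i (al be : ctrl (reg P i)) p l : stset P i p -> 0 <= l <= 1 ->
  exists ga : ctrl (reg P i), rate p ga = (1 - l) * rate p al + l * rate p be /\
    speed p ga = (1 - l) * speed p al + l * speed p be.
Proof.
move=> sp lI; have [ga [e1 e2]] := mix_ctrl al be sp lI; exists ga.
rewrite /rate /speed e1 e2 edotDr edotDl !edotZr !edotZl; split; ring.
Qed.

Lemma nonzero_speed i (al : ctrl (reg P i)) p c : Ga p.1 -> 0 <= p.2 <= T -> rate p al < c ->
  exists2 be : ctrl (reg P i), rate p be < c & speed p be != 0.
Proof.
move=> Gp pI rc; have [s0|s0] := eqVneq (speed p al) 0; last by exists al.
have sp : stset P i p by split=> //; exact: (iface_closure S i).
have [dl dl0 Hd] := speed_ctrl S Gp.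
have dd : `|dl| <= dl by rewrite gtr0_norm.
have [be hb] := Hd i p.2 dl pI dd.
have [l [l0 l1 Hl]] := small_mix (rate p be) rc.
have lI : 0 <= l <= 1 by rewrite (ltW l0).
have [ga [e1 e2]] := mix_rate al be sp lI; exists ga; first by rewrite e1.
by rewrite e2 s0 mulr0 add0r /speed hb mulf_neq0// gt_eqF.
Qed.

(** When both speeds point outwards, the sliding weight is dictated by them and not chosen, so both
    rates must lie below [c]. This is how the minimum of the two Hamiltonians arises. *)
Lemma iface_good r (al1 : ctrl (reg P true)) (al2 : ctrl (reg P false)) p c :
  test phi D d setT p -> Ga p.1 -> 0 <= p.2 <= T -> rate p al1 < c -> rate p al2 < c ->
  good P M phi r Ga setT p c.
Proof.
move=> tp Gp pI r1 r2.
have [be1 {}r1 s1] := nonzero_speed Gp pI r1.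
have [be2 {}r2 s2] := nonzero_speed Gp pI r2.
have [n1|p1|/esym/eqP] := ltgtP (speed p be1) 0; last by rewrite eq_sym (negbTE s1).
  exact: (enter_good S r tp Gp pI r1 n1).
have [n2|p2|/esym/eqP] := ltgtP (speed p be2) 0; last by rewrite eq_sym (negbTE s2).
  exact: (enter_good S r tp Gp pI r2 n2).
pose B1 := edot (dyn p.1 p.2 be1) (grad sd p.1).
pose B2 := - edot (dyn p.1 p.2 be2) (grad sd p.1).
have B10 : 0 < sgn true * B1 by exact: p1.
have B20 : 0 < sgn true * B2 by rewrite mul1r /B2 -mulN1r; exact: p2.
have b1 : 0 < B1 by move: B10; rewrite mul1r.
have b2 : 0 < B2 by move: B20; rewrite mul1r.
have b12 : 0 < B1 + B2 by rewrite addr_gt0.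
have [|rho [tau1 [h1 h2 h3]]] :=
    slide_good S (r:=r) (e:=true) (c:=c) (fun=> isT) tp Gp pI (@subsetT _ _) erefl erefl B10 B20.
  rewrite -/B1 -/B2; set m := B2 / (B1 + B2).
  have m0 : 0 <= m by rewrite divr_ge0 ?ltW.
  have m1 : m <= 1 by rewrite ler_pdivrMr// mul1r lerDr ltW.
  have -> : edot (D p) (dyn_iface (P:=P) p.1 p.2 (be1, be2, m)) - d p +
      cost_iface (P:=P) p.1 p.2 (be1, be2, m) = m * rate p be1 + (1 - m) * rate p be2.
    rewrite /rate /dyn_iface /cost_iface /= edotDr !edotZr; ring.
  have [->|mn0] := eqVneq m 0; first by rewrite mul0r add0r subr0 mul1r.
  have mp : 0 < m by rewrite lt_neqAle eq_sym mn0.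
  have : m * rate p be1 < m * c by rewrite ltr_pM2l.
  have : (1 - m) * rate p be2 <= (1 - m) * c by rewrite ler_wpM2l ?subr_ge0// ltW.
  move: (m * _) ((1 - m) * _) => u v h3 h4.
  have -> : c = m * c + (1 - m) * c by ring.
  by rewrite ltr_leD.
exists rho, tau1; split=> // y t tau Gy q1 q2 q3 q4 q5 q6.
by have [X [a [pX _ gX]]] := h3 y t tau Gy q1 q2 q3 q4 q5 q6; exists X, a.
Qed.

Lemma Ham_gt i z s v k : k < Ham (reg P i) z s v ->
  exists al : ctrl (reg P i), k < - edot (dyn z s al) v - cost z s al.
Proof.
rewrite /Ham => h; have [a0 _] := ctrl_ne S i.
have [|_ [al _ <-] hk] := sup_gt _ h; first by eexists; exists a0.
by exists al.
Qed.

Lemma Ham_rate i (p : V * R) : 0 < d p + Ham (reg P i) p.1 p.2 (D p) ->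
  exists al : ctrl (reg P i), rate p al < 0.
Proof.
rewrite -ltrBlDl sub0r => /Ham_gt[al h]; exists al.
by rewrite /rate edotC; move: h; move: (edot _ _) (cost _ _ _) => u v; lra.
Qed.

End Perturbation.

(** * Subsolution inequalities in the whole space *)

Section Subsolution.
Context {R : realType} {N : nat} (P : control_problem R N) (M L : R).
Local Notation V := 'rV[R]_N.
Local Notation T := (horizon P).
Local Notation Ga := (iface P).
Hypothesis S : standing P M L.

Lemma C1_test (phi : V * R -> R) p : C1_cylinder P phi -> cylinder P p ->
  test phi (grad_x phi) (d_t phi) setT p.
Proof.
move=> C1p cp; split.
- apply: (nearS (cylinder_near cp)) => q /C1p[dq _] _; exact: expansion_diff.
- move=> e e0; have [_ Cp] := C1p p cp.
  have : \forall q \near p, forall i : 'I_N,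
      `|'D_((delta_mx 0 i, 0) : V * R) phi q - 'D_((delta_mx 0 i, 0) : V * R) phi p| <= e.
    apply: (@filter_forall _ _ (fun i q => `|'D_((delta_mx 0 i, 0) : V * R) phi q -
      'D_((delta_mx 0 i, 0) : V * R) phi p| <= e) (nbhs p)) => i.
    have /cvgrPdist_le/(_ _ e0) := Cp ((delta_mx 0 i, 0) : V * R).
    by move=> h; apply: (nearS h) => q; rewrite /= distrC.
  move=> h; apply: (nearS h) => q Hq _; apply: norm_le_coord; first exact: ltW.
  by move=> i; rewrite !mxE; exact: Hq.
- move=> e e0; have [_ Cp] := C1p p cp.
  have /cvgrPdist_le/(_ _ e0) h := Cp ((0, 1) : V * R).
  by apply: (nearS h) => q /=; rewrite distrC.
Qed.

Lemma test_cont (phi : V * R -> R) D d (E : set (V * R)) p : test phi D d E p -> E p ->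
  forall e, 0 < e -> \forall q \near p, E q -> `|phi q - phi p| <= e.
Proof.
move=> [nE _ _] Ep e e0; have ex := nbhs_singleton nE Ep.
have [dl dl0 H] := expansion_lip ex; set C := (_ + 1) in H.
have C0 : 0 < C by rewrite ltr_wpDl ?addr_ge0 ?mulr_ge0.
apply/box_near; exists (Num.min dl (e / (2 * C))); first by rewrite lt_min dl0 divr_gt0// mulr_gt0.
move=> q; rewrite !lt_min => /andP[h1 h2] /andP[h3 h4] Eq.
rewrite (le_trans (H q Eq h1 h3))//.
rewrite (@le_trans _ _ (C * (e / (2 * C) + e / (2 * C))))//.
  by rewrite ler_wpM2l ?(ltW C0)// lerD// ltW.
by have -> : C * (e / (2 * C) + e / (2 * C)) = e by field; rewrite gt_eqF.
Qed.

Lemma sub_contra r (phi : V * R -> R) (p : V * R) c : C1_cylinder P phi -> cylinder P p ->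
  (\forall q \near p, usc_env P (value P r) q - phi q <= usc_env P (value P r) p - phi p) ->
  c < 0 -> (forall i, run_good P M phi r i p c) -> good P M phi r Ga setT p c -> False.
Proof.
move=> C1p cp maxp c0 Hr Hg; have tp := C1_test C1p cp.
apply: (sub_core S cp c0 (good_glue S Hr Hg)).
- by apply: (nearS maxp) => q h _.
- move=> A c' nA cl.
  have [q [h1 h2 h3]] := usc_env_freq (value_domain_bounded S r) cp cl nA.
  by exists q; split.
- by move=> e e0; have h := test_cont tp I e0; apply: (nearS h) => q hq _; exact: hq.
Qed.

Lemma value_sub r : subsolution P (usc_env P (value P r)).
Proof.
have wB := value_domain_bounded S r; split.
- exact: (usc_env_bounded wB).
- exact: (usc_env_usc wB).
move=> phi p C1p cp maxp h1 h2; have tp := C1_test C1p cp.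
have pI : 0 <= p.2 <= T by case/andP: cp => /ltW -> /ltW ->.
have mid (x : R) : x < 0 -> exists2 c, x < c & c < 0 by move=> x0; exists (x / 2); lra.
have inside i : dom (reg P i) p.1 -> d_t phi p + Ham (reg P i) p.1 p.2 (grad_x phi p) <= 0.
  move=> Dp; rewrite leNgt; apply/negP => /(Ham_rate S)[al /mid[c rc c0]].
  have sp : stset P i p by split=> //; exact: subset_closure.
  have nG : ~ Ga p.1.
    by move=> Gp; move: Dp; case: (i) => h; [exact: (iface_notin1 S Gp)|exact: (iface_notin2 S Gp)].
  have gr : run_good P M phi r i p c by exact: (run_goodP S r tp sp rc).
  (* A point of region [i] has no point of the opposite region or of the interface nearby, so the
     two remaining strategies are vacuous. *)
  have gr' : run_good P M phi r (~~ i) p c.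
    apply: (run_good_vacuous S); move=> /(closure_dom S)[|//].
    by move: Dp; case: (i) => u1 u2; [exact: (dom_disj S u1 u2)|exact: (dom_disj S u2 u1)].
  apply: (sub_contra C1p cp maxp c0 _ (iface_good_vacuous S phi r setT c nG)) => j.
  by move: gr gr'; case: (i); case: j.
split; [exact: (inside true)|exact: (inside false)|].
move=> Gp; rewrite leNgt; apply/negP => h.
have [g1 g2] : 0 < d_t phi p + h1 /\ 0 < d_t phi p + h2.
  by move: h; rewrite -!(ltrBlDl) !lt_min sub0r => /andP[].
have [al1 r1] := Ham_rate S (i:=true) g1; have [al2 r2] := Ham_rate S (i:=false) g2.
have [c rc c0] : exists2 c, Num.max (rate (grad_x phi) (d_t phi) p al1)
    (rate (grad_x phi) (d_t phi) p al2) < c & c < 0 by apply: mid; rewrite gt_max r1.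
move: rc; rewrite gt_max => /andP[rc1 rc2].
apply: (sub_contra C1p cp maxp c0 _ (iface_good S r tp Gp pI rc1 rc2)).
case.
- by apply: (run_goodP S r tp _ rc1); split=> //; exact: (iface_closure S true).
- by apply: (run_goodP S r tp _ rc2); split=> //; exact: (iface_closure S false).
Qed.

End Subsolution.

(* The controls are perturbed so that both normal speeds become nonzero of the
   same sign; the resulting sliding weight is a convex combination of [m] and
   [m + l * (1 / 2 - m)], hence close to [m]. *)
Lemma blend {R : realFieldType} (m s1 s2 Q1 Q2 C dl c sg : R) : 0 <= m <= 1 -> m * s1 = (1 - m) * s2 ->
  sg * sg = 1 -> 0 <= sg * s1 -> 0 <= sg * s2 -> `|Q1| <= C -> `|Q2| <= C -> 0 < dl ->
  m * Q1 + (1 - m) * Q2 < c ->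
  exists l r1 r2, [/\ 0 <= l <= 1, `|r1| <= dl, `|r2| <= dl &
    forall R1 R2, `|R1| <= C -> `|R2| <= C ->
    let B1 := (1 - l) * s1 + l * r1 in let B2 := (1 - l) * s2 + l * r2 in
    [/\ 0 < sg * B1, 0 < sg * B2 & let m' := B2 / (B1 + B2) in
      m' * ((1 - l) * Q1 + l * R1) + (1 - m') * ((1 - l) * Q2 + l * R2) < c]].
Proof.
move=> /andP[m0 m1] ms sg2 hs1 hs2 hQ1 hQ2 dl0 Qc.
have C0 : 0 <= C by exact: le_trans hQ1.
pose g := c - (m * Q1 + (1 - m) * Q2); have g0 : 0 < g by rewrite subr_gt0.
have C4 : 0 < 4 * C + 1 by rewrite ltr_wpDl// mulr_ge0.
(* Replacing the controls changes the mean rate by at most [2 * C * l], and the shift of the weight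
   adds at most [2 * C * l]; together they stay below the gap [g]. *)
pose l := Num.min (1 / 2) (g / 2 / (4 * C + 1)).
have l0 : 0 < l by rewrite lt_min !divr_gt0.
have l12 : l <= 1 / 2 by rewrite ge_min lexx.
have lg : 4 * C * l < g.
  have : l * (4 * C + 1) <= g / 2 by rewrite -ler_pdivlMr// ge_min lexx orbT.
  by move: (4 * C) => u; rewrite mulrDr mulr1 mulrC; lra.
have l1 : 0 < 1 - l by lra.
(* Moving the weight towards 1/2 puts [n] strictly between 0 and 1 even when [m] is an endpoint. *)
clearbody l; pose n := (1 - l) * m + l / 2.
have n0 : 0 < n.
  apply: ltr_wpDl; last by rewrite divr_gt0.
  by apply: mulr_ge0 => //; exact: ltW.
have n1 : 0 < 1 - n.
  have -> : 1 - n = (1 - l) * (1 - m) + l / 2 by rewrite /n; field.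
  apply: ltr_wpDl; last by rewrite divr_gt0.
  by apply: mulr_ge0; [exact: ltW|rewrite subr_ge0].
have nsg : `|sg| = 1.
  by apply/eqP; rewrite -sqrp_eq1// real_normK ?num_real// expr2 sg2.
(* Speeds in the ratio [1 - n] to [n] have sliding weight exactly [n]; both are strictly positive
   after multiplication by [sg], even if [s1] and [s2] vanish. *)
exists l, (sg * (dl * (1 - n))), (sg * (dl * n)); split.
- by rewrite (ltW l0); lra.
- by rewrite !normrM nsg mul1r (gtr0_norm dl0) gtr0_norm// ler_piMr ?(ltW dl0)// gerBl ltW.
- rewrite !normrM nsg mul1r (gtr0_norm dl0) gtr0_norm// ler_piMr ?(ltW dl0)//.
  by move: n1; rewrite subr_gt0 => /ltW.
move=> R1 R2 hR1 hR2 B1 B2.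
have B1E : sg * B1 = (1 - l) * (sg * s1) + l * (dl * (1 - n)).
  rewrite /B1; have -> : sg * ((1 - l) * s1 + l * (sg * (dl * (1 - n)))) =
    (1 - l) * (sg * s1) + sg * sg * (l * (dl * (1 - n))) by ring.
  by rewrite sg2 mul1r.
have B2E : sg * B2 = (1 - l) * (sg * s2) + l * (dl * n).
  rewrite /B2; have -> : sg * ((1 - l) * s2 + l * (sg * (dl * n))) =
    (1 - l) * (sg * s2) + sg * sg * (l * (dl * n)) by ring.
  by rewrite sg2 mul1r.
have b1 : 0 < sg * B1.
  by rewrite B1E; apply: ltr_wpDl; [apply: mulr_ge0 => //; exact: ltW|rewrite !mulr_gt0].
have b2 : 0 < sg * B2.
  by rewrite B2E; apply: ltr_wpDl; [apply: mulr_ge0 => //; exact: ltW|rewrite !mulr_gt0].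
split=> // m'.
have mE : m' = (sg * B2) / (sg * B1 + sg * B2).
  have sg0 : sg != 0 by rewrite -normr_eq0 nsg oner_eq0.
  by rewrite /m' -mulrDr invfM mulrACA divff// mul1r.
move: b1 b2 mE; set b1 := sg * B1; set b2 := sg * B2 => b10 b20 mE.
have b12 : 0 < b1 + b2 by rewrite addr_gt0.
have m'0 : 0 <= m' by rewrite mE divr_ge0// ltW.
have m'1 : m' <= 1 by rewrite mE ler_pdivrMr// mul1r lerDr ltW.
have ldl : 0 < l * dl by rewrite mulr_gt0.
have low : l * dl <= b1 + b2.
  have -> : b1 + b2 = (1 - l) * (sg * s1 + sg * s2) + l * dl by rewrite /b1 /b2 B1E B2E; ring.
  by rewrite lerDr; apply: mulr_ge0; [exact: ltW|exact: addr_ge0].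
have dm : `|m' - m| <= l.
  have E : m' - m = (l * dl * (n - m)) / (b1 + b2).
    rewrite mE; apply: (mulIf (lt0r_neq0 b12)); rewrite mulrBl !divfK ?lt0r_neq0//.
    have s2E : s2 = m * (s1 + s2) by rewrite mulrDr ms; ring.
    rewrite /b1 /b2 B1E B2E.
    have s2z : s2 - m * (s1 + s2) = 0 by rewrite -s2E subrr.
    apply/eqP; rewrite -subr_eq0; apply/eqP.
    by rewrite -[RHS](mulr0 ((1 - l) * sg)) -s2z; ring.
  rewrite E normrM normfV (gtr0_norm b12) ler_pdivrMr// normrM (gtr0_norm ldl).
  have nm : `|n - m| <= l.
    have -> : n - m = l * (1 / 2 - m) by rewrite /n; field.
    rewrite normrM (gtr0_norm l0) ler_piMr ?(ltW l0)// ler_norml; lra.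
  by rewrite mulrC ler_pM ?normr_ge0// ltW.
have Ecalc : m' * ((1 - l) * Q1 + l * R1) + (1 - m') * ((1 - l) * Q2 + l * R2) =
    m * Q1 + (1 - m) * Q2 + l * (m' * (R1 - Q1) + (1 - m') * (R2 - Q2)) + (m' - m) * (Q1 - Q2).
  by ring.
have d1 : R1 - Q1 <= 2 * C by move: hR1 hQ1; rewrite !ler_norml => /andP[u1 u2] /andP[u3 u4]; clear - u1 u2 u3 u4; lra.
have d2 : R2 - Q2 <= 2 * C by move: hR2 hQ2; rewrite !ler_norml => /andP[u1 u2] /andP[u3 u4]; clear - u1 u2 u3 u4; lra.
have d3 : `|Q1 - Q2| <= 2 * C.
  by rewrite (le_trans (ler_normB _ _))// mulr_natl mulr2n lerD.
have t1 : m' * (R1 - Q1) + (1 - m') * (R2 - Q2) <= 2 * C.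
  have -> : 2 * C = m' * (2 * C) + (1 - m') * (2 * C) by ring.
  by rewrite lerD// ler_wpM2l// subr_ge0.
have t2 : (m' - m) * (Q1 - Q2) <= l * (2 * C).
  by rewrite (le_trans (ler_norm _))// normrM ler_pM.
have t3 : l * (m' * (R1 - Q1) + (1 - m') * (R2 - Q2)) <= l * (2 * C) by rewrite ler_pM2l.
rewrite Ecalc; have gE : g = c - (m * Q1 + (1 - m) * Q2) by [].
have e4 : 4 * C * l = l * (2 * C) + l * (2 * C) by ring.
rewrite e4 gE in lg.
move: lg t2 t3; move: (m * Q1 + _) (l * _) ((m' - m) * _) (l * _) => u1 u2 u3 u4.
clear; lra.
Qed.

(** * Tangential subsolution inequalities *)

Section Tangential.
Context {R : realType} {N : nat} (P : control_problem R N) (M L : R).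
Local Notation V := 'rV[R]_N.
Local Notation T := (horizon P).
Local Notation Ga := (iface P).
Local Notation sd := (signed_dist P).
Local Notation ctl := (control P).
Hypothesis S : standing P M L.
Variables (phi : V * R -> R) (D : V * R -> V) (d : V * R -> R).

Lemma rate_bound (p : V * R) i (al : ctrl (reg P i)) : stset P i p ->
  `|rate D d p al| <= N%:R * `|D p| * M + `|d p| + M.
Proof.
move=> sp; rewrite /rate (le_trans (ler_normD _ _))// lerD ?(st_cost S)//.
rewrite (le_trans (ler_normB _ _))// lerD// (le_trans (edot_le _ _))//.
by rewrite ler_wpM2l ?mulr_ge0// (st_dyn S).
Qed.

Lemma same_sign (m s1 s2 : R) : 0 <= m <= 1 -> m * s1 = (1 - m) * s2 ->
  exists e, 0 <= sgn e * s1 /\ 0 <= sgn e * s2.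
Proof.
move=> /andP[m0 m1] ms.
have [h1|h1] := leP 0 s1; have [h2|h2] := leP 0 s2.
- by exists true; rewrite /sgn !mul1r.
- exists false; rewrite /sgn !mulN1r !oppr_ge0 (ltW h2); split=> //.
  rewrite leNgt; apply/negP => s1p.
  have z : (1 - m) * s2 <= 0 by rewrite mulr_ge0_le0 ?subr_ge0// ltW.
  have : m * s1 <= 0 by rewrite ms.
  rewrite pmulr_lle0// => m0'; have mz : m = 0 by apply/eqP; rewrite eq_le m0 m0'.
  by move: ms; rewrite mz mul0r subr0 mul1r => s2z; move: h2; rewrite -s2z ltxx.
- exists false; rewrite /sgn !mulN1r !oppr_ge0 (ltW h1); split=> //.
  rewrite leNgt; apply/negP => s2p.
  have z : m * s1 <= 0 by rewrite mulr_ge0_le0// ltW.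
  have : (1 - m) * s2 <= 0 by rewrite -ms.
  rewrite pmulr_lle0// subr_le0 => m1'; have mz : m = 1 by apply/eqP; rewrite eq_le m1 m1'.
  by move: ms; rewrite mz subrr mul0r mul1r => s1z; move: h1; rewrite s1z ltxx.
- by exists false; rewrite /sgn !mulN1r !oppr_ge0 !ltW.
Qed.

(** A control in [A0] balances the two normal speeds, so they agree in weak sign and [e] records it.
    If regularity is required, [A0reg] forces the outward case [e = true], in which sliding is
    regular. *)
Lemma tangential_good (r : bool) (E : set (V * R)) (a : ctl) (p : V * R) c :
  test phi D d E p -> iface_cylinder P `<=` E -> Ga p.1 -> 0 <= p.2 <= T ->
  A0 p.1 p.2 a -> (r -> A0reg p.1 p.2 a) ->
  edot (D p) (dyn_iface p.1 p.2 a) - d p + cost_iface p.1 p.2 a < c ->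
  good P M phi r Ga Ga p c.
Proof.
case: a => [[a1 a2] m] tp GE Gp pI [mI tan] rA Hc; rewrite /ctrl_set /= in mI.
have sp1 : stset P true p by split=> //; exact: (iface_closure S true).
have sp2 : stset P false p by split=> //; exact: (iface_closure S false).
have [k1 k10 E1] := edot_normal S true Gp.
have [k2 k20 E2] := edot_normal S false Gp.
pose s1 := speed (i:=true) p a1; pose s2 := speed (i:=false) p a2.
have ms : m * s1 = (1 - m) * s2.
  apply/eqP; rewrite -subr_eq0; apply/eqP; apply: (mulfI (lt0r_neq0 k10)).
  rewrite mulr0 -[RHS]tan [RHS](E1 _) /dyn_iface /= edotDl !edotZl /s1 /s2 /speed /sgn.
  by ring.
have [e [re [se1 se2]]] : exists e : bool, (r -> e) /\ (0 <= sgn e * s1 /\ 0 <= sgn e * s2).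
  case: r rA => [/(_ isT)[_ h1 h2]|_]; last first.
    by have [e h] := same_sign mI ms; exists e.
  exists true; split=> //; rewrite /sgn !mul1r; split.
    by move: h1; rewrite [X in _ <= X -> _](E1 _) pmulr_rge0.
  by move: h2; rewrite [X in _ <= X -> _](E2 _) pmulr_rge0.
have [dl dl0 Hd] := speed_ctrl S Gp.
have hQ1 := rate_bound (i:=true) a1 sp1; have hQ2 := rate_bound (i:=false) a2 sp2.
have sgsg : sgn e * sgn e = 1 :> R by rewrite /sgn; case: (e); rewrite ?mulr1// mulrNN mulr1.
have Hc' : m * rate D d (i:=true) p a1 + (1 - m) * rate D d (i:=false) p a2 < c.
  move: Hc; rewrite /rate /dyn_iface /cost_iface /= edotDr !edotZr.
  by congr (_ < _); ring.
have [l [r1 [r2 [lI hr1 hr2 H]]]] := blend mI ms sgsg se1 se2 hQ1 hQ2 dl0 Hc'.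
have [be1 hb1] := Hd true p.2 r1 pI hr1; have [be2 hb2] := Hd false p.2 r2 pI hr2.
have [ga1 [ra1 sa1]] := mix_rate S D d (i:=true) a1 be1 sp1 lI.
have [ga2 [ra2 sa2]] := mix_rate S D d (i:=false) a2 be2 sp2 lI.
have {H} := H _ _ (rate_bound (i:=true) be1 sp1) (rate_bound (i:=false) be2 sp2).
rewrite /s1 /s2 /= -hb1 -hb2 -/(speed (i:=true) p be1) -/(speed (i:=false) p be2).
rewrite -ra1 -ra2 -sa1 -sa2 => -[h1 h2 h3].
have B1E : speed (i:=true) p ga1 = edot (dyn p.1 p.2 ga1) (grad sd p.1).
  by rewrite /speed /sgn mul1r.
have B2E : speed (i:=false) p ga2 = - edot (dyn p.1 p.2 ga2) (grad sd p.1).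
  by rewrite /speed /sgn mulN1r.
apply: (slide_good S re tp Gp pI GE B1E B2E h1 h2).
apply: le_lt_trans h3; rewrite /rate /dyn_iface /cost_iface /= edotDr !edotZr.
by rewrite le_eqVlt; apply/orP; left; apply/eqP; ring.
Qed.

End Tangential.

Section InterfaceSubsolution.
Context {R : realType} {N : nat} (P : control_problem R N) (M L : R).
Local Notation T := (horizon P).
Local Notation Ga := (iface P).
Hypothesis S : standing P M L.

(** The Hamiltonians on the interface are then suprema of nonempty sets, so a positive inequality
    yields a control. *)
Lemma A0reg_ne z s : Ga z -> 0 <= s <= T -> exists a : control P, A0reg z s a.
Proof.
move=> Gz sI; have [d d0 Hd] := normal_ctrl S.
have dI : - d <= 0 <= d by rewrite oppr_le0 ltW.
have [a1 h1] := Hd true z s 0 Gz sI dI; have [a2 h2] := Hd false z s 0 Gz sI dI.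
exists (a1, a2, 1); split; [split|by rewrite [leRHS]h1|by rewrite [leRHS]h2].
  by rewrite /ctrl_set /= ler01 lexx.
by rewrite /dyn_iface /= scale1r subrr scale0r addr0.
Qed.

Lemma iface_test phi D d p : C1_iface P phi D d -> iface_cylinder P p ->
  test phi D d (iface_cylinder P) p.
Proof.
move=> [_ ex cD cd] ip; split.
- apply/box_near; exists 1 => // q _ _ iq e e0.
  have e1 : 0 < e / (N%:R + 1) by rewrite divr_gt0.
  apply: (nearS (ex q iq _ e1)) => q' H iq'; rewrite (le_trans (H iq'))//.
  rewrite -mulrA ler_wpM2l ?(ltW e0)// mulrC ler_pdivrMr// mulrC mulrDr lerD//.
    by rewrite (le_trans (enorm_le_norm _))// ler_wpM2r// lerDl.
  by rewrite ler_peMl// lerDr.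
- have /cvgrPdist_le H := (subspace_continuousP _ _).1 cD p ip.
  by move=> e e0; apply: (nearS (H _ e0)) => q h /h; rewrite distrC.
- have /cvgrPdist_le H := (subspace_continuousP _ _).1 cd p ip.
  by move=> e e0; apply: (nearS (H _ e0)) => q h /h; rewrite distrC.
Qed.

Lemma value_iface_sub (r : bool) :
  iface_subsolution P (if r then HTreg P else HT P) (usc_env P (value P r)).
Proof.
move=> phi D d C1p p Gp cp maxp.
have pI : 0 <= p.2 <= T by case/andP: cp => /ltW -> /ltW ->.
have ip : iface_cylinder P p by [].
have tp := iface_test C1p ip.
rewrite leNgt; apply/negP; rewrite -ltrBlDl sub0r => h.
have [a [Ha Hr hk]] : exists a : control P, [/\ A0 p.1 p.2 a, (r -> A0reg p.1 p.2 a) &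
    - d p < - edot (dyn_iface p.1 p.2 a) (D p) - cost_iface p.1 p.2 a].
  have [a0 [a00 h1 h2]] := A0reg_ne Gp pI.
  case: (r) h => h.
    have [|_ [a Ha <-] hk] := sup_gt _ h; first by eexists; exists a0.
    by exists a; split=> //; case: Ha.
  have [|_ [a Ha <-] hk] := sup_gt _ h; first by eexists; exists a0.
  by exists a.
have neg : edot (D p) (dyn_iface p.1 p.2 a) - d p + cost_iface p.1 p.2 a < 0.
  by rewrite edotC; move: hk; move: (edot _ _) (cost_iface _ _ _) => u v; lra.
have [c rc c0] : exists2 c, edot (D p) (dyn_iface p.1 p.2 a) - d p + cost_iface p.1 p.2 a < c & c < 0.
  by move: neg; move: (_ + _) => u u0; exists (u / 2); lra.
have Hg := tangential_good S tp (@subset_refl _ _) Gp pI Ha Hr rc.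
apply: (sub_core S cp c0 Hg).
- apply: (nearS (cylinder_near cp)) => q cq Gq; exact: maxp.
- move=> A c' nA cl; have [q [h1 h2 h3 h4]] := iface_freq S cp Gp nA cl.
  by exists q.
- move=> e e0; have h' := test_cont tp ip e0.
  apply: (nearS2 h' (cylinder_near cp)) => q [h1 /andP[q0 q1]] Gq; apply: h1.
  by split=> //; rewrite !ltW.
Qed.

End InterfaceSubsolution.

(** * Supersolution inequalities *)

Section Super.
Context {R : realType} {N : nat} (P : control_problem R N) (M L : R).
Local Notation V := 'rV[R]_N.
Local Notation mu := (@lebesgue_measure R).
Local Notation T := (horizon P).
Local Notation ctl := (control P).
Hypothesis S : standing P M L.
Variables (phi : V * R -> R) (D : V * R -> V) (d : V * R -> R).

Lemma tested_lip p rad K : tested phi D d setT p rad K ->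
  forall q q' : V * R, `|q.1 - p.1| < rad -> `|q.2 - p.2| < rad ->
    `|q'.1 - p.1| < rad -> `|q'.2 - p.2| < rad ->
    `|phi q - phi q'| <= (N%:R * K + K) * (`|q.1 - q'.1| + `|q.2 - q'.2|).
Proof.
move=> [rad0 K0 H] q q' q1 q2 q'1 q'2.
pose v := q.1 - q'.1; pose w := q.2 - q'.2.
pose X (th : R) : V := q'.1 + th *: v; pose Y (th : R) : R := q'.2 + th * w.
have bX th : 0 <= th <= 1 -> `|X th - p.1| < rad /\ `|Y th - p.2| < rad.
  move=> /andP[th0 th1]; have th1' : 0 <= 1 - th by rewrite subr_ge0.
  have conv (a b : R) : a < rad -> b < rad -> (1 - th) * a + th * b < rad.
    move=> ha hb; have [->|tn] := eqVneq th 0; first by rewrite subr0 mul1r mul0r addr0.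
    have tp : 0 < th by rewrite lt_neqAle eq_sym tn.
    have -> : rad = (1 - th) * rad + th * rad by ring.
    by rewrite ler_ltD ?ltr_pM2l// ler_wpM2l// ltW.
  split.
    have -> : X th - p.1 = (1 - th) *: (q'.1 - p.1) + th *: (q.1 - p.1).
      by apply/rowP => j; rewrite !mxE; ring.
    rewrite (le_lt_trans (ler_normD _ _))// !normrZ (ger0_norm th1') (ger0_norm th0).
    exact: conv.
  have -> : Y th - p.2 = (1 - th) * (q'.2 - p.2) + th * (q.2 - p.2) by rewrite /Y /w; ring.
  rewrite (le_lt_trans (ler_normD _ _))// !normrM (ger0_norm th1') (ger0_norm th0).
  exact: conv.
have dXt (th : R) : is_derive th 1 X v.
  apply/is_deriveP => e e0; apply: (@filterS _ (nbhs (0 : R)) _ setT); last exact: filterT.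
  move=> h _.
  rewrite (_ : X (th + h) - X th - h *: v = 0); first by rewrite normr0 mulr_ge0// ltW.
  by apply/rowP => j; rewrite !mxE; ring.
have dYt (th : R) : is_derive th 1 Y w.
  apply/is_deriveP => e e0; apply: (@filterS _ (nbhs (0 : R)) _ setT); last exact: filterT.
  move=> h _.
  rewrite (_ : Y (th + h) - Y th - h *: w = 0); first by rewrite normr0 mulr_ge0// ltW.
  by rewrite /Y -[h *: w]/(h * w); ring.
pose df th := edot (D (X th, Y th)) v + d (X th, Y th) * w.
have dF (th : R) : 0 <= th <= 1 -> is_derive th 1 (fun u => phi (X u, Y u)) (df th).
  move=> /bX[b1 b2]; have [ex _ _] := H (X th, Y th) I b1 b2.
  by apply: (@is_derive_chain _ _ setT phi _ _ X Y th _ _ ex (dXt th) (dYt th)); exact: filterT.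
have := @increment_norm_le _ (fun u => phi (X u, Y u)) df 0 1
  ((N%:R * K + K) * (`|q.1 - q'.1| + `|q.2 - q'.2|)) ler01.
have -> : phi (X 1, Y 1) = phi q.
  by congr phi; rewrite /X /Y /v /w scale1r mul1r !(addrC q'.1, addrC q'.2) !subrK; case: (q).
have -> : phi (X 0, Y 0) = phi q'.
  by congr phi; rewrite /X /Y scale0r mul0r !addr0; case: (q').
rewrite subr0 mulr1; apply.
  apply: derivable_within_continuous => u; rewrite in_itv/= => /dF h.
  exact: (@ex_derive _ _ _ _ _ _ _ h).
move=> th; rewrite in_itv/= => /andP[h0 h1].
have thI : 0 <= th <= 1 by rewrite !ltW.
split; first exact: dF.
have [b1 b2] := bX _ thI; have [_ h2 h3] := H (X th, Y th) I b1 b2.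
rewrite (le_trans (ler_normD _ _))// normrM mulrDl.
rewrite /v /w in h2 h3 *; rewrite lerD//.
  by rewrite (le_trans (edot_le _ _))// ler_pM ?mulr_ge0 ?ler_wpM2l// lerDl.
by rewrite ler_pM// lerDr.
Qed.

(** The trajectory is arbitrary, hence differentiable only almost everywhere, and Lipschitz
    continuity along it comes from that of [phi] on the box. [rate_le] is applied with all signs
    reversed. *)
Lemma verification_ae r p rad K c y (t tau : R) (X : R -> V) (a : R -> ctl) :
  tested phi D d setT p rad K -> 0 <= tau <= t -> t <= T -> ptraj M r y t tau X a ->
  (forall s, 0 <= s <= tau -> `|X s - p.1| < rad /\ `|t - s - p.2| < rad) ->
  (forall (q : V * R) al, ctrl_set al -> 0 <= q.2 <= T -> `|q.1 - p.1| < rad -> `|q.2 - p.2| < rad ->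
     c <= edot (D q) (drift (P:=P) q.1 q.2 al) - d q + running_cost (P:=P) q.1 q.2 al) ->
  c * tau <= phi (X tau, t - tau) - phi (y, t) + jcost X a t tau.
Proof.
move=> te tI tT pX XB Hc; have /andP[tau0 taut] := tI.
have M0 := st_M0 S; have [X0 lX [la _] dX _] := pX.
have [rad0 K0 H] := te.
pose C := (N%:R * K + K) * (M + 1).
have C0 : 0 <= C by rewrite !mulr_ge0 ?addr_ge0 ?mulr_ge0 ?(ltW M0).
have mrc := measurable_running_cost S tI tT pX.
have bB s : s \in `[0, tau] -> `|running_cost (X s) (t - s) (a s)| <= M.
  by move=> sI; exact: (running_cost_ptraj_le S tI tT pX).
have := @rate_le _ (fun s => - phi (X s, t - s)) (fun s => - running_cost (X s) (t - s) (a s))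
  tau (- c) C M tau0 C0 (ltW M0).
have -> : \int[mu]_(s in `[0, tau]) (- running_cost (X s) (t - s) (a s)) = - jcost X a t tau.
  rewrite /jcost -mulN1r -RintegralZl//.
    by apply: eq_Rintegral => s _; rewrite mulN1r.
  exact: integrable_bdd bB.
rewrite X0 subr0 => h.
have {h} h : - phi (X tau, t - tau) - - phi (y, t) + - jcost X a t tau <= - c * tau.
  apply: h.
  - move=> s s' sI s'I.
    have -> : - phi (X s, t - s) - - phi (X s', t - s') =
        phi (X s', t - s') - phi (X s, t - s) by ring.
    have [b1 b2] := XB _ sI; have [b3 b4] := XB _ s'I.
    rewrite (le_trans (tested_lip te (q:=(X s', t - s')) (q':=(X s, t - s)) b3 b4 b1 b2))//=.
    rewrite -mulrA ler_wpM2l ?addr_ge0 ?mulr_ge0// mulrDl mul1r lerD//.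
      by rewrite distrC; exact: lX.
    by rewrite (_ : t - s' - (t - s) = s - s')//; ring.
  - exact: measurableT_comp.
  - by move=> s sI; rewrite normrN; exact: bB.
  - move: dX; apply: filterS; first exact: (ae_filter_ringOfSetsType mu).
    move=> s dXs sI; have {}dXs := dXs sI.
    move: sI; rewrite in_itv/= => /andP[u0 u1]; have sI : 0 <= s <= tau by rewrite !ltW.
    have [b1 b2] := XB _ sI; have [ex _ _] := H (X s, t - s) I b1 b2.
    have dth : is_derive s 1 (fun u : R => t - u) (- 1 : R).
      by rewrite -[X in is_derive _ _ _ X]add0r; apply: is_deriveB.
    have dF := @is_derive_chain _ _ setT phi _ _ X (fun u => t - u) s _ _ ex dXs dth (@filterT _ (nbhs (0 : R)) _).
    exists (- (edot (D (X s, t - s)) (drift (X s) (t - s) (a s)) + d (X s, t - s) * -1)).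
      exact: is_deriveN.
    have tsI : 0 <= t - s <= T by exact: time_left sI taut tT.
    have aI : ctrl_set (a s) by apply: la; rewrite in_itv/= !ltW.
    have := Hc (X s, t - s) (a s) aI tsI b1 b2.
    by rewrite /= mulrN1; move: (edot _ _) (d _) (running_cost _ _ _) => v1 v2 v3; lra.
move: h; move: (phi _) (phi _) (jcost _ _ _ _) => v1 v2 v3.
rewrite mulNr; move: (c * tau) => v4; lra.
Qed.

(** The moduli in (C1) and (C2) are uniform in the control, so one box serves all controls. *)
Lemma rate_uniform i (p : V * R) c0 c : test phi D d setT p -> c < c0 -> 0 <= p.2 <= T ->
  (closure (dom (reg P i)) p.1 -> forall al : ctrl (reg P i), c0 <= rate D d p al) ->
  exists2 rad, 0 < rad & forall (q : V * R) (al : ctrl (reg P i)), stset P i q ->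
    `|q.1 - p.1| < rad -> `|q.2 - p.2| < rad -> c <= rate D d q al.
Proof.
move=> tp cc pI Hp; have [cl|ncl] := pselect (closure (dom (reg P i)) p.1); last first.
  have np : nbhs p.1 (~` closure (dom (reg P i))).
    by apply: open_nbhs_nbhs; split=> //; apply: closed_openC; exact: closed_closure.
  move: np => /nbhs_ballP[e /= e0 H]; exists e => // q al [cq _] q1 _; exfalso.
  by have := H q.1; rewrite -ball_normE /= distrC => /(_ q1); exact.
have sp : stset P i p by [].
have M0 := st_M0 S; have L0 := st_L0 S; have [_ nD nd] := tp.
(* Four terms vary with the point: [D], the dynamics, [d] and the cost. *)
pose g := (c0 - c) / 4; have g0 : 0 < g by rewrite divr_gt0// subr_gt0.
have NM : 0 < N%:R * M + 1 by rewrite ltr_wpDl// mulr_ge0// ltW.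
have ND : 0 < N%:R * `|D p| * (2 * L) + 1.
  by rewrite ltr_wpDl// !mulr_ge0// ltW.
have e1 : 0 < g / (N%:R * M + 1) by rewrite divr_gt0.
have [ra ra0 Ha] := (box_near _ _).1 (nD _ e1).
have [rb rb0 Hb] := (box_near _ _).1 (nd _ g0).
have [rc rc0 Hcst] := cost_uniform S i g0.
pose rad := Num.min (Num.min ra rb) (Num.min rc (g / (N%:R * `|D p| * (2 * L) + 1))).
exists rad; first by rewrite !lt_min ra0 rb0 rc0 divr_gt0.
move=> q al sq; rewrite !lt_min => /andP[/andP[a1 b1] /andP[c1 d1]].
move=> /andP[/andP[a2 b2] /andP[c2 d2]].
have hD := Ha q a1 a2 I; have hd := Hb q b1 b2 I.
have hc : `|cost q.1 q.2 al - cost p.1 p.2 al| < g by apply: Hcst => //; rewrite mdistxx.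
have hdyn := st_lip S al sq sp.
have hp := Hp cl al.
have E : rate D d q al - rate D d p al = edot (D q - D p) (dyn q.1 q.2 al) +
    edot (D p) (dyn q.1 q.2 al - dyn p.1 p.2 al) - (d q - d p) + (cost q.1 q.2 al - cost p.1 p.2 al).
  by rewrite /rate edotBl edotBr; ring.
have t1 : `|edot (D q - D p) (dyn q.1 q.2 al)| <= g.
  rewrite (le_trans (edot_le _ _))//.
  rewrite (@le_trans _ _ ((N%:R * M + 1) * (g / (N%:R * M + 1))))//; last first.
    by rewrite mulrCA divff ?mulr1// gt_eqF.
  rewrite mulrAC ler_pM ?mulr_ge0//.
  by rewrite ler_wpDr// ler_wpM2l// (st_dyn S).
have t2 : `|edot (D p) (dyn q.1 q.2 al - dyn p.1 p.2 al)| <= g.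
  rewrite (le_trans (edot_le _ _))//.
  rewrite (@le_trans _ _ (N%:R * `|D p| * (2 * L) * (g / (N%:R * `|D p| * (2 * L) + 1))))//.
    rewrite -[leRHS]mulrA; apply: ler_wpM2l; first by rewrite mulr_ge0.
    apply: (le_trans hdyn); move: (g / _) d1 d2 => w d1 d2.
    have -> : 2 * L * w = L * (w + w) by ring.
    by rewrite ler_wpM2l ?(ltW L0)// lerD// ltW.
  by rewrite mulrCA ler_piMr ?(ltW g0)// ler_pdivrMr// mul1r lerDl.
have := ler_norm (- edot (D q - D p) (dyn q.1 q.2 al)).
have := ler_norm (- edot (D p) (dyn q.1 q.2 al - dyn p.1 p.2 al)).
rewrite !normrN; have gE : c0 = c + 4 * g by rewrite /g; field.
move: hd hc t1 t2 hp E; rewrite gE ler_norml ltr_norml.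
move: (rate _ _ _ _) (rate _ _ _ _) (edot _ _) (edot _ _) (d q - d p) (cost _ _ _ - cost _ _ _).
move=> v1 v2 v3 v4 v5 v6 /andP[u1 u2] /andP[u3 u4] u5 u6 u7 u8 u9 u10.
clear - u1 u2 u3 u4 u5 u6 u7 u8 u9 u10; lra.
Qed.

(** On the interface the rate is a convex combination of the two one-sided rates, so a lower bound
    on both is required; this is how the maximum of the Hamiltonians arises. *)
Lemma rate_drift (q : V * R) (al : ctl) c : ctrl_set al -> 0 <= q.2 <= T ->
  (forall i (be : ctrl (reg P i)), stset P i q -> c <= rate D d q be) ->
  c <= edot (D q) (drift (P:=P) q.1 q.2 al) - d q + running_cost (P:=P) q.1 q.2 al.
Proof.
move=> /andP[m0 m1] qI H; have [Dq|Dq|Gq] := tricho S q.1.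
- rewrite (drift_dom S (i:=true))// (running_cost_dom S (i:=true))//.
  by apply: (H true); split=> //; exact: subset_closure.
- rewrite (drift_dom S (i:=false))// (running_cost_dom S (i:=false))//.
  by apply: (H false); split=> //; exact: subset_closure.
rewrite (drift_iface S)// (running_cost_iface S)//.
have h1 : c <= rate D d (i:=true) q al.1.1.
  by apply: H; split=> //; exact: (iface_closure S true).
have h2 : c <= rate D d (i:=false) q al.1.2.
  by apply: H; split=> //; exact: (iface_closure S false).
have -> : edot (D q) (dyn_iface (P:=P) q.1 q.2 al) - d q + cost_iface (P:=P) q.1 q.2 al =
    al.2 * rate D d (i:=true) q al.1.1 + (1 - al.2) * rate D d (i:=false) q al.1.2.
  rewrite /rate /dyn_iface /cost_iface /= edotDr !edotZr; ring.
have -> : c = al.2 * c + (1 - al.2) * c by ring.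
by rewrite lerD// ler_wpM2l// subr_ge0.
Qed.

End Super.

Section Supersolution.
Context {R : realType} {N : nat} (P : control_problem R N) (M L : R).
Local Notation V := 'rV[R]_N.
Local Notation T := (horizon P).
Hypothesis S : standing P M L.

(** The rate stays above [c = c0 / 2] for all controls near [p], so along every trajectory [phi]
    plus cost increases by at least [c * tau]. With minimality at [p], the infimum over trajectories
    exceeds the envelope by almost [c * tau] at every nearby start, yet some nearby points have
    values close to the envelope. *)
Lemma super_core r (phi : V * R -> R) (p : V * R) c0 : C1_cylinder P phi -> cylinder P p ->
  (\forall q \near p, lsc_env P (value P r) p - phi p <= lsc_env P (value P r) q - phi q) ->
  0 < c0 ->
  ~ (forall i, closure (dom (reg P i)) p.1 ->
       forall al : ctrl (reg P i), c0 <= rate (grad_x phi) (d_t phi) p al).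
Proof.
move=> C1p cp minp c00 Hr; have tp := C1_test C1p cp.
have pI : 0 <= p.2 <= T by case/andP: cp => /ltW -> /ltW ->.
have M0 := st_M0 S; have M1 : 0 < M + 1 by rewrite addr_gt0.
pose c := c0 / 2; have cc : c < c0 by rewrite ltr_pdivrMr// ltr_pMr// ltr1n.
have c_gt0 : 0 < c by rewrite divr_gt0.
have wB := domain_boundedN (value_domain_bounded S r).
have [rad1 [K te]] := test_tested tp.
have [rad2 rad20 H2] := rate_uniform S tp cc pI (Hr true).
have [rad3 rad30 H3] := rate_uniform S tp cc pI (Hr false).
have [e1 e10 H1] := (box_near _ _).1 minp.
have [e2 e20 H4] := (box_near _ _).1 (cylinder_near cp).
have /andP[p20 p2T] := cp; have [rad10 _ _] := te.
pose rad := Num.min (Num.min rad1 (Num.min rad2 rad3)) (Num.min (Num.min e1 e2) p.2).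
have rad0 : 0 < rad by rewrite !lt_min rad10 rad20 rad30 e10 e20.
have r1 : rad <= rad1 by rewrite !ge_min lexx.
have r2 : rad <= rad2 by rewrite !ge_min lexx !orbT.
have r3 : rad <= rad3 by rewrite !ge_min lexx !orbT.
have r4 : rad <= e1 by rewrite !ge_min lexx !orbT.
have r5 : rad <= e2 by rewrite !ge_min lexx !orbT.
have r6 : rad <= p.2 by rewrite !ge_min lexx !orbT.
have te' := testedW rad0 r1 te.
have Hc (q : V * R) (al : control P) : ctrl_set al -> 0 <= q.2 <= T ->
    `|q.1 - p.1| < rad -> `|q.2 - p.2| < rad ->
    c <= edot (grad_x phi q) (drift q.1 q.2 al) - d_t phi q + running_cost q.1 q.2 al.
  move=> alI qI q1 q2; apply: (rate_drift S) => // -[] be sq.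
    by apply: (H2 q be sq); [exact: lt_le_trans r2|exact: lt_le_trans r2].
  by apply: (H3 q be sq); [exact: lt_le_trans r3|exact: lt_le_trans r3].
pose tau := rad / 2 / (M + 1).
have tau0 : 0 < tau by rewrite !divr_gt0.
have ta3 : tau <= rad / 2.
  by rewrite ler_pdivrMr// ler_peMr ?divr_ge0 ?(ltW rad0)// lerDr ltW.
pose ep := c * tau / 4; have ep0 : 0 < ep by rewrite divr_gt0// mulr_gt0.
have bx : \forall q \near p, `|q.1 - p.1| < rad / 2 /\ `|q.2 - p.2| < rad / 2.
  by apply/box_near; exists (rad / 2); first by rewrite divr_gt0.
have cl : usc_env P (fun q => - value P r q) p - ep < usc_env P (fun q => - value P r q) p.
  by rewrite gtrBl.
have [[y t] [[[/= y2 t2] hphi] cq wq]] :=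
  usc_env_freq wB cp cl (nearS2 bx (test_cont tp I ep0) (@subset_refl _ _)).
have {}hphi := hphi I; have /andP[/= t0 tT] := cq.
have taut : tau <= t by exact: close_le t2 ta3 r6.
have tI : 0 <= tau <= t by rewrite (ltW tau0).
have tI' : 0 <= t <= T by rewrite !ltW.
have tauI : 0 <= tau <= tau by rewrite lexx ltW.
have low : phi (y, t) - phi p + lsc_env P (value P r) p + c * tau <= value P r (y, t).
  apply: lb_le_inf.
    by have [Xa tX] := trajs_ne S (reg_ptraj_ex S) r y tI'; exists (payoff t Xa); exists Xa.
  move=> _ [[X a] /(trajs_ptraj S _ _ _ _ tI') pX <-].
  have pX' := ptraj_restrict taut pX.
  have XB := short_ptraj S pX' y2 t2 (lexx _).
  have g := verification_ae S te' tI (ltW tT) pX' XB Hc.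
  have [n1 n2] := XB _ tauI.
  have mn := H1 (X tau, t - tau) (lt_le_trans n1 r4) (lt_le_trans n2 r4).
  have ce := H4 (X tau, t - tau) (lt_le_trans n1 r5) (lt_le_trans n2 r5).
  have := usc_env_ge wB ce; have := value_ge S tI (ltW tT) pX.
  move: mn g; rewrite (lsc_envE _ _ (X tau, t - tau)).
  move: (usc_env _ _ _) (value P r _) (payoff _ _) (jcost _ _ _ _) (phi _) (phi _) (phi _) (lsc_env _ _ _).
  by move=> v1 v2 v3 v4 v5 v6 v7 v8 u1 u2 u3 u4; clear - u1 u2 u3 u4; lra.
move: low hphi wq; rewrite lsc_envE ler_norml.
have -> : c * tau = 4 * ep by rewrite /ep; field.
move: (usc_env _ _ _) (value P r _) (phi _) (phi _) => v1 v2 v3 v4 u1 /andP[u2 u3] u4.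
clear - ep0 u1 u2 u3 u4; lra.
Qed.

Lemma Ham_ge i (al : ctrl (reg P i)) z s v : spacetime (reg P i) T z s ->
  - edot (dyn z s al) v - cost z s al <= Ham (reg P i) z s v.
Proof.
move=> st; apply: ub_le_sup; last by exists al.
exists (N%:R * M * `|v| + M) => _ [be _ <-]; have M0 := st_M0 S.
have := st_cost S be st; have := edot_le (dyn z s be) v; have := st_dyn S be st.
rewrite !ler_norml => hb /andP[h1 _] /andP[h3 _].
have h4 : N%:R * `|dyn z s be| * `|v| <= N%:R * M * `|v|.
  by rewrite ler_wpM2r// ler_wpM2l// ler_norml.
by move: h1 h3 h4; move: (edot _ _) (cost _ _ _) (_ * `|v|) (_ * `|v|) => u1 u2 u3 u4; lra.
Qed.

Lemma value_super r : supersolution P (lsc_env P (value P r)).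
Proof.
have wB := value_domain_bounded S r; split.
- exact: (lsc_env_bounded wB).
- exact: (lsc_env_lsc wB).
move=> phi p C1p cp minp h1 h2.
have pI : 0 <= p.2 <= T by case/andP: cp => /ltW -> /ltW ->.
pose h i := Ham (reg P i) p.1 p.2 (grad_x phi p).
have key (x : R) : (forall i, closure (dom (reg P i)) p.1 -> h i <= x) -> 0 <= d_t phi p + x.
  move=> Hx; rewrite leNgt; apply/negP => neg.
  have c0 : 0 < - (d_t phi p + x) by rewrite oppr_gt0.
  apply: (super_core C1p cp minp c0) => i cl al.
  have := Ham_ge al (grad_x phi p) (conj cl pI); have := Hx i cl.
  rewrite /h /rate (edotC (grad_x phi p)).
  by move: (Ham _ _ _ _) (edot _ _) (cost _ _ _) => u1 u2 u3; lra.
have inside i : dom (reg P i) p.1 -> 0 <= d_t phi p + h i.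
  move=> Dp; apply: key => j /(closure_dom S); case=> [Dj|Gp].
    by move: Dp Dj; case: (i); case: j => // u1 u2; exfalso;
      [exact: (dom_disj S u1 u2)|exact: (dom_disj S u2 u1)].
  by exfalso; move: Dp; case: (i) => u; [exact: (iface_notin1 S Gp)|exact: (iface_notin2 S Gp)].
split; [exact: (inside true)|exact: (inside false)|].
move=> Gp; apply: key => -[] _; by rewrite le_max lexx ?orbT.
Qed.

End Supersolution.

Theorem theorem3p3 (R : realType) (N : nat) (N_gt0 : (0 < N)%N)
    (P : control_problem R N) (T_gt0 : 0 < horizon P)
    (g_bounded : [bounded terminal P x | x in [set: 'rV[R]_N]])
    (g_continuous : continuous (terminal P))
    (geometry : H_Omega P) (controls : control_assumptions P) :
  [/\ viscosity_solution P (Uminus P),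
      viscosity_solution P (Uplus P),
      iface_subsolution P (HT P) (usc_env P (Uminus P)) &
      iface_subsolution P (HTreg P) (usc_env P (Uplus P))].
Proof.
have [M [L S]] := standing_ex T_gt0 g_bounded geometry controls.
split.
(* [Uminus] and [Uplus] unfold to [value P false] and [value P true]. *)
- by split; [exact: (value_sub S false)|exact: (value_super S false)].
- by split; [exact: (value_sub S true)|exact: (value_super S true)].
- exact: (@value_iface_sub _ _ _ _ _ S false).
- exact: (@value_iface_sub _ _ _ _ _ S true).
Qed.
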